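(* Let $p\in(0,1)$ and $\lambda>0$ be fixed, and consider the two-community stochastic block model with community proportions $p,1-p$, equal average degrees $d$ and signal strength $\lambda=d\epsilon^2$. Let $\lambda_c(p)$ be the threshold defined in the context. (1) If $\lambda>\lambda_c(p)$, then the community detection problem is solvable (in the limit of large degrees). (2) If $\lambda<\lambda_c(p)$, then the community detection problem is not solvable.
   Context: **Model.** For $d>0$ let $\epsilon=\sqrt{\lambda/d}$ and $a=1+\frac{1-p}{p}\epsilon$, $b=1-\epsilon$, $c=1+\frac{p}{1-p}\epsilon$ (so that $pa+(1-p)b=pb+(1-p)c=1$ and $\lambda=d(1-b)^2$). Let $M=\frac dn\begin{pmatrix} a & b \\ b & c \end{pmatrix}$; $d$ and $n$ are taken large enough that the entries of $M$ lie in $[0,1]$. The random graph $\mathbf G$ on vertex set $\{1,\dots,n\}$ is generated as follows: labels $X_1,\dots,X_n\in\{1,2\}$ are i.i.d. with $\mathbb{P}(X_i=1)=p$; conditionally on $\mathbf X=(X_1,\dots,X_n)$, the edge indicators $G_{i,j}$, $i<j$, are independent Bernoulli variables with means $M_{X_i,X_j}$. **Solvability.** An estimator is a function $\mathbf G\mapsto\mathbf x(\mathbf G)\in\{1,2\}^n$ (given for all $n,d$) that may depend on auxiliary randomness independent of $\mathbf X$. For $\mathbf x\in\{1,2\}^n$ and $i\in\{1,2\}$ let $S_i(\mathbf x)=\{k: x_k=i\}$. For $\mathbf x,\mathbf y\in\{1,2\}^n$, the community overlap is $$\mathrm{overlap}(\mathbf x,\mathbf y)=\frac1n\max_\sigma\sum_{i=1,2}\Big(\#\big(S_i(\mathbf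 x)\cap S_{\sigma(i)}(\mathbf y)\big)-\frac1n\#S_i(\mathbf x)\,\#S_{\sigma(i)}(\mathbf y)\Big),$$ the maximum being over permutations $\sigma$ of $\{1,2\}$. The community detection problem is solvable if there exists an estimator with $$\liminf_{d\to\infty}\liminf_{n\to\infty}\mathbb{E}\big[\mathrm{overlap}(\mathbf x(\mathbf G),\mathbf X)\big]>0$$ (with $p,\lambda$ fixed). **Threshold.** Let $P_0$ be the distribution with $P_0\big(\sqrt{(1-p)/p}\big)=p$ and $P_0\big(-\sqrt{p/(1-p)}\big)=1-p$ (mean $0$, variance $1$), and for $\lambda,q\ge 0$ $$\mathcal F(\lambda,q)=-\frac{\lambda}{4}q^2+\mathbb{E}\log\left(\int dP_0(x)\exp\Big(\sqrt{\lambda q}\,Zx+\lambda q\,xX-\frac{\lambda}{2}q x^2\Big)\right),$$ with $Z\sim\mathcal N(0,1)$, $X\sim P_0$ independent. Let $D\subset(0,\infty)$ be the set of $\lambda$ at which $\lambda\mapsto\sup_{q\ge0}\mathcal F(\lambda,q)$ is differentiable; for $\lambda\in D$ the maximizer $q^*(\lambda)$ of $q\ge0\mapsto\mathcal F(\lambda,q)$ is unique. Then $\lambda_c(p)=\sup\{\lambda\in D\ |\ q^*(\lambda)=0\}$. *)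

(* Defs.v *)
From HB Require Import structures.
From mathcomp Require Import all_boot all_order all_algebra all_fingroup.
From mathcomp Require Import all_classical all_reals all_analysis.

Set Implicit Arguments.
Unset Strict Implicit.
Unset Printing Implicit Defensive.

Import Order.TTheory GRing.Theory Num.Theory.
Import numFieldNormedType.Exports.

Local Open Scope classical_set_scope.
Local Open Scope ring_scope.

(** ** The stochastic block model *)

(* The labels 1 and 2 are [ord0 : 'I_2] and [ord_max : 'I_2]; the vertices
   1, ..., n are the elements of ['I_n]. *)
Definition labeling (n : nat) := {ffun 'I_n -> 'I_2}.

Definition vertex_pair (n : nat) := {e : 'I_n * 'I_n | (e.1 < e.2)%N}.

Definition graph (n : nat) := {ffun vertex_pair n -> bool}.

Section Sbm.
Context {R : realType}.
Implicit Types (p lambda d : R) (n : nat).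

Definition epsilon lambda d : R := Num.sqrt (lambda / d).

Definition connectivity p lambda d n : 'M[R]_2 :=
  let a := 1 + (1 - p) / p * epsilon lambda d in
  let b := 1 - epsilon lambda d in
  let c := 1 + p / (1 - p) * epsilon lambda d in
  (d / n%:R) *:
    \matrix_(i, j) (if i != j then b else if i == ord0 then a else c).

Definition labeling_mass p n (X : labeling n) : R :=
  \prod_(i < n) (if X i == ord0 then p else 1 - p).

(* Conditional law of the graph given the labels. *)
Definition graph_mass p lambda d n (X : labeling n) (G : graph n) : R :=
  \prod_(e : vertex_pair n)
    let m := connectivity p lambda d n (X (val e).1) (X (val e).2) in
    if G e then m else 1 - m.

(* Joint law of (X, G).  It is a probability mass function as soon as the
   entries of the connectivity matrix lie in [0, 1], which holds for d large
   and then n large. *)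
Definition sbm_mass p lambda d n (X : labeling n) (G : graph n) : R :=
  labeling_mass p X * graph_mass p lambda d X G.

End Sbm.

(** ** Overlap, estimators and solvability *)

Definition community n (i : 'I_2) (x : labeling n) : {set 'I_n} :=
  [set k | x k == i]%SET.

Section Solvability.
Context {R : realType}.
Implicit Types (p lambda d : R) (n : nat).

Definition overlap_sum n (x y : labeling n) (s : 'S_2) : R :=
  \sum_(i : 'I_2)
    ((#|community i x :&: community (s i) y|%SET)%:R
     - n%:R^-1 * (#|community i x|)%:R * (#|community (s i) y|)%:R).

(* The iterated maximum is seeded with the value at the identity permutation,
   which is one of the terms. *)
Definition overlap n (x y : labeling n) : R :=
  n%:R^-1 * \big[Num.max/overlap_sum x y 1%g]_(s : 'S_2) overlap_sum x y s.

(* A randomized estimator on n vertices: a function of the observed graph and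
   of an auxiliary seed drawn from an arbitrary probability space. *)
Record estimator (n : nat) := Estimator {
  seed_display : measure_display ;
  seed : measurableType seed_display ;
  seed_law : probability seed R ;
  estimate : graph n -> seed -> labeling n ;
  measurable_estimate : forall (G : graph n) (x : labeling n),
    measurable [set u | estimate G u = x]
}.
Arguments estimate {n} e G u.

(* The seed is independent of the pair (X, G): the expectation is taken under
   the product of the joint law of (X, G) and the law of the seed. *)
Definition expected_overlap p lambda d n (est : estimator n) : \bar R :=
  (\sum_(X : labeling n) \sum_(G : graph n)
    (sbm_mass p lambda d X G)%:E *
    'E_(seed_law est)[fun u => overlap (estimate est G u) X])%E.

Definition solvable_sbm p lambda : Prop :=
  exists est : forall (d : R) (n : nat), estimator n,
    (0%E < limf_einf
       (fun d : R =>
          limn_einf (fun n : nat => expected_overlap p lambda d (est d n)))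
       (pinfty_nbhs R))%E.

End Solvability.

(** ** The threshold *)

Section Threshold.
Context {R : realType}.
Implicit Types (p lambda q : R).

Definition P0_atom p (b : bool) : R :=
  if b then Num.sqrt ((1 - p) / p) else - Num.sqrt (p / (1 - p)).

Lemma measurable_P0_atom p : measurable_fun [set: bool] (P0_atom p).
Proof. by []. Qed.

HB.instance Definition _ p :=
  @isMeasurableFun.Build _ _ bool R (P0_atom p) (measurable_P0_atom p).

Definition P0 p : probability R R :=
  distribution (bernoulli_prob p) (P0_atom p).

(* The pair w is (Z, X), with Z standard normal and X of law P0,
   independent. *)
Definition free_energy p lambda q : R :=
  - (lambda / 4) * q ^+ 2 +
  \int[(normal_prob 0 1 \x P0 p)%E]_w
    ln (\int[P0 p]_x
          expR (Num.sqrt (lambda * q) * w.1 * x + lambda * q * x * w.2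
                - lambda / 2 * q * x ^+ 2)).

Definition sup_free_energy p lambda : R :=
  sup [set free_energy p lambda q | q in [set q : R | 0 <= q]].

Definition differentiability_set p : set R :=
  [set lambda | 0 < lambda /\ derivable (sup_free_energy p) lambda 1].

Definition maximizers p lambda : set R :=
  [set q | 0 <= q /\
    forall q', 0 <= q' -> free_energy p lambda q' <= free_energy p lambda q].

(* "q is q^*(lambda)", the unique maximizer; stated as a predicate so that no
   default value is involved when there is not exactly one maximizer. *)
Definition is_q_star p lambda q : Prop := maximizers p lambda = [set q].

(* Taken in the extended reals, so that no default value is involved. *)
Definition lambda_c p : \bar R :=
  ereal_sup [set lambda%:E | lambda in
    [set lambda | differentiability_set p lambda /\ is_q_star p lambda 0]].

End Threshold.
Arguments estimator R n : clear implicits.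

(* Main.v *)
(* Let x_i be the standardized label of vertex i: sqrt((1-p)/p) for label 1 and -sqrt(p/(1-p)) for
   label 2.  The edge {i,j} has mean (d/n)(1 + eps x_i x_j), so the posterior of the labels given G is
   proportional to post(X) = P(X) prod_e (1 + xi_e x_i x_j), where xi_e is centred when the edges are
   independent of the labels.  Averaging a functional of post over this null model is a product of
   commuting operators, one per edge, each replacing a weight v by v(1 + xi x_i x_j).  Guerra's
   interpolation, carried out on these operators, replaces the edges by many small symmetric steps at
   the vertices; each vertex then performs a random walk that converges to a Gaussian channel with
   signal-to-noise ratio lambda q.  With F = free_energy and Z = sum_X post(X), this gives, to first
   order in the exponent and for small r and s,
     E_null sum_X post(X) (sum_(x : R(X,x) near q) post(x))^r <= exp (n r F(q)),
     E_null Z^(1-s) <= exp (- n s F(q)),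
   where R(X,x) = n^-1 sum_i X_i x_i.

   If F(q) <= - c q^2 for all q >= 0, the first bound excludes overlaps R > 0 between two posterior
   samples; as R has nonnegative mean, E|R| -> 0, and a second-moment argument then bounds the overlap
   of every estimator.  If F(q) > 0 for some q, the second bound makes Z exponentially large, while the
   first one at q = 0 makes the mass of the pairs with R near 0 at most of order 1 before division by Z.
   So |R| is bounded away from 0, and the Bayes estimator does at least as well as a posterior sample.

   Finally F(q) + (lambda q)^2 / (4 lambda) depends on lambda q only: if F <= 0 at some lambda', then at
   every lambda < lambda' there is a quadratic gap F(q) <= - c q^2, and 0 is the unique maximizer.
   Hence lambda_c separates the two cases. *)
Require Import Defs.
From HB Require Import structures.
From mathcomp Require Import all_boot all_order all_algebra all_fingroup.
From mathcomp Require Import all_classical all_reals all_analysis.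
From mathcomp Require Import measurable_realfun ring lra.

Set Implicit Arguments.
Unset Strict Implicit.
Unset Printing Implicit Defensive.

Import Order.TTheory GRing.Theory Num.Theory.
Import numFieldNormedType.Exports.

Local Open Scope classical_set_scope.
Local Open Scope ring_scope.

(** * Second-order expansions of averages over channels *)

Section Taylor.
Context {R : realType}.
Implicit Types (r x y : R).

(** The interpolation is discrete, without a time derivative. To second order a centred channel
    multiplies the functional by 1 plus its variance times [ell], so edge and node channels are
    compared variance against variance. Done for all edges at once, this has an error quadratic in
    the number of edges; so each edge is first split into [M] rarely active copies, and rounds of
    copies are exchanged one by one for rounds of node steps. For large [M] the error of order n
    comes from third moments: each is of order lambda eps / n, so n lambda eps over n^2 edges, small
    against n because eps^2 = lambda / d tends to 0. The exponent r <= 1 gives the two-replica part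
    of [ell] a sign that a square can control. The planted part has the opposite sign, and is
    controlled by restricting the inner sum to R near q. Small r (or 1 - r) makes second-order terms
    in the exponent negligible against the free energy, whose channel part is the derivative of log
    E Z^(1+r) at r = 0. *)

Lemma norm_le_of_derive (f df : R -> R) (h C : R) (n : nat) : f 0 = 0 ->
  (forall x, `|x| <= h -> is_derive x 1 f (df x)) ->
  (forall x, `|x| <= h -> `|df x| <= C * `|x| ^+ n) ->
  forall x, `|x| <= h -> `|f x| <= C * `|x| ^+ n.+1.
Proof.
move=> f0 fd dfle.
have C0 x : `|x| <= h -> 0 <= C * `|x| ^+ n by move=> /dfle; exact: le_trans.
have key a b : a <= b -> (forall z, a <= z <= b -> `|z| <= h) ->
    exists2 c, a <= c <= b & f b - f a = df c * (b - a).
  move=> ab zh.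
  have [||c] := @MVT_segment R f df a b ab.
  - by move=> x; rewrite in_itv/= => /andP[? ?]; apply/fd/zh; rewrite !ltW.
  - apply: derivable_within_continuous => x; rewrite in_itv/= => xab.
    by case: (fd x (zh _ xab)).
  - by rewrite in_itv/= => cab e; exists c.
have nn : {homo (fun t : R => t ^+ n) : x y / 0 <= x <= y >-> x <= y}.
  by move=> u v /andP[u0 uv]; rewrite lerXn2r// nnegrE//; exact: le_trans uv.
have fin c x : `|x| <= h -> `|c| <= `|x| -> `|df c| <= C * `|x| ^+ n.
  move=> xh cx; have ch := le_trans cx xh; apply: (le_trans (dfle _ ch)).
  (* [C] has no sign hypothesis; its nonnegativity is read off the bound at [c], which requires
     [c != 0]. *)
  have [->|c0] := eqVneq c 0.
    case: n {nn dfle} C0 => [|n] C0; first by rewrite !expr0.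
    by rewrite normr0 expr0n/= mulr0 C0.
  apply: ler_wpM2l; last by apply: nn; rewrite normr_ge0.
  by have := C0 _ ch; rewrite pmulr_lge0// exprn_gt0// normr_gt0.
move=> x xh; rewrite exprSr mulrA.
have [x0|/ltW x0] := leP 0 x.
  have [|c /andP[c0 cx]] := key 0 x x0.
    move=> z /andP[z0 zx]; rewrite ger0_norm//; apply: le_trans xh.
    by rewrite (ger0_norm x0).
  rewrite f0 !subr0 => ->; rewrite normrM ler_wpM2r//; apply: fin => //.
  by rewrite !ger0_norm.
have [|c /andP[cx c0]] := key x 0 x0.
  move=> z /andP[xz z0]; rewrite ler0_norm//; apply: le_trans xh.
  by rewrite (ler0_norm x0) lerN2.
rewrite f0 !sub0r => /eqP; rewrite eqr_oppLR mulrN opprK => /eqP ->.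
rewrite normrM ler_wpM2r//; apply: fin => //.
by rewrite !ler0_norm// lerN2.
Qed.

Lemma is_derive_powR1D r x : - 1 < x ->
  is_derive x 1 (fun y => (1 + y) `^ r) (r * (1 + x) `^ (r - 1)).
Proof.
move=> x1; have x0 : 0 < 1 + x by lra.
have h1 : is_derive (1 + x) 1 (@powR R ^~ r) (r * (1 + x) `^ (r - 1)).
  apply: DeriveDef.
    by apply: derivable_powR; rewrite in_itv/= x0.
  by rewrite -derive1E powR_derive1// in_itv/= x0.
have -> : (fun y => (1 + y) `^ r) = (@powR R ^~ r) \o (fun y => 1 + y) by [].
have h2 : is_derive x 1 (fun y : R => 1 + y) 1.
  have := @is_deriveD R R R (cst 1) id x 1 0 1 _ _; rewrite add0r; exact.
have := @is_derive1_comp R (@powR R ^~ r) (fun y => 1 + y) x _ _ h1 h2.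
by rewrite mulr1.
Qed.

(** The third derivative is at most 4 * 18 on [-1/2, 1/2], and three applications of the mean value
    theorem keep this constant. The range of [r] reaches 2 because the walks at the vertices carry
    the exponent [1 + r]. *)
Lemma powR1D_taylor r y : 0 < r <= 2 -> `|y| <= 1 / 2 ->
  `|(1 + y) `^ r - 1 - r * y - r * (r - 1) / 2 * y ^+ 2| <= 72 * `|y| ^+ 3.
Proof.
move=> /andP[r0 r2].
have x1 x : `|x| <= 1 / 2 -> - 1 < x by rewrite ler_norml => /andP[? _]; lra.
pose f3 x := r * (r - 1) * (r - 2) * (1 + x) `^ (r - 3).
pose f2 x := r * (r - 1) * (1 + x) `^ (r - 2) - r * (r - 1).
pose f1 x := r * (1 + x) `^ (r - 1) - r - r * (r - 1) * x.
have b3 x : `|x| <= 1 / 2 -> `|f3 x| <= 72 * `|x| ^+ 0.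
  move=> xh; have xx := x1 _ xh; have px : 0 < 1 + x by lra.
  rewrite expr0 mulr1 /f3 normrM (ger0_norm (powR_ge0 _ _)).
  have h1 : `|r * (r - 1) * (r - 2)| <= 4.
    rewrite !normrM (ger0_norm (ltW r0)).
    have a : `|r - 1| <= 1 by rewrite ler_norml; apply/andP; split; lra.
    have b : `|r - 2| <= 2 by rewrite ler_norml; apply/andP; split; lra.
    apply: (@le_trans _ _ (2 * 1 * 2)); last by lra.
    by rewrite !ler_pM// ?mulr_ge0// ltW.
  have h2 : (1 + x) `^ (r - 3) <= 18.
    rewrite powRB; last by rewrite (gt_eqF px) implybT.
    rewrite -[3]/(3%:R) powR_mulrn; last exact: ltW.
    rewrite ler_pdivrMr ?exprn_gt0//.
    have h : 1 / 2 <= 1 + x by move: xh; rewrite ler_norml; lra.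
    have h3 : 1 / 8 <= (1 + x) ^+ 3.
      have -> : 1 / 8 = (1 / 2) ^+ 3 :> R by lra.
      by rewrite lerXn2r// nnegrE; lra.
    have h4 : (1 + x) `^ r <= 9 / 4.
      have h5 : 1 + x <= 3 / 2 by move: xh; rewrite ler_norml; lra.
      apply: (@le_trans _ _ ((3/2) `^ r)).
        by rewrite ge0_ler_powR ?nnegrE; lra.
      apply: (@le_trans _ _ ((3/2) `^ 2)).
        by rewrite ler_powR//; lra.
      have -> : (3 / 2) `^ 2 = (3 / 2) ^+ 2 :> R by rewrite -powR_mulrn//; lra.
      lra.
    lra.
  apply: (@le_trans _ _ (4 * 18)); last by lra.
  by rewrite ler_pM// powR_ge0.
have b2 x : `|x| <= 1 / 2 -> `|f2 x| <= 72 * `|x| ^+ 1.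
  apply: (norm_le_of_derive _ _ b3).
    by rewrite /f2 addr0 powR1 mulr1 subrr.
  move=> z /x1 z1; have := is_derive_powR1D (r - 2) z1 => H.
  apply: is_derive_eq; rewrite /f3 subr0 -mulr_algl/=.
  rewrite (_ : r - 2 - 1 = r - 3); last by ring.
  by rewrite /GRing.scale/=; ring.
have b1 x : `|x| <= 1 / 2 -> `|f1 x| <= 72 * `|x| ^+ 2.
  apply: (norm_le_of_derive _ _ b2).
    by rewrite /f1 addr0 powR1 mulr1 subrr mulr0 subr0.
  move=> z /x1 z1; have := is_derive_powR1D (r - 1) z1 => H.
  apply: is_derive_eq; rewrite /f2.
  rewrite (_ : r - 1 - 1 = r - 2); last by ring.
  by rewrite /GRing.scale/=; ring.
apply: (norm_le_of_derive (f := fun y => (1 + y) `^ r - 1 - r * y - r * (r - 1) / 2 * y ^+ 2) _ _ b1).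
  by rewrite addr0 powR1 expr2 !mulr0 !subr0 subrr.
move=> z /x1 z1; have := is_derive_powR1D r z1 => H.
apply: is_derive_eq; rewrite /f1.
by rewrite /GRing.scale/=; field.
Qed.
(** Thresholds on [n] and [M] are given below as sums of nonnegative requirements; this splits them
    again. *)
Lemma le_terms4 (a b c e x : R) : 0 <= a -> 0 <= b -> 0 <= c -> 0 <= e ->
  a + b + c + e <= x -> [/\ a <= x, b <= x, c <= x & e <= x].
Proof. by move=> *; split; lra. Qed.

Lemma le_terms5 (a b c e f x : R) : 0 <= a -> 0 <= b -> 0 <= c -> 0 <= e -> 0 <= f ->
  a + b + c + e + f <= x -> [/\ a <= x, b <= x, c <= x, e <= x & f <= x].
Proof. by move=> *; split; lra. Qed.

Lemma le_half (x y : R) : 2 * x <= y -> x <= 1 / 2 * y.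
Proof. by move=> *; lra. Qed.

End Taylor.

Section Law.
Context {R : realType}.
Implicit Types (L : seq (R * R)) (f g : R -> R) (K x : R).

(* A finite law is a list of pairs (weight, value). *)
Definition Ex L f : R := \sum_(k <- L) k.1 * f k.2.

(** The last condition keeps every factor [1 + x * a] with [|a| <= K] between 1/2 and 3/2. *)
Definition mean_zero_law K L : Prop :=
  [/\ (forall k, k \in L -> 0 <= k.1), \sum_(k <- L) k.1 = 1, Ex L id = 0 &
      forall k, k \in L -> K * `|k.2| <= 1 / 2].

Lemma ExD L f g : Ex L (fun x => f x + g x) = Ex L f + Ex L g.
Proof. by rewrite /Ex -big_split; apply: eq_bigr => k _; rewrite mulrDr. Qed.

Lemma ExZ L c f : Ex L (fun x => c * f x) = c * Ex L f.
Proof. by rewrite /Ex mulr_sumr; apply: eq_bigr => k _; rewrite mulrCA. Qed.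

Lemma Ex_cst L c : \sum_(k <- L) k.1 = 1 -> Ex L (fun=> c) = c.
Proof. by move=> L1; rewrite /Ex -mulr_suml L1 mul1r. Qed.

Lemma le_Ex L f g : (forall k, k \in L -> 0 <= k.1) ->
  (forall k, k \in L -> f k.2 <= g k.2) -> Ex L f <= Ex L g.
Proof. by move=> L0 fg; rewrite /Ex !big_seq; apply: ler_sum => k kL; rewrite ler_wpM2l ?L0 ?fg. Qed.

Lemma norm_Ex_le L f : (forall k, k \in L -> 0 <= k.1) ->
  `|Ex L f| <= Ex L (fun x => `|f x|).
Proof.
move=> L0; apply: le_trans (ler_norm_sum _ _ _) _.
by rewrite /Ex !big_seq; apply: ler_sum => k kL; rewrite normrM ger0_norm ?L0.
Qed.

Definition mom1 L := Ex L (fun x => `|x|).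
Definition mom2 L := Ex L (fun x => x ^+ 2).
Definition mom3 L := Ex L (fun x => `|x| ^+ 3).

Lemma mom_ge0 K L : mean_zero_law K L -> [/\ 0 <= mom1 L, 0 <= mom2 L & 0 <= mom3 L].
Proof.
case=> L0 _ _ _; have h f : (forall x, 0 <= f x) -> 0 <= Ex L f.
  by move=> f0; rewrite /Ex big_seq; apply: sumr_ge0 => k /L0 k0; exact: mulr_ge0.
by split; apply: h => x; rewrite ?sqr_ge0 ?exprn_ge0.
Qed.

Lemma mom_le K L : 1 <= K -> mean_zero_law K L -> mom3 L <= mom2 L /\ mom2 L <= mom1 L.
Proof.
move=> K1 [L0 L1 _ LK].
have k1 k : k \in L -> `|k.2| <= 1.
  move=> /LK h; apply: le_trans (_ : K * `|k.2| <= 1); last by lra.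
  by rewrite ler_peMl.
split; apply: le_Ex => // k kL; have := k1 k kL; have := normr_ge0 k.2.
  by rewrite -(@real_normK _ k.2) ?num_real// => h0 h1; rewrite [leLHS]exprS ler_piMl ?exprn_ge0.
by rewrite -(@real_normK _ k.2) ?num_real// => h0 h1; rewrite [leLHS]expr2 ler_piMl.
Qed.
End Law.

(** * Commuting operators on functionals of a weight *)

Section Channels.
Context {R : realType} (Om : finType).
Implicit Types (v a b : Om -> R) (F G : (Om -> R) -> R) (x K r : R).

Definition chan : Type := ((Om -> R) * seq (R * R))%type.

(* The channel [(a, L)] replaces a weight [v] by [v * (1 + x * a)], with [x] of law [L]. *)
Definition tilt a x v : Om -> R := fun w => v w * (1 + x * a w).

Definition op (c : chan) F : (Om -> R) -> R :=
  fun v => Ex c.2 (fun x => F (tilt c.1 x v)).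

Definition ops (l : seq chan) F := foldr op F l.

Definition good_chan K (c : chan) : Prop :=
  (forall w, `|c.1 w| <= K) /\ mean_zero_law K c.2.

Definition pos v := forall w, 0 < v w.

Definition leF F G := forall v, pos v -> F v <= G v.

Lemma xa_half K a x w : (forall w, `|a w| <= K) -> K * `|x| <= 1 / 2 -> `|x * a w| <= 1 / 2.
Proof.
move=> aK xK; rewrite normrM; apply: le_trans xK.
by rewrite mulrC ler_wpM2r.
Qed.

Lemma tilt_pos K a x v : (forall w, `|a w| <= K) -> K * `|x| <= 1 / 2 ->
  pos v -> pos (tilt a x v).
Proof.
move=> aK xK v0 w; rewrite mulr_gt0//.
by have := xa_half w aK xK; rewrite ler_norml => /andP[? ?]; lra.
Qed.

Lemma op_le K c F G : good_chan K c -> leF F G -> leF (op c F) (op c G).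
Proof.
move=> [aK [L0 L1 _ LK]] FG v v0; apply: le_Ex => // k kL.
by apply: FG; apply: tilt_pos v0 => //; exact: LK.
Qed.

Lemma ops_le K l F G : (forall c, List.In c l -> good_chan K c) -> leF F G ->
  leF (ops l F) (ops l G).
Proof.
elim: l => [//|c l IH] lK FG; apply: (@op_le K); first by apply: lK; left.
by apply: IH => // c' c'l; apply: lK; right.
Qed.

Lemma opZ c k F : op c (fun v => k * F v) = (fun v => k * op c F v).
Proof. by apply/funext => v; rewrite /op ExZ. Qed.

Lemma opsZ l k F : ops l (fun v => k * F v) = (fun v => k * ops l F v).
Proof. by elim: l => [//|c l IH] /=; rewrite -/(ops l _) IH opZ. Qed.

Lemma op_sum c (I : finType) (F : I -> (Om -> R) -> R) :
  op c (fun v => \sum_i F i v) = (fun v => \sum_i op c (F i) v).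
Proof.
apply/funext => v; rewrite /op /Ex exchange_big/=.
by apply: eq_bigr => k _; rewrite mulr_sumr.
Qed.

Lemma ops_sum l (I : finType) (F : I -> (Om -> R) -> R) :
  ops l (fun v => \sum_i F i v) = (fun v => \sum_i ops l (F i) v).
Proof. by elim: l => [//|c l IH] /=; rewrite -/(ops l _) IH op_sum. Qed.

Lemma ops_cat l1 l2 F : ops (l1 ++ l2) F = ops l1 (ops l2 F).
Proof. by rewrite /ops foldr_cat. Qed.

(** A weight is only ever multiplied pointwise, so the order of the channels is immaterial. The
    exchange of rounds in [ops_pw_le] rests on this. *)
Lemma op_comm c c' F : op c (op c' F) = op c' (op c F).
Proof.
apply/funext => v; rewrite /op /Ex.
under eq_bigr do rewrite mulr_sumr.
under [RHS]eq_bigr do rewrite mulr_sumr.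
rewrite exchange_big/=; apply: eq_bigr => k _; apply: eq_bigr => k' _.
rewrite mulrCA; congr (_ * (_ * F _)).
by apply/funext => w; rewrite /tilt mulrAC.
Qed.

Lemma ops_op_comm l c F : ops l (op c F) = op c (ops l F).
Proof. by elim: l => [//|c' l IH] /=; rewrite -/(ops l _) IH op_comm. Qed.

Lemma ops_comm l1 l2 F : ops l1 (ops l2 F) = ops l2 (ops l1 F).
Proof. by elim: l1 => [//|c l IH] /=; rewrite -!/(ops _ _) IH ops_op_comm. Qed.

End Channels.

(** * Response of the Gibbs functional to a single channel *)

Section Gibbs.
Context {R : realType} (Om : finType) (o : option Om) (S : {set Om}) (r K : R).
Hypotheses (r0 : 0 < r) (r1 : r <= 1) (K1 : 1 <= K).
Implicit Types (v a b : Om -> R) (x : R).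

Definition part v : R := \sum_(w in S) v w.

Definition spin a : R := if o is Some X then a X else 0.

(* [o = Some X] stands for a planted configuration [X], [o = None] for none. *)
Definition Phi v : R := (if o is Some X then v X else 1) * part v `^ r.

Definition avg a v : R := (\sum_(w in S) v w * a w) / part v.

(* The coefficient of [x ^ 2] in [gain a x v] below. *)
Definition ell a v : R := r * (spin a * avg a v + (r - 1) / 2 * avg a v ^+ 2).

Let K0 : 0 <= K. Proof. by apply: le_trans K1. Qed.

Ltac slra := generalize r0 r1 K1 K0; intros; lra.
Ltac snra := generalize r0 r1 K1 K0; intros; nra.

Lemma part_ge0 v : pos v -> 0 <= part v.
Proof. by move=> v0; apply: sumr_ge0 => w _; exact: ltW. Qed.

Lemma Phi_ge0 v : pos v -> 0 <= Phi v.
Proof.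
move=> v0; rewrite /Phi mulr_ge0 ?powR_ge0//.
by case: o => // X; exact: ltW.
Qed.

Lemma part_eq0 v : pos v -> part v = 0 -> forall a, \sum_(w in S) v w * a w = 0.
Proof.
move=> v0 /eqP; rewrite psumr_eq0; last by move=> w _; exact: ltW.
move=> /allP h a; apply: big1 => w wS.
by have /implyP/(_ wS) := h w (mem_index_enum _); rewrite gt_eqF.
Qed.

(** For an empty [S] both sides vanish; [avg] is then 0 through division by zero. *)
Lemma sum_avg v a : pos v -> \sum_(w in S) v w * a w = part v * avg a v.
Proof.
move=> v0; rewrite /avg; have [z|z] := eqVneq (part v) 0.
  by rewrite (part_eq0 v0 z) z mul0r.
by rewrite mulrC divfK.
Qed.

Lemma part_tilt v a x : pos v -> part (tilt a x v) = part v * (1 + x * avg a v).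
Proof.
move=> v0; rewrite /part /tilt; under eq_bigr do rewrite mulrDr mulr1 mulrCA.
by rewrite big_split/= -mulr_sumr sum_avg// -/(part v); ring.
Qed.

Lemma avg_le v a M : pos v -> 0 <= M -> (forall w, `|a w| <= M) -> `|avg a v| <= M.
Proof.
move=> v0 M0 aM; rewrite /avg; have [z|z] := eqVneq (part v) 0.
  by rewrite (part_eq0 v0 z) mul0r normr0.
have p0 : 0 < part v by rewrite lt_neqAle eq_sym z part_ge0.
rewrite normrM normfV (gtr0_norm p0) ler_pdivrMr//.
apply: le_trans (ler_norm_sum _ _ _) _; rewrite /part mulr_sumr.
by apply: ler_sum => w _; rewrite normrM (gtr0_norm (v0 w)) mulrC ler_wpM2r// ltW.
Qed.

Lemma xavg_half v a x : pos v -> (forall w, `|a w| <= K) -> K * `|x| <= 1 / 2 ->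
  `|x * avg a v| <= 1 / 2.
Proof.
move=> v0 aK xK; rewrite normrM; apply: le_trans xK.
by rewrite mulrC; apply: ler_wpM2r => //; exact: avg_le.
Qed.

Lemma xspin_half a x : (forall w, `|a w| <= K) -> K * `|x| <= 1 / 2 ->
  `|x * spin a| <= 1 / 2.
Proof.
move=> aK xK; rewrite /spin; case: o => [X|]; last by rewrite mulr0 normr0; slra.
exact: xa_half aK xK.
Qed.

Lemma spin_le a : (forall w, `|a w| <= K) -> `|spin a| <= K.
Proof. by move=> aK; rewrite /spin; case: o => // ; rewrite normr0; slra. Qed.

Definition gain a x v : R := (1 + x * spin a) * (1 + x * avg a v) `^ r.

Lemma Phi_tilt v a x : pos v -> (forall w, `|a w| <= K) -> K * `|x| <= 1 / 2 ->
  Phi (tilt a x v) = Phi v * gain a x v.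
Proof.
move=> v0 aK xK; rewrite /Phi part_tilt// powRM ?part_ge0//; last first.
  by have := xavg_half v0 aK xK; rewrite ler_norml => /andP[? ?]; slra.
by rewrite /gain /spin /tilt; case: o => [X|]; ring.
Qed.

Lemma gain_bounds v a x : pos v -> (forall w, `|a w| <= K) -> K * `|x| <= 1 / 2 ->
  0 <= gain a x v <= 3.
Proof.
move=> v0 aK xK; rewrite /gain.
have := xavg_half v0 aK xK; rewrite ler_norml => /andP[u1 u2].
have := xspin_half aK xK; rewrite ler_norml => /andP[s1 s2].
have p : (1 + x * avg a v) `^ r <= 3 / 2.
  apply: (@le_trans _ _ ((3 / 2) `^ r)).
    by apply: ge0_ler_powR; rewrite ?nnegrE; slra.
  by rewrite ler1_powR//; slra.
apply/andP; split; first by rewrite mulr_ge0 ?powR_ge0//; slra.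
apply: (@le_trans _ _ (3 / 2 * (3 / 2))); last by slra.
by apply: ler_pM; rewrite ?powR_ge0//; slra.
Qed.

(** 109 = 3/2 * 72 + 1: the factor [1 + x * spin a], at most 3/2, multiplies the Taylor remainder,
    and the product of its linear part with the quadratic Taylor term leaves one more cubic term. *)
Lemma gain_taylor v a x : pos v -> (forall w, `|a w| <= K) -> K * `|x| <= 1 / 2 ->
  `|gain a x v - 1 - x * (spin a + r * avg a v) - x ^+ 2 * ell a v| <=
  109 * K ^+ 3 * `|x| ^+ 3.
Proof.
move=> v0 aK xK; rewrite /gain /ell.
have uh := xavg_half v0 aK xK; have sh := xspin_half aK xK.
have uK : `|avg a v| <= K by exact: avg_le.
have sK := spin_le aK.
have r2 : 0 < r <= 2 by slra.
have := powR1D_taylor r2 uh.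
move: (avg a v) (spin a) uh sh uK sK => u A uh sh uK sK.
set P := (1 + x * u) `^ r; set rem := P - 1 - _ - _ => hrem.
have -> : (1 + x * A) * P - 1 - x * (A + r * u) - x ^+ 2 * (r * (A * u + (r - 1) / 2 * u ^+ 2))
  = (1 + x * A) * rem + x ^+ 3 * (A * u ^+ 2 * (r * (r - 1) / 2)).
  by rewrite /rem; field.
have hK : `|x * u| ^+ 3 <= K ^+ 3 * `|x| ^+ 3.
  by rewrite normrM exprMn mulrC ler_wpM2r ?exprn_ge0// lerXn2r// nnegrE; slra.
apply: (le_trans (ler_normD _ _)).
have e1 : `|(1 + x * A) * rem| <= 3 / 2 * (72 * (K ^+ 3 * `|x| ^+ 3)).
  rewrite normrM; apply: ler_pM => //.
    by apply: le_trans (ler_normD _ _) _; rewrite normr1; slra.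
  by apply: (le_trans hrem); rewrite ler_wpM2l.
have e2 : `|x ^+ 3 * (A * u ^+ 2 * (r * (r - 1) / 2))| <= `|x| ^+ 3 * (K * K ^+ 2 * 1).
  rewrite normrM normrX ler_wpM2l ?exprn_ge0// normrM; apply: ler_pM => //.
    rewrite normrM; apply: ler_pM => //.
    by rewrite normrX lerXn2r// nnegrE; slra.
  rewrite ler_norml; apply/andP; split; snra.
have -> : 109 * K ^+ 3 * `|x| ^+ 3 = 3 / 2 * (72 * (K ^+ 3 * `|x| ^+ 3)) + `|x| ^+ 3 * (K * K ^+ 2 * 1).
  by field.
exact: lerD.
Qed.

Lemma ell_le v a : pos v -> (forall w, `|a w| <= K) -> `|ell a v| <= 2 * K ^+ 2.
Proof.
move=> v0 aK; rewrite /ell.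
have uK : `|avg a v| <= K by exact: avg_le.
have sK := spin_le aK.
rewrite normrM (gtr0_norm r0); apply: (@le_trans _ _ (1 * (K * K + 1 * K ^+ 2))); last first.
  by rewrite mul1r expr2; slra.
apply: ler_pM => //; first exact: ltW.
apply: le_trans (ler_normD _ _) _; apply: lerD.
  by rewrite normrM ler_pM.
rewrite normrM ler_pM//; last by rewrite normrX lerXn2r// nnegrE; slra.
by rewrite ler_norml; slra.
Qed.

(** The change is [x] times the Gibbs covariance of [a] and [b], divided by [1 + x * avg a v], which
    is at least 1/2. *)
Lemma avg_tilt_le v a b x : pos v -> (forall w, `|a w| <= K) -> (forall w, `|b w| <= K) ->
  K * `|x| <= 1 / 2 -> `|avg b (tilt a x v) - avg b v| <= 4 * K ^+ 2 * `|x|.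
Proof.
move=> v0 aK bK xK.
have := xavg_half v0 aK xK; rewrite ler_norml => /andP[u1 u2].
have uK : `|avg a v| <= K by exact: avg_le.
have bu : `|avg b v| <= K by exact: avg_le.
have cK : `|avg (fun w => a w * b w) v| <= K * K.
  by apply: avg_le => // [|w]; rewrite ?mulr_ge0// normrM ler_pM.
have e : avg b (tilt a x v) * (1 + x * avg a v) = avg b v + x * avg (fun w => a w * b w) v.
  rewrite {1}/avg part_tilt// /tilt; under eq_bigr do rewrite mulrDr mulr1 mulrDl.
  have [z|z] := eqVneq (part v) 0.
    by rewrite z mul0r invr0 mulr0 mul0r /avg z invr0 !mulr0 addr0.
  rewrite big_split/=.
  have -> : \sum_(w in S) v w * (x * a w) * b w = x * (\sum_(w in S) v w * (a w * b w)).
    by rewrite mulr_sumr; apply: eq_bigr => w _; ring.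
  rewrite !sum_avg//; field.
  by rewrite z/= gt_eqF//; slra.
have e' : (avg b (tilt a x v) - avg b v) * (1 + x * avg a v) =
    x * (avg (fun w => a w * b w) v - avg b v * avg a v).
  by rewrite mulrBl e; ring.
have h : `|avg b (tilt a x v) - avg b v| * (1 / 2) <= `|x| * (K * K + K * K).
  apply: (@le_trans _ _ `|(avg b (tilt a x v) - avg b v) * (1 + x * avg a v)|).
    by rewrite normrM ler_wpM2l// ger0_norm; slra.
  rewrite e' normrM ler_wpM2l//; apply: le_trans (ler_normB _ _) _.
  by rewrite lerD// normrM ler_pM.
by rewrite expr2; snra.
Qed.

Lemma ell_tilt_le v a b x : pos v -> (forall w, `|a w| <= K) -> (forall w, `|b w| <= K) ->
  K * `|x| <= 1 / 2 -> `|ell b (tilt a x v) - ell b v| <= 8 * K ^+ 3 * `|x|.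
Proof.
move=> v0 aK bK xK.
have vt := tilt_pos aK xK v0.
have := avg_tilt_le v0 aK bK xK.
have uK : `|avg b v| <= K by exact: avg_le.
have uK' : `|avg b (tilt a x v)| <= K by exact: avg_le.
have sK := spin_le bK; rewrite /ell.
move: (avg b _) (avg b _) (spin b) uK uK' sK => u' u A uK uK' sK hd.
have -> : r * (A * u' + (r - 1) / 2 * u' ^+ 2) - r * (A * u + (r - 1) / 2 * u ^+ 2) =
  r * (A + (r - 1) / 2 * (u' + u)) * (u' - u) by field.
have -> : 8 * K ^+ 3 * `|x| = 1 * (K + 1 / 2 * (K + K)) * (4 * K ^+ 2 * `|x|) by field.
rewrite normrM; apply: ler_pM => //.
rewrite normrM (gtr0_norm r0); apply: ler_pM => //; first exact: ltW.
apply: le_trans (ler_normD _ _) _; apply: lerD => //.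
rewrite normrM; apply: ler_pM => //.
  by rewrite ler_norml; slra.
by apply: le_trans (ler_normD _ _) _; exact: lerD.
Qed.

End Gibbs.

(* Locked, for otherwise unification unfolds the numeral. *)
HB.lock Definition expansion_cst {R : realType} (K : R) : R := 246 * K ^+ 5.

Lemma expansion_cst_ge0 {R : realType} (K : R) : 0 <= K -> 0 <= expansion_cst K.
Proof. by move=> K0; rewrite expansion_cst.unlock; apply: mulr_ge0; [exact: ler0n|exact: exprn_ge0]. Qed.

Section Expansion.
Context {R : realType} (Om : finType) (o : option Om) (S : {set Om}) (r K : R).
Hypotheses (r0 : 0 < r) (r1 : r <= 1) (K1 : 1 <= K).
Implicit Types (v a b : Om -> R) (x : R).
Local Notation Phi := (Phi o S r).
Local Notation ell := (ell o S r).
Local Notation gain := (gain o S r).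

Let K0 : 0 <= K. Proof. by apply: le_trans K1. Qed.
Ltac slra := generalize r0 r1 K1 K0; intros; lra.
Ltac snra := generalize r0 r1 K1 K0; intros; nra.

(** The linear term of [gain] averages to zero since the law is centred, which leaves the variance
    times [ell]. *)
Lemma op_Phi (c : chan Om) v : good_chan K c -> pos v ->
  `|op c Phi v - Phi v * (1 + mom2 c.2 * ell c.1 v)| <= Phi v * (109 * K ^+ 3 * mom3 c.2).
Proof.
move=> [aK [L0 L1 Lm LK]] v0.
have -> : op c Phi v - Phi v * (1 + mom2 c.2 * ell c.1 v) = Ex c.2 (fun x =>
  Phi v * (gain c.1 x v - 1 - x * (spin o c.1 + r * avg S c.1 v) - x ^+ 2 * ell c.1 v)).
  rewrite /op {1}/Ex (eq_big_seq (fun k => k.1 * (Phi v * gain c.1 k.2 v))); last first.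
    by move=> k kL; rewrite (Phi_tilt o S r0 r1 K1)//; exact: LK.
  rewrite -[X in X - _]/(Ex c.2 (fun x => Phi v * gain c.1 x v)) !ExZ -mulrBr; congr (_ * _).
  have -> : (fun x => gain c.1 x v - 1 - x * (spin o c.1 + r * avg S c.1 v) - x ^+ 2 * ell c.1 v) =
    (fun x => gain c.1 x v + ((- 1) + (- (spin o c.1 + r * avg S c.1 v) * x + - ell c.1 v * x ^+ 2))).
    by apply/funext => x; ring.
  by rewrite !ExD (Ex_cst _ L1) !ExZ Lm /mom2; ring.
rewrite ExZ normrM ger0_norm ?Phi_ge0// ler_wpM2l ?Phi_ge0//.
apply: le_trans (norm_Ex_le _ L0) _; rewrite -ExZ; apply: le_Ex => // k kL.
by apply: gain_taylor => //; exact: LK.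
Qed.

Definition sum_mom (m : seq (R * R) -> R) (l : seq (chan Om)) := \sum_(c <- l) m c.2.

Definition drift (l : seq (chan Om)) v := \sum_(c <- l) mom2 c.2 * ell c.1 v.

Lemma sum_mom_ge0 l : (forall c, List.In c l -> good_chan K c) ->
  [/\ 0 <= sum_mom mom1 l, 0 <= sum_mom mom2 l & 0 <= sum_mom mom3 l].
Proof.
rewrite /sum_mom; elim: l => [|c l IH] lK; first by rewrite !big_nil.
have [|h1 h2 h3] := IH; first by move=> c' h; apply: lK; right.
have [|_ /mom_ge0[g1 g2 g3]] := lK c; first by left.
by rewrite !big_cons !addr_ge0.
Qed.

Lemma drift_le l v : (forall c, List.In c l -> good_chan K c) -> pos v ->
  `|drift l v| <= 2 * K ^+ 2 * sum_mom mom2 l.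
Proof.
rewrite /drift /sum_mom; elim: l => [|c l IH] lK v0.
  by rewrite !big_nil normr0 mulr0.
rewrite !big_cons mulrDr; apply: le_trans (ler_normD _ _) _; apply: lerD.
  have [aK /mom_ge0[_ g2 _]] := lK c (or_introl erefl).
  by rewrite normrM ger0_norm// mulrC ler_wpM2r// (ell_le _ _ r0 r1 K1).
by apply: IH => // c' h; apply: lK; right.
Qed.

Lemma drift_tilt_le l v a x : (forall c, List.In c l -> good_chan K c) -> pos v ->
  (forall w, `|a w| <= K) -> K * `|x| <= 1 / 2 ->
  `|drift l (tilt a x v) - drift l v| <= 8 * K ^+ 3 * `|x| * sum_mom mom2 l.
Proof.
move=> lK v0 aK xK; move: lK; rewrite /drift /sum_mom; elim: l => [|c l IH] lK.
  by rewrite !big_nil subr0 normr0 mulr0.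
rewrite !big_cons mulrDr opprD addrACA -mulrBr.
apply: le_trans (ler_normD _ _) _; apply: lerD.
  have [bK /mom_ge0[_ g2 _]] := lK c (or_introl erefl).
  by rewrite normrM ger0_norm// mulrC ler_wpM2r// (ell_tilt_le _ _ r0 r1 K1).
by apply: IH => // c' h; apply: lK; right.
Qed.

(** The second inequality fixes the constant: with all powers raised to [K ^+ 5] it reads 4 + 218 +
    24 = 246. *)
Let CE : [/\ 109 * K ^+ 3 <= (expansion_cst K),
   4 * K ^+ 4 + 2 * K ^+ 2 * (109 * K ^+ 3) + 24 * K ^+ 3 <= (expansion_cst K),
   2 * K ^+ 2 + 109 * K ^+ 3 <= (expansion_cst K) & 0 <= (expansion_cst K)].
Proof.
have e i : (i <= 5)%N -> K ^+ i <= K ^+ 5 by move=> h; rewrite ler_weXn2l.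
have [h2 h3 h4] : [/\ K ^+ 2 <= K ^+ 5, K ^+ 3 <= K ^+ 5 & K ^+ 4 <= K ^+ 5] by split; exact: e.
have h5 : 0 <= K ^+ 5 by exact: exprn_ge0.
by rewrite expansion_cst.unlock; split; slra.
Qed.

(** Peeling off a channel moves the drift of the remaining ones by O(|x| * sum of variances), whence
    the products [mom2 * mom1]. The error inherited from the tail is multiplied by at most
    [1 + C * mom2 c.2], and these factors build up the exponential. *)
Lemma ops_Phi l v : (forall c, List.In c l -> good_chan K c) -> pos v ->
  `|ops l Phi v - Phi v * (1 + drift l v)| <=
  Phi v * ((expansion_cst K) * expR ((expansion_cst K) * sum_mom mom2 l) *
           (sum_mom mom3 l + sum_mom mom2 l * sum_mom mom1 l)).
Proof.
have [C1 C2 C3 C0] := CE.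
elim: l v => [|c l IH] v lK v0.
  by rewrite /drift /sum_mom !big_nil /= mul0r !addr0 !mulr0 mulr1 subrr normr0.
have lK' c' : List.In c' l -> good_chan K c' by move=> h; apply: lK; right.
have cK : good_chan K c by apply: lK; left.
have [aK [L0 L1 Lm LK]] := cK.
have [t10 t20 t30] := mom_ge0 cK.2.
have [t32 t21] := mom_le K1 cK.2.
have [s10 s20 s30] := sum_mom_ge0 lK'.
rewrite [drift (c :: l) v]/drift /sum_mom !big_cons -!/(sum_mom _ l) -/(drift l v).
set s := sum_mom mom2 l in s20 *; set q1 := sum_mom mom1 l in s10 *.
set q3 := sum_mom mom3 l in s30 *.
set E := (expansion_cst K) * expR ((expansion_cst K) * s) * (q3 + s * q1).
have E0 : 0 <= E by rewrite /E !mulr_ge0 ?expR_ge0// addr_ge0// mulr_ge0.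
have P0 := Phi_ge0 o S r v0.
have PT x : K * `|x| <= 1 / 2 -> pos (tilt c.1 x v) by move=> xK; exact: tilt_pos v0.
have opb := op_Phi cK v0.
have lc := ell_le o S r0 r1 K1 v0 aK.
have Gs := drift_le lK' v0; rewrite -/s in Gs.
have h1 : `|Ex c.2 (fun x => ops l Phi (tilt c.1 x v) - Phi (tilt c.1 x v) * (1 + drift l v))|
   <= Phi v * (24 * K ^+ 3 * s * mom1 c.2) + E * op c Phi v.
  apply: le_trans (norm_Ex_le _ L0) _.
  apply: (@le_trans _ _ (Ex c.2 (fun x => (Phi v * (24 * K ^+ 3 * s)) * `|x| + E * Phi (tilt c.1 x v)))); last first.
    by rewrite ExD !ExZ -/(mom1 _) -/(op c Phi v) !mulrA.
  apply: le_Ex => // k kL; have xK := LK _ kL.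
  have -> : ops l Phi (tilt c.1 k.2 v) - Phi (tilt c.1 k.2 v) * (1 + drift l v) =
    (ops l Phi (tilt c.1 k.2 v) - Phi (tilt c.1 k.2 v) * (1 + drift l (tilt c.1 k.2 v))) +
    Phi (tilt c.1 k.2 v) * (drift l (tilt c.1 k.2 v) - drift l v) by ring.
  apply: le_trans (ler_normD _ _) _; rewrite [leRHS]addrC; apply: lerD.
    by rewrite [leRHS]mulrC; apply: (IH _ lK' (PT _ xK)).
  rewrite normrM (Phi_tilt o S r0 r1 K1)// (ger0_norm (mulr_ge0 P0 _)); last first.
    by have /andP[] := gain_bounds o S r0 r1 K1 v0 aK xK.
  have /andP[g0 g3] := gain_bounds o S r0 r1 K1 v0 aK xK.
  have -> : Phi v * (24 * K ^+ 3 * s) * `|k.2| = (Phi v * 3) * (8 * K ^+ 3 * `|k.2| * s) by ring.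
  apply: ler_pM => //; first exact: mulr_ge0.
    by rewrite ler_wpM2l.
  exact: drift_tilt_le.
have h2 : Ex c.2 (fun x => ops l Phi (tilt c.1 x v) - Phi (tilt c.1 x v) * (1 + drift l v)) =
  op c (ops l Phi) v - (1 + drift l v) * op c Phi v.
  rewrite /op.
  have -> : (fun x => ops l Phi (tilt c.1 x v) - Phi (tilt c.1 x v) * (1 + drift l v)) =
    (fun x => ops l Phi (tilt c.1 x v) + - 1 * ((1 + drift l v) * Phi (tilt c.1 x v))).
    by apply/funext => x; ring.
  by rewrite ExD !ExZ; ring.
rewrite h2 in h1; rewrite [ops (c :: l) _]/=.
have opu : op c Phi v <= Phi v * (1 + (expansion_cst K) * mom2 c.2).
  have : op c Phi v <= Phi v * (1 + mom2 c.2 * ell c.1 v) + Phi v * (109 * K ^+ 3 * mom3 c.2).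
    by move: opb; rewrite ler_norml; lra.
  move/le_trans; apply; rewrite -mulrDr ler_wpM2l//.
  have : mom2 c.2 * ell c.1 v <= mom2 c.2 * (2 * K ^+ 2).
    by rewrite ler_wpM2l//; apply: le_trans lc; exact: ler_norm.
  have : 109 * K ^+ 3 * mom3 c.2 <= 109 * K ^+ 3 * mom2 c.2.
    by rewrite ler_wpM2l// mulr_ge0// exprn_ge0.
  have : (2 * K ^+ 2 + 109 * K ^+ 3) * mom2 c.2 <= (expansion_cst K) * mom2 c.2 by rewrite ler_wpM2r.
  lra.
have h3 : `|(1 + drift l v) * op c Phi v - Phi v * (1 + (mom2 c.2 * ell c.1 v + drift l v))| <=
  (1 + 2 * K ^+ 2 * s) * (Phi v * (109 * K ^+ 3 * mom3 c.2)) +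
  Phi v * ((2 * K ^+ 2 * s) * (mom2 c.2 * (2 * K ^+ 2))).
  have -> : (1 + drift l v) * op c Phi v - Phi v * (1 + (mom2 c.2 * ell c.1 v + drift l v)) =
    (1 + drift l v) * (op c Phi v - Phi v * (1 + mom2 c.2 * ell c.1 v)) +
    Phi v * (drift l v * (mom2 c.2 * ell c.1 v)) by ring.
  apply: le_trans (ler_normD _ _) _; apply: lerD.
    rewrite normrM; apply: ler_pM => //.
    by apply: le_trans (ler_normD _ _) _; rewrite normr1 lerD2l.
  rewrite normrM (ger0_norm P0) ler_wpM2l// normrM; apply: ler_pM => //.
  by rewrite normrM ger0_norm// ler_wpM2l.
have -> : op c (ops l Phi) v - Phi v * (1 + (mom2 c.2 * ell c.1 v + drift l v)) =
  (op c (ops l Phi) v - (1 + drift l v) * op c Phi v) +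
  ((1 + drift l v) * op c Phi v - Phi v * (1 + (mom2 c.2 * ell c.1 v + drift l v))) by ring.
apply: le_trans (ler_normD _ _) _; apply: (le_trans (lerD h1 h3)).
have h4 : E * op c Phi v <= E * (Phi v * (1 + (expansion_cst K) * mom2 c.2)) by rewrite ler_wpM2l.
apply: (le_trans (lerD (lerD (lexx _) h4) (lexx _))).
have -> : Phi v * (24 * K ^+ 3 * s * mom1 c.2) + E * (Phi v * (1 + (expansion_cst K) * mom2 c.2)) +
   ((1 + 2 * K ^+ 2 * s) * (Phi v * (109 * K ^+ 3 * mom3 c.2)) +
    Phi v * (2 * K ^+ 2 * s * (mom2 c.2 * (2 * K ^+ 2)))) =
   Phi v * (109 * K ^+ 3 * mom3 c.2 + s * (24 * K ^+ 3 * mom1 c.2 +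
     2 * K ^+ 2 * (109 * K ^+ 3) * mom3 c.2 + 4 * K ^+ 4 * mom2 c.2) +
     E * (1 + (expansion_cst K) * mom2 c.2)) by ring.
rewrite ler_wpM2l//.
have t31 := le_trans t32 t21.
have KK i : 0 <= K ^+ i by exact: exprn_ge0.
apply: (@le_trans _ _ ((expansion_cst K) * mom3 c.2 + s * ((expansion_cst K) * mom1 c.2) +
    E * expR ((expansion_cst K) * mom2 c.2))).
  apply: lerD; last by rewrite ler_wpM2l// expR_ge1Dx.
  apply: lerD; first by rewrite ler_wpM2r.
  rewrite ler_wpM2l//.
  apply: (@le_trans _ _ ((4 * K ^+ 4 + 2 * K ^+ 2 * (109 * K ^+ 3) + 24 * K ^+ 3) * mom1 c.2)); last first.
    by rewrite ler_wpM2r.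
  have a1 : 2 * K ^+ 2 * (109 * K ^+ 3) * mom3 c.2 <= 2 * K ^+ 2 * (109 * K ^+ 3) * mom1 c.2.
    by rewrite ler_wpM2l// !mulr_ge0.
  have a2 : 4 * K ^+ 4 * mom2 c.2 <= 4 * K ^+ 4 * mom1 c.2 by rewrite ler_wpM2l// mulr_ge0.
  lra.
rewrite [(expansion_cst K) * (mom2 c.2 + s)]mulrDr expRD /E.
set e1 := expR ((expansion_cst K) * mom2 c.2); set e2 := expR ((expansion_cst K) * s).
have e1g : 1 <= e1 by rewrite -expR0 ler_expR mulr_ge0.
have e2g : 1 <= e2 by rewrite -expR0 ler_expR mulr_ge0.
have e12 : 1 <= e1 * e2 by rewrite -[1]mulr1 ler_pM.
have p : 0 <= mom3 c.2 + s * mom1 c.2 by rewrite addr_ge0// mulr_ge0.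
have q : 0 <= mom2 c.2 * (mom1 c.2 + q1) by rewrite mulr_ge0// addr_ge0.
apply: (@le_trans _ _ ((expansion_cst K) * (e1 * e2) * ((mom3 c.2 + s * mom1 c.2) + (q3 + s * q1)))); last first.
  rewrite ler_wpM2l//; first by rewrite !mulr_ge0// expR_ge0.
  by move: q; rewrite mulrDl; lra.
rewrite [leRHS]mulrDr; apply: lerD; last by rewrite le_eqVlt; apply/orP; left; apply/eqP; ring.
rewrite (_ : _ + _ = (expansion_cst K) * (mom3 c.2 + s * mom1 c.2)); last by ring.
by rewrite ler_wpM2r// ler_peMr.
Qed.

End Expansion.

(** * Interpolation between edge and node channels *)

Section Laws.
Context {R : realType}.
Implicit Types (L : seq (R * R)) (K h : R).

(* The value is kept with probability [1 / M] and replaced by [0] otherwise. *)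
Definition erase (M : nat) L : seq (R * R) :=
  (1 - M%:R^-1, 0) :: [seq (k.1 / M%:R, k.2) | k <- L].

Definition sign_law h : seq (R * R) := [:: (1 / 2, h); (1 / 2, - h)].

Lemma Ex_erase M L f : f 0 = 0 -> Ex (erase M L) f = M%:R^-1 * Ex L f.
Proof.
move=> f0; rewrite /Ex /erase big_cons/= f0 mulr0 add0r big_map mulr_sumr.
by apply: eq_bigr => k _ /=; ring.
Qed.

Lemma mean_zero_erase K M L : (0 < M)%N -> 0 <= K -> mean_zero_law K L ->
  mean_zero_law K (erase M L).
Proof.
move=> M0 K0 [L0 L1 Lm LK]; have M1 : 1 <= M%:R :> R by rewrite (ler_nat _ 1).
split.
- move=> k; rewrite inE => /orP[/eqP->/=|/mapP[k' /L0 k'0 ->]/=].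
    by rewrite subr_ge0 invf_le1//; lra.
  by rewrite divr_ge0.
- rewrite big_cons big_map/= -mulr_suml L1; lra.
- by rewrite Ex_erase// Lm mulr0.
- move=> k; rewrite inE => /orP[/eqP->/=|/mapP[k' /LK h ->]//].
  by rewrite normr0 mulr0; lra.
Qed.

Lemma mom_erase M L : [/\ mom1 (erase M L) = M%:R^-1 * mom1 L,
   mom2 (erase M L) = M%:R^-1 * mom2 L & mom3 (erase M L) = M%:R^-1 * mom3 L].
Proof. by split; rewrite /mom1 /mom2 /mom3 Ex_erase// ?normr0// expr0n. Qed.

Lemma mean_zero_sign K h : K * `|h| <= 1 / 2 -> mean_zero_law K (sign_law h).
Proof.
move=> Kh; split.
- by move=> k; rewrite !inE => /orP[] /eqP -> /=; lra.
- rewrite !big_cons big_nil/=; lra.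
- rewrite /Ex !big_cons big_nil/=; lra.
- by move=> k; rewrite !inE => /orP[] /eqP -> /=; rewrite ?normrN.
Qed.

Lemma mom_sign h : [/\ mom1 (sign_law h) = `|h|, mom2 (sign_law h) = h ^+ 2 &
  mom3 (sign_law h) = `|h| ^+ 3].
Proof.
by split; rewrite /mom1 /mom2 /mom3 /Ex !big_cons big_nil/= ?normrN ?sqrrN; field.
Qed.
End Laws.

Section Lists.
Context {R : realType} (Om : finType).
Local Notation chan := (@chan R Om).

Lemma In_map_chan (T : Type) (f : T -> chan) (l : seq T) c :
  List.In c [seq f x | x <- l] -> exists2 x, List.In x l & c = f x.
Proof.
elim: l => [//|x l IH] /= [<-|/IH[y yl ->]]; first by exists x => //; left.
by exists y => //; right.
Qed.

Lemma In_cat_chan (l1 l2 : seq chan) c :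
  List.In c (l1 ++ l2) -> List.In c l1 \/ List.In c l2.
Proof.
elim: l1 => [|x l1 IH] /=; first by right.
by move=> [->|/IH[]]; [left; left|left; right|right].
Qed.

Definition pw (M : nat) (l : seq chan) := flatten (nseq M l).

Lemma In_pw M (l : seq chan) c : List.In c (pw M l) -> List.In c l.
Proof. by elim: M => [//|M IH] /In_cat_chan[]. Qed.

Lemma In_nseq_chan M (c c' : chan) : List.In c (nseq M c') -> c = c'.
Proof. by elim: M => [//|M IH] /= [->|/IH]. Qed.

Lemma ops_pw M (l : seq chan) F : ops (pw M l) F = iter M (ops l) F.
Proof. by elim: M => [//|M IH]; rewrite /pw /= ops_cat -/(pw M l) IH. Qed.

(** [A] and [B] are compared on [F] alone, not on its iterates: commutation always brings the round
    to be exchanged next to [F], and the other rounds are monotone. *)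
Lemma ops_pw_le K (A B : seq chan) (k : R) (F : (Om -> R) -> R) M : 0 <= k ->
  (forall c, List.In c A -> good_chan K c) ->
  (forall c, List.In c B -> good_chan K c) ->
  leF (ops A F) (fun v => k * ops B F v) ->
  leF (ops (pw M A) F) (fun v => k ^+ M * ops (pw M B) F v).
Proof.
move=> k0 AK BK AB; elim: M => [|M IH] v v0; first by rewrite mul1r.
rewrite /pw /= !ops_cat -!/(pw M _) ops_comm.
apply: le_trans (ops_le (K := K) (l := pw M A) _ AB v0) _.
  by move=> c /In_pw; exact: AK.
rewrite opsZ ops_comm exprS -mulrA ler_wpM2l//.
have := ops_le BK IH v0; rewrite opsZ; exact: le_trans.
Qed.

Lemma ops_flatten_nseq M (l : seq chan) (f : chan -> chan) F :
  ops (flatten [seq nseq M (f c) | c <- l]) F = ops (pw M [seq f c | c <- l]) F.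
Proof.
elim: l => [|c l IH] /=; first by rewrite ops_pw; elim: M => [//|M /= <-].
rewrite ops_cat IH !ops_pw.
have -> : ops (f c :: [seq f i | i <- l]) = (op (f c)) \o (ops [seq f i | i <- l]) by [].
have -> : ops (nseq M (f c)) = iter M (op (f c)).
  by apply/funext => G; elim: M {IH} => [//|M /= <-].
elim: M {IH} F => [//|M IH] F; rewrite !iterSr -IH /=; congr iter.
by rewrite -!ops_pw ops_op_comm.
Qed.
End Lists.

Section Interpolation.
Context {R : realType} (Om : finType) (o : option Om) (S : {set Om}) (r K : R).
Hypotheses (r0 : 0 < r) (r1 : r <= 1) (K1 : 1 <= K).
Implicit Types (v a b : Om -> R) (L : seq (R * R)).
Local Notation Phi := (Phi o S r).
Local Notation ell := (ell o S r).
Local Notation C := (expansion_cst K).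

Let K0 : 0 <= K. Proof. by apply: le_trans K1. Qed.
Let C0 : 0 <= C. Proof. exact: expansion_cst_ge0. Qed.

(** The error of [ops_Phi] for one channel of law [L]. It also serves for its [M] erased copies,
    because erasure divides every moment by [M]. *)
Definition edge_err L : R := C * expR (C * mom2 L) * (mom3 L + mom2 L * mom1 L).

Lemma edge_err_ge0 L : mean_zero_law K L -> 0 <= edge_err L.
Proof.
move=> /mom_ge0[m1 m2 m3]; apply: mulr_ge0; first exact: (mulr_ge0 C0 (expR_ge0 _)).
by apply: addr_ge0 => //; exact: mulr_ge0.
Qed.

(** Both sides equal [Phi v * (1 + mom2 c.2 * ell c.1 v)] up to a relative error [e = edge_err c.2].
    As the lower estimate is at least half of [Phi v], a factor [1 + 4 * e] bridges the gap
    [2 * e]. *)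
Lemma op_le_erased (c : chan Om) M v : good_chan K c -> (0 < M)%N ->
  2 * K ^+ 2 * mom2 c.2 + edge_err c.2 <= 1 / 2 -> pos v ->
  op c Phi v <= (1 + 4 * edge_err c.2) * ops (nseq M (c.1, erase M c.2)) Phi v.
Proof.
move=> cK M0 small v0.
have MN : M%:R != 0 :> R by rewrite pnatr_eq0 -lt0n.
have P0 := Phi_ge0 o S r v0.
have e0 := edge_err_ge0 cK.2.
have up : op c Phi v <= Phi v * (1 + mom2 c.2 * ell c.1 v + edge_err c.2).
  have := @ops_Phi _ _ o S r K r0 r1 K1 [:: c] v.
  rewrite /drift /sum_mom !big_cons !big_nil !addr0 => /(_ _ v0).
  case/(_ _)/Wrap; first by move=> c' [<-|].
  rewrite -/(edge_err c.2) -[ops [:: c] Phi v]/(op c Phi v) ler_norml => /andP[_ h].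
  have -> : Phi v * (1 + mom2 c.2 * ell c.1 v + edge_err c.2) =
    Phi v * (1 + mom2 c.2 * ell c.1 v) + Phi v * edge_err c.2 by ring.
  lra.
have lo : Phi v * (1 + mom2 c.2 * ell c.1 v - edge_err c.2) <= ops (nseq M (c.1, erase M c.2)) Phi v.
  have := @ops_Phi _ _ o S r K r0 r1 K1 (nseq M (c.1, erase M c.2)) v.
  have [m1 m2 m3] := mom_erase M c.2.
  have sN (f : @chan R Om -> R) d : \sum_(i <- nseq M d) f i = M%:R * f d.
    by rewrite big_nseq iter_addr_0 mulr_natl.
  have sm (m : seq (R * R) -> R) z : m (erase M c.2) = M%:R^-1 * z ->
      sum_mom m (nseq M (c.1, erase M c.2)) = z.
    by move=> e; rewrite /sum_mom (sN (fun c => m c.2)) [snd _]/= e mulVKf.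
  have dr : drift o S r (nseq M (c.1, erase M c.2)) v = mom2 c.2 * ell c.1 v.
    rewrite /drift (sN (fun c => mom2 c.2 * ell c.1 v)) [snd _]/= [fst _]/= m2.
    by rewrite -(mulrA M%:R^-1) mulVKf.
  rewrite dr (sm _ _ m1) (sm _ _ m2) (sm _ _ m3) => /(_ _ v0).
  case/(_ _)/Wrap.
    move=> c' /In_nseq_chan ->; case: cK => aK LK; split => //.
    exact: mean_zero_erase.
  rewrite -/(edge_err c.2) ler_norml => /andP[h _].
  have -> : Phi v * (1 + mom2 c.2 * ell c.1 v - edge_err c.2) =
    Phi v * (1 + mom2 c.2 * ell c.1 v) - Phi v * edge_err c.2 by ring.
  lra.
apply: (le_trans up).
have lc := ell_le o S r0 r1 K1 v0 cK.1.
have [_ m20 _] := mom_ge0 cK.2.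
have D : - (2 * K ^+ 2 * mom2 c.2) <= mom2 c.2 * ell c.1 v.
  by move: lc; rewrite ler_norml => /andP[+ _] => h; rewrite mulrC -mulrN ler_wpM2l.
apply: (@le_trans _ _ ((1 + 4 * edge_err c.2) * (Phi v * (1 + mom2 c.2 * ell c.1 v - edge_err c.2)))); last first.
  by rewrite ler_wpM2l//; lra.
rewrite [leRHS]mulrCA ler_wpM2l//.
move: (mom2 c.2 * ell c.1 v) D small e0 => x D small e0; nra.
Qed.

Lemma edges_le_erased L (es : seq (Om -> R)) M v : mean_zero_law K L -> (0 < M)%N ->
  (forall a, List.In a es -> forall w, `|a w| <= K) ->
  2 * K ^+ 2 * mom2 L + edge_err L <= 1 / 2 -> pos v ->
  ops [seq (a, L) | a <- es] Phi v <=
  (1 + 4 * edge_err L) ^+ size es * ops (pw M [seq (a, erase M L) | a <- es]) Phi v.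
Proof.
move=> LK M0 eK small; have e0 := edge_err_ge0 LK.
have -> : [seq (a, erase M L) | a <- es] = [seq (c.1, erase M c.2) | c <- [seq (a, L) | a <- es]].
  by rewrite -map_comp.
rewrite -ops_flatten_nseq.
elim: es eK v => [|a es IH] eK v v0; first by rewrite mul1r.
have aK : forall w, `|a w| <= K by apply: eK; left.
have esK b : List.In b es -> forall w, `|b w| <= K by move=> h; apply: eK; right.
have esG c : List.In c [seq (a, L) | a <- es] -> good_chan K c.
  by case/In_map_chan => b /esK bK ->.
have ncG c : List.In c (nseq M (a, erase M L)) -> good_chan K c.
  by move=> /In_nseq_chan ->; split => //; exact: mean_zero_erase.
rewrite [ops (map _ _) Phi]/= -/(ops _ _) -ops_op_comm.
have st : leF (op (a, L) Phi) (fun v => (1 + 4 * edge_err L) * ops (nseq M (a, erase M L)) Phi v).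
  by move=> u u0; apply: (@op_le_erased (a, L)).
apply: (le_trans (ops_le esG st v0)).
rewrite opsZ ops_comm /= ops_cat exprS -mulrA ler_wpM2l//; first by lra.
have := ops_le ncG (IH esK) v0; rewrite opsZ; exact: le_trans.
Qed.

End Interpolation.

Section Comparison.
Context {R : realType} (Om : finType) (o : option Om) (S : {set Om}) (r K : R).
Hypotheses (r0 : 0 < r) (r1 : r <= 1) (K1 : 1 <= K).
Implicit Types (v a b : Om -> R) (L : seq (R * R)) (es vs : seq (Om -> R)).
Local Notation Phi := (Phi o S r).
Local Notation ell := (ell o S r).
Local Notation C := (expansion_cst K).
Local Notation len s := ((size s)%:R : R).

Let K0 : 0 <= K. Proof. by apply: le_trans K1. Qed.
Let C0 : 0 <= C. Proof. exact: expansion_cst_ge0. Qed.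

Definition bounded_by (l : seq (Om -> R)) := forall a, List.In a l -> forall w, `|a w| <= K.

Lemma sum_mom_map (m : seq (R * R) -> R) L es :
  sum_mom m [seq (a, L) | a <- es] = len es * m L.
Proof.
rewrite /sum_mom big_map; elim: es => [|a es IH]; first by rewrite big_nil mul0r.
by rewrite big_cons IH/= -addn1 natrD; ring.
Qed.

Lemma drift_map L es v :
  drift o S r [seq (a, L) | a <- es] v = mom2 L * \sum_(a <- es) ell a v.
Proof. by rewrite /drift big_map mulr_sumr. Qed.

Lemma good_map L es : mean_zero_law K L -> bounded_by es ->
  forall c, List.In c [seq (a, L) | a <- es] -> good_chan K c.
Proof. by move=> LK eK c /In_map_chan[a /eK aK ->]. Qed.

Lemma sum_ell_le es v : bounded_by es -> pos v ->
  `|\sum_(a <- es) ell a v| <= len es * (2 * K ^+ 2).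
Proof.
move=> eK v0; elim: es eK => [|a es IH] eK; first by rewrite big_nil normr0 mul0r.
rewrite big_cons /= -addn1 natrD mulrDl mul1r [leRHS]addrC.
apply: le_trans (ler_normD _ _) _; apply: lerD.
  by apply: (ell_le o S r0 r1 K1 v0); apply: eK; left.
by apply: IH => b h; apply: eK; right.
Qed.

(** The term quadratic in the number of edges carries an additional 1/M; over [M] rounds it
    therefore vanishes in the limit and only [len es * mom3 L] remains. This is the purpose of
    erasure. *)
Lemma edge_round_le L es M v : mean_zero_law K L -> bounded_by es -> pos v ->
  (0 < M)%N -> C * (len es * mom2 L) <= M%:R ->
  ops [seq (a, erase M L) | a <- es] Phi v <=
  Phi v * (1 + M%:R^-1 * (mom2 L * \sum_(a <- es) ell a v) +
    C * expR 1 * (len es * mom3 L + len es * mom2 L * (len es * mom1 L) / M%:R) / M%:R).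
Proof.
move=> LK eK v0 M0 CM.
have MN : 0 < M%:R :> R by rewrite ltr0n.
have P0 := Phi_ge0 o S r v0.
have [m10 m20 m30] := mom_ge0 LK.
have LM := mean_zero_erase M0 K0 LK.
have := ops_Phi o S r0 r1 K1 (good_map LM eK) v0.
have [m1 m2 m3] := mom_erase M L.
rewrite !sum_mom_map drift_map m1 m2 m3 ler_norml => /andP[_ h].
set D := \sum_(a <- es) ell a v in h *.
have h' : ops [seq (a, erase M L) | a <- es] Phi v <= Phi v * (1 + M%:R^-1 * mom2 L * D) +
  Phi v * (C * expR (C * (len es * (M%:R^-1 * mom2 L))) *
     (len es * (M%:R^-1 * mom3 L) + len es * (M%:R^-1 * mom2 L) * (len es * (M%:R^-1 * mom1 L)))).
  by move: h; lra.
apply: (le_trans h'); rewrite -mulrDr ler_wpM2l// -(mulrA _ (mom2 L) D) lerD2l.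
have -> : C * expR 1 * (len es * mom3 L + len es * mom2 L * (len es * mom1 L) / M%:R) / M%:R =
  C * expR 1 * (len es * (M%:R^-1 * mom3 L) + len es * (M%:R^-1 * mom2 L) * (len es * (M%:R^-1 * mom1 L))).
  by field; rewrite gt_eqF.
have q3 : 0 <= M%:R^-1 * mom3 L by rewrite mulr_ge0// invr_ge0 ltW.
have q2 : 0 <= M%:R^-1 * mom2 L by rewrite mulr_ge0// invr_ge0 ltW.
have q1 : 0 <= M%:R^-1 * mom1 L by rewrite mulr_ge0// invr_ge0 ltW.
apply: ler_wpM2r; first by rewrite addr_ge0// !mulr_ge0.
apply: ler_wpM2l => //; rewrite ler_expR.
have -> : C * (len es * (M%:R^-1 * mom2 L)) = C * (len es * mom2 L) / M%:R by ring.
by rewrite ler_pdivrMr// mul1r.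
Qed.

Lemma node_round_le h vs v : 0 <= h -> K * `|h| <= 1 / 2 -> bounded_by vs -> pos v ->
  C * (len vs * h ^+ 2) <= 1 ->
  `|ops [seq (a, sign_law h) | a <- vs] Phi v -
    Phi v * (1 + h ^+ 2 * \sum_(a <- vs) ell a v)| <=
  Phi v * (C * expR 1 * (len vs + len vs * len vs) * h ^+ 3).
Proof.
move=> h0 Kh vK v0 Ch.
have P0 := Phi_ge0 o S r v0.
have := ops_Phi o S r0 r1 K1 (good_map (mean_zero_sign Kh) vK) v0.
have [m1 m2 m3] := mom_sign h.
rewrite !sum_mom_map drift_map m1 m2 m3 (ger0_norm h0) => /le_trans; apply.
rewrite ler_wpM2l//.
have -> : C * expR 1 * (len vs + len vs * len vs) * h ^+ 3 =
   C * expR 1 * (len vs * h ^+ 3 + len vs * h ^+ 2 * (len vs * h)) by ring.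
apply: ler_wpM2r; first by rewrite addr_ge0// !mulr_ge0// ?exprn_ge0.
by apply: ler_wpM2l => //; rewrite ler_expR.
Qed.

(** [P] is the value before the round and [b] bounds its relative change, so [P] and [y] differ by
    at most [2 * b * y]. The excess [c'] may have either sign, whence the correction in [|c'| * b];
    in the application both factors are of order 1/M. *)
Lemma round_compare (y y' P D D' c' EA EB b : R) :
  0 <= P -> 0 <= EA -> 0 <= EB -> `|D| + EB <= b -> b <= 1 / 2 ->
  y' <= P * (1 + D' + EA) -> `|y - P * (1 + D)| <= P * EB -> D' <= D + c' ->
  y' <= expR (c' + 2 * (EA + EB) + 2 * `|c'| * b) * y.
Proof.
move=> P0 A0 B0 Db b2 hy' hy hD.
have D0 := normr_ge0 D.
have := Db; rewrite -lerBrDr ler_norml => /andP[D1 D2].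
move: hy; rewrite ler_norml => /andP[hy1 hy2].
have yP : P <= 2 * y by nra.
have y0 : 0 <= y by lra.
have Py : `|P - y| <= 2 * b * y.
  rewrite ler_norml; apply/andP; split; nra.
have cPy : c' * P <= c' * y + 2 * `|c'| * b * y.
  have : c' * (P - y) <= `|c'| * (2 * b * y).
    by apply: le_trans (ler_norm _) _; rewrite normrM ler_wpM2l.
  lra.
have e1 : P * (EA + EB) <= 2 * y * (EA + EB) by rewrite ler_wpM2r// addr_ge0.
apply: (@le_trans _ _ ((1 + (c' + 2 * (EA + EB) + 2 * `|c'| * b)) * y)).
  have : y' <= P * (1 + D + c' + EA).
    by apply: le_trans hy' _; rewrite ler_wpM2l//; lra.
  nra.
by rewrite ler_wpM2r// expR_ge1Dx.
Qed.

End Comparison.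

Section Guerra.
Context {R : realType} (Om : finType) (o : option Om) (S : {set Om}) (r K : R).
Hypotheses (r0 : 0 < r) (r1 : r <= 1) (K1 : 1 <= K).
Implicit Types (v a b : Om -> R) (L : seq (R * R)) (es vs : seq (Om -> R)).
Local Notation Phi := (Phi o S r).
Local Notation ell := (ell o S r).
Local Notation C := (expansion_cst K).
Local Notation len s := ((size s)%:R : R).

Let K0 : 0 <= K. Proof. by apply: le_trans K1. Qed.
Let C0 : 0 <= C. Proof. exact: expansion_cst_ge0. Qed.

Let le_quarter (a b c : R) : 4 * (a * b) * c <= 1 -> a * b * c <= (1 / 2) ^+ 2.
Proof. by move=> *; lra. Qed.

(* Each edge channel is cut into [M] erased channels, and one round of these is compared with one
   round of steps of size [sqrt (gam / M)] at the nodes. *)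
Lemma ops_edges_le_nodes L es vs (gam cc : R) : mean_zero_law K L ->
  2 * K ^+ 2 * mom2 L + edge_err K L <= 1 / 2 ->
  0 <= gam -> bounded_by K es -> bounded_by K vs ->
  (forall v, pos v -> mom2 L * \sum_(a <- es) ell a v <= gam * (\sum_(a <- vs) ell a v) + cc) ->
  exists W : R, forall M : nat, (0 < M)%N -> W <= M%:R -> forall v, pos v ->
    ops [seq (a, L) | a <- es] Phi v <=
    (1 + 4 * edge_err K L) ^+ size es *
    expR (cc + 2 * (C * expR 1 * (len es * mom3 L)) + W * Num.sqrt M%:R^-1) *
    ops (pw M [seq (a, sign_law (Num.sqrt (gam / M%:R))) | a <- vs]) Phi v.
Proof.
move=> LK small g0 eK vK Hdrift.
have [m10 m20 m30] := mom_ge0 LK.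
have e0 := edge_err_ge0 K1 LK.
have E0 : 0 <= expR 1 :> R := expR_ge0 _.
pose n : R := len vs; pose N : R := len es.
have n0 : 0 <= n by exact: ler0n.
have N0 : 0 <= N by exact: ler0n.
pose W1 := C * expR 1 * (n + n * n) * (gam * Num.sqrt gam).
have W10 : 0 <= W1 by rewrite /W1 !mulr_ge0 ?sqrtr_ge0// addr_ge0// mulr_ge0.
pose W2 := gam * (n * (2 * K ^+ 2)) + W1.
have W20 : 0 <= W2 by rewrite /W2 addr_ge0// !mulr_ge0// exprn_ge0.
pose Q := C * expR 1 * (N * mom2 L * (N * mom1 L)).
have Q0 : 0 <= Q by rewrite /Q !mulr_ge0.
pose W3 := 2 * Q + 2 * W1 + 2 * `|cc| * W2.
have W30 : 0 <= W3 by have q := mulr_ge0 (normr_ge0 cc) W20; rewrite /W3; lra.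
have i1 : 0 <= C * (N * mom2 L) by rewrite !mulr_ge0.
have i2 : 0 <= C * (n * gam) by rewrite !mulr_ge0.
have i5 : 0 <= 2 * W2 by rewrite mulr_ge0.
have i3 : 0 <= 4 * (K ^+ 2 * gam) by rewrite !mulr_ge0// exprn_ge0.
(* In order: the final error, the edge round, the relative change of a node round, the step size,
   and the node round. *)
exists (W3 + C * (N * mom2 L) + 2 * W2 + 4 * (K ^+ 2 * gam) + C * (n * gam)) => M M0.
set W := (X in X <= _) => WM v v0.
have [w1 w2 w3 w4 w5] := le_terms5 W30 i1 i5 i3 i2 WM.
have MN : 0 < M%:R :> R by rewrite ltr0n.
(* The node steps have size of order [t], with cubic errors [t ^+ 3] in each of [M = t ^- 2] rounds;
   hence the total error of order [t]. *)
pose t := Num.sqrt (M%:R^-1 : R).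
have t0 : 0 <= t by exact: sqrtr_ge0.
have t2 : t ^+ 2 = M%:R^-1 by rewrite sqr_sqrtr// invr_ge0 ltW.
have Mt : M%:R * t ^+ 2 = 1 by rewrite t2 mulfV// gt_eqF.
have tM z : z <= M%:R -> z * t ^+ 2 <= 1.
  by move=> zM; rewrite t2 ler_pdivrMr// mul1r.
have t1 : t <= 1.
  rewrite -[leRHS]sqrtr1 /t; apply: ler_wsqrtr; rewrite invf_le1//.
  by rewrite (ler_nat _ 1).
have t21 : t ^+ 2 <= t by rewrite expr2 ler_piMl.
pose h := Num.sqrt (gam / M%:R).
have hE : h = Num.sqrt gam * t by rewrite /h sqrtrM.
have h0 : 0 <= h by exact: sqrtr_ge0.
have h2 : h ^+ 2 = gam * t ^+ 2 by rewrite hE exprMn sqr_sqrtr.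
have h3 : h ^+ 3 = gam * Num.sqrt gam * t ^+ 3.
  by rewrite exprSr h2 hE; ring.
have Kh : K * `|h| <= 1 / 2.
  rewrite ger0_norm//; have : (K * h) ^+ 2 <= (1 / 2) ^+ 2.
    by rewrite exprMn h2 mulrA; move/tM: w4; exact: le_quarter.
  by rewrite ler_pXn2r ?nnegrE// ?mulr_ge0.
have Ch : C * (n * h ^+ 2) <= 1.
  by move/tM: w5; rewrite h2 !mulrA.
have small2 : W2 * t ^+ 2 <= 1 / 2.
  by move/tM: w3; rewrite -mulrA => /le_half; rewrite mulr1.
apply: (le_trans (edges_le_erased o S r0 r1 K1 LK M0 eK small v0)).
rewrite -mulrA ler_wpM2l//; first by rewrite exprn_ge0//; lra.
pose x := cc * t ^+ 2 + 2 * (C * expR 1 * (N * mom3 L + N * mom2 L * (N * mom1 L) / M%:R) / M%:R + W1 * t ^+ 3) + 2 * `|cc * t ^+ 2| * (W2 * t ^+ 2).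
have t32 : t ^+ 3 <= t ^+ 2 by rewrite [leLHS]exprS ler_piMl// exprn_ge0.
have rnd : leF (ops [seq (a, erase M L) | a <- es] Phi)
    (fun u => expR x * ops [seq (a, sign_law h) | a <- vs] Phi u).
  move=> u u0.
  have up := edge_round_le o S r0 r1 K1 LK eK u0 M0 w2.
  have lo := node_round_le o S r0 r1 K1 h0 Kh vK u0 Ch.
  rewrite -/n in lo.
  have eB : C * expR 1 * (n + n * n) * h ^+ 3 = W1 * t ^+ 3 by rewrite h3 /W1; ring.
  rewrite eB in lo.
  have P0 := Phi_ge0 o S r u0.
  apply: (round_compare P0 _ _ _ small2 up lo).
  - apply: divr_ge0; last exact: ltW.
    apply: mulr_ge0; first exact: mulr_ge0.
    apply: addr_ge0; first exact: mulr_ge0.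
    by apply: divr_ge0; [apply: mulr_ge0; exact: mulr_ge0|exact: ltW].
  - by apply: mulr_ge0 => //; exact: exprn_ge0.
  - rewrite /W2 mulrDl; apply: lerD.
      rewrite h2 normrM ger0_norm ?mulr_ge0 ?exprn_ge0//.
      rewrite [leRHS](_ : _ = gam * t ^+ 2 * (n * (2 * K ^+ 2))); last by ring.
      rewrite ler_wpM2l//; first by rewrite mulr_ge0// exprn_ge0.
      exact: (sum_ell_le o S r0 r1 K1).
    by rewrite ler_wpM2l.
  - rewrite h2 t2; have := Hdrift u u0 => Hd.
    have iM : 0 <= M%:R^-1 :> R by rewrite invr_ge0 ltW.
    have := ler_wpM2l iM Hd; lra.
have lG c : List.In c [seq (a, erase M L) | a <- es] -> good_chan K c.
  by apply: good_map => //; exact: mean_zero_erase.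
have nG c : List.In c [seq (a, sign_law h) | a <- vs] -> good_chan K c.
  by apply: good_map => //; exact: mean_zero_sign.
have := ops_pw_le M (expR_ge0 x) lG nG rnd v0; move/le_trans; apply.
rewrite -expRM_natl ler_wpM2r//.
  have : leF (fun=> 0) (ops (pw M [seq (a, sign_law h) | a <- vs]) Phi).
    have z0 : ops (pw M [seq (a, sign_law h) | a <- vs]) (fun=> 0) = fun=> 0.
      have e F : (fun u : Om -> R => 0 * F u : R) = fun=> 0.
        by apply/funext => u; rewrite mul0r.
      by rewrite -[in LHS](e Phi) opsZ e.
    rewrite -z0; apply: (ops_le (K := K)); last by move=> u; exact: Phi_ge0.
    by move=> c /In_pw; exact: nG.
  exact.
rewrite ler_expR.
have -> : M%:R * x = cc * (M%:R * t ^+ 2) + 2 * (C * expR 1 * (N * mom3 L)) + 2 * Q * M%:R^-1 +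
    2 * W1 * (M%:R * t ^+ 2 * t) + 2 * `|cc| * W2 * (M%:R * t ^+ 2 * t ^+ 2).
  rewrite /x /Q normrM (ger0_norm (exprn_ge0 2 t0)); field.
  by rewrite gt_eqF.
rewrite -/t -/W Mt -t2 !mul1r mulr1.
have : 2 * Q * t ^+ 2 <= 2 * Q * t by rewrite ler_wpM2l// mulr_ge0.
have : 2 * `|cc| * W2 * t ^+ 2 <= 2 * `|cc| * W2 * t by rewrite ler_wpM2l// !mulr_ge0.
have : W3 * t <= W * t by rewrite ler_wpM2r// /W; do 4!(apply: ler_wpDr => //).
rewrite /W3 -/N; lra.
Qed.
End Guerra.

(** * Comparison of the one-vertex walk with a Gaussian channel *)

Section Gaussian.
Context {R : realType}.
Implicit Types (s t k y m : R) (f g : R -> R).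
Local Notation mu := (@lebesgue_measure R).

Definition gauss t y : R := normal_pdf 0 (Num.sqrt t) y.

Lemma gaussE t y : 0 < t ->
  gauss t y = normal_peak (Num.sqrt t) * expR (- (y ^+ 2 / (2 * t))).
Proof.
move=> t0; have s0 : Num.sqrt t != 0 by rewrite gt_eqF// sqrtr_gt0.
rewrite /gauss normal_pdfE// /normal_fun subr0 sqr_sqrtr ?ltW// mulNr.
by rewrite mulr_natl.
Qed.

Lemma gauss_ge0 t y : 0 <= gauss t y.
Proof. exact: normal_pdf_ge0. Qed.

Lemma measurable_gauss t : measurable_fun setT (gauss t).
Proof. exact: measurable_normal_pdf. Qed.

Lemma continuous_gauss t : 0 < t -> continuous (gauss t).
Proof. by move=> t0; apply: continuous_normal_pdf; rewrite gt_eqF// sqrtr_gt0. Qed.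

Lemma normal_pdf_sqrtE m t y : 0 < t ->
  normal_pdf m (Num.sqrt t) y = normal_peak (Num.sqrt t) * expR (- ((y - m) ^+ 2 / (2 * t))).
Proof.
move=> t0; have s0 : Num.sqrt t != 0 by rewrite gt_eqF// sqrtr_gt0.
by rewrite normal_pdfE// /normal_fun sqr_sqrtr ?ltW// mulNr mulr_natl.
Qed.

Lemma normal_peak_sqrt t : 0 < t -> normal_peak (Num.sqrt t) = (Num.sqrt (2 * pi * t))^-1.
Proof.
move=> t0; rewrite /normal_peak sqr_sqrtr ?ltW//; congr (Num.sqrt _)^-1.
by rewrite -mulr_natl; ring.
Qed.

(** The last factor is the conditional density of the first increment given the sum [w] (a Brownian
    bridge). *)
Lemma gauss_conv s t a w : 0 < s -> 0 < t ->
  gauss s a * gauss t (w - a) =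
  gauss (s + t) w * normal_pdf (s * w / (s + t)) (Num.sqrt (s * t / (s + t))) a.
Proof.
move=> s0 t0; have st : 0 < s + t by exact: addr_gt0.
have q0 : 0 < s * t / (s + t) by rewrite divr_gt0// mulr_gt0.
rewrite !gaussE// normal_pdf_sqrtE// !normal_peak_sqrt//.
rewrite mulrACA [RHS]mulrACA -!invfM -!sqrtrM ?mulr_ge0 ?pi_ge0 ?ltW// -!expRD.
congr (_ * expR _).
  by congr (Num.sqrt _)^-1; field; rewrite gt_eqF.
field; apply/and3P; split; rewrite gt_eqF//.
Qed.

(** Integrability is included so that such means can be added and compared; nonnegative functions go
    through the extended-valued [gint] instead. *)
Definition gauss_mean t f m : Prop :=
  mu.-integrable setT (fun y => (f y * gauss t y)%:E) /\
  (\int[mu]_y (f y * gauss t y)%:E = m%:E)%E.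

Lemma gauss_mean_expR t k : 0 < t ->
  gauss_mean t (fun y => expR (k * y)) (expR (k ^+ 2 * t / 2)).
Proof.
move=> t0.
have e y : expR (k * y) * gauss t y = expR (k ^+ 2 * t / 2) * normal_pdf (k * t) (Num.sqrt t) y.
  rewrite gaussE// normal_pdf_sqrtE// mulrCA [RHS]mulrCA -!expRD; congr (_ * expR _).
  by field; rewrite gt_eqF.
have i := integrable_normal_pdf (k * t) (Num.sqrt t).
split.
  under eq_fun do rewrite e EFinM.
  exact: integrableZl.
under eq_integral do rewrite e EFinM.
by rewrite integralZl// integral_normal_pdf mule1.
Qed.

Lemma gauss_meanD t f g a b : gauss_mean t f a -> gauss_mean t g b ->
  gauss_mean t (fun y => f y + g y) (a + b).
Proof.
move=> [fi fe] [gi ge]; split.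
  under eq_fun do rewrite mulrDl EFinD.
  exact: integrableD.
under eq_integral do rewrite mulrDl EFinD.
by rewrite integralD// fe ge.
Qed.

Lemma gauss_meanZ t f a c : gauss_mean t f a -> gauss_mean t (fun y => c * f y) (c * a).
Proof.
move=> [fi fe]; split.
  under eq_fun do rewrite -mulrA EFinM.
  exact: integrableZl.
under eq_integral do rewrite -mulrA EFinM.
by rewrite integralZl// fe.
Qed.

Lemma gauss_mean_cst t c : 0 < t -> gauss_mean t (fun=> c) c.
Proof.
move=> t0; have := gauss_meanZ c (gauss_mean_expR 0 t0).
rewrite expr0n/= !mul0r expR0 mulr1.
by under eq_fun do rewrite mul0r expR0 mulr1.
Qed.

Lemma gauss_mean_sum t (I : finType) (f : I -> R -> R) (a : I -> R) : 0 < t ->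
  (forall i, gauss_mean t (f i) (a i)) ->
  gauss_mean t (fun y => \sum_i f i y) (\sum_i a i).
Proof.
move=> t0 fa.
have h (l : seq I) : gauss_mean t (fun y => \sum_(i <- l) f i y) (\sum_(i <- l) a i).
  elim: l => [|i l IH].
    rewrite big_nil; under [X in gauss_mean t X _]eq_fun do rewrite big_nil.
    exact: gauss_mean_cst.
  rewrite big_cons; under [X in gauss_mean t X _]eq_fun do rewrite big_cons.
  exact: gauss_meanD.
exact: h.
Qed.

Lemma gauss_mean_eq t f g a : gauss_mean t f a -> f =1 g -> gauss_mean t g a.
Proof. by move=> h fg; have <- : f = g by apply/funext. Qed.

Definition gint t f : \bar R := (\int[mu]_y (f y * gauss t y)%:E)%E.

Lemma measurable_fgauss t f : continuous f -> measurable_fun [set: R] (EFin \o (fun y => f y * gauss t y)).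
Proof.
move=> cf; apply/measurable_EFinP; apply: measurable_funM; last exact: measurable_gauss.
exact: continuous_measurable_fun.
Qed.

Lemma gauss_mean_le t f a g : gauss_mean t f a -> continuous g ->
  (forall y, 0 <= g y) -> (forall y, f y <= g y) -> (a%:E <= gint t g)%E.
Proof.
move=> [fi fe] cg g0 fg; rewrite -fe.
have mg := measurable_fgauss t cg.
have [gy|] := ltP (gint t g) +oo%E; last by rewrite leye_eq => /eqP ->; rewrite leey.
apply: le_integral => //.
  apply/integrableP; split => //.
  by under eq_integral do rewrite gee0_abs ?lee_fin ?mulr_ge0 ?gauss_ge0//.
by move=> y _; rewrite lee_fin ler_wpM2r// gauss_ge0.
Qed.

Lemma integral_shift f a : continuous f -> (forall y, 0 <= f y) ->
  (\int[mu]_y (f y)%:E = \int[mu]_y (f (y - a))%:E)%E.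
Proof.
move=> cf f0.
have d : ((fun y : R => y - a)^`())%classic = cst 1.
  apply/funext => y; rewrite derive1E.
  have := @is_deriveB R R R id (cst a) y 1 1 0 _ _; rewrite subr0.
  by move=> h; have [_ ->] := h.
rewrite (@increasing_ge0_integration_by_substitutionT R (fun y => y - a) f)//.
- by apply: eq_integral => y _; rewrite d /= fctE/= mulr1.
- by move=> x y xy; rewrite ltrD2r.
- by rewrite d; move=> x; exact: cvg_cst.
- by rewrite d; exact: is_cvg_cst.
- by rewrite d; exact: is_cvg_cst.
- exact: cvg_addrr_Ny.
- exact: cvg_addrr.
Qed.

(** Shift the inner variable to the sum of the increments, exchange the integrals by Tonelli, and
    integrate out the bridge density of [gauss_conv]. *)
Lemma gint_semigroup s t f : 0 < s -> 0 < t -> continuous f -> (forall y, 0 <= f y) ->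
  (\int[mu]_a ((gauss s a)%:E * gint t (fun b => f (a + b)%R)) = gint (s + t)%R f)%E.
Proof.
move=> s0 t0 cf f0.
pose h (z : R * R) := (gauss s z.1 * (f z.2 * gauss t (z.2 - z.1)))%:E.
have h0 z : (0 <= h z)%E by rewrite lee_fin !mulr_ge0// ?gauss_ge0.
have mh : measurable_fun setT h.
  apply/measurable_EFinP; apply: measurable_funM.
    by apply: measurableT_comp => //; exact: measurable_gauss.
  apply: measurable_funM.
    by apply: measurableT_comp => //; exact: continuous_measurable_fun.
  apply: measurableT_comp; first exact: measurable_gauss.
  by apply: measurable_funB.
transitivity (\int[mu]_a \int[mu]_w h (a, w))%E.
  apply: eq_integral => a _; rewrite /gint.
  have cg : continuous (fun b => f (a + b) * gauss t b).
    move=> b; apply: cvgM; last exact: continuous_gauss.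
    apply: (@continuous_comp _ _ _ (fun b : R => a + b) f); last exact: cf.
    by apply: cvgD; [exact: cvg_cst|exact: cvg_id].
  rewrite (integral_shift a cg); last by move=> y; rewrite mulr_ge0// gauss_ge0.
  rewrite -ge0_integralZl//=.
  - by apply: eq_integral => w _; rewrite /h/= -EFinM (addrC a) subrK.
  - apply/measurable_EFinP; apply: (measurableT_comp (f := fun b => f (a + b) * gauss t b)).
      exact: continuous_measurable_fun.
    exact: measurable_funB.
  - by move=> y _; rewrite lee_fin mulr_ge0// gauss_ge0.
  - by rewrite lee_fin gauss_ge0.
rewrite fubini_tonelli//; apply: eq_integral => w _.
under eq_integral do rewrite /h/= mulrCA gauss_conv// mulrA EFinM.
rewrite ge0_integralZl//.
- by rewrite integral_normal_pdf mule1.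
- by apply/measurable_EFinP; exact: measurable_normal_pdf.
- by move=> y _; rewrite lee_fin normal_pdf_ge0.
- by rewrite lee_fin mulr_ge0// gauss_ge0.
Qed.

Lemma measurable_gint_shift t f : continuous f -> (forall y, 0 <= f y) ->
  measurable_fun [set: R] (fun a => gint t (fun b => f (a + b)%R)).
Proof.
move=> cf f0.
pose h (z : R * R) := (f (z.1 + z.2) * gauss t z.2)%:E.
have h0 z : (0 <= h z)%E by rewrite lee_fin mulr_ge0// gauss_ge0.
have mh : measurable_fun setT h.
  apply/measurable_EFinP; apply: measurable_funM.
    apply: measurableT_comp; first exact: continuous_measurable_fun.
    by apply: measurable_funD.
  by apply: measurableT_comp => //; exact: measurable_gauss.
exact: (measurable_fun_fubini_tonelli_F (m2 := mu) h mh h0).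
Qed.

Lemma gint_ge0 t f : (forall y, 0 <= f y) -> (0 <= gint t f)%E.
Proof. by move=> f0; apply: integral_ge0 => y _; rewrite lee_fin mulr_ge0// gauss_ge0. Qed.

Lemma gint_le_step s t (c : R) f g : 0 < s -> 0 < t -> 0 <= c -> continuous f ->
  continuous g -> (forall y, 0 <= f y) -> (forall y, 0 <= g y) ->
  (forall y, ((g y)%:E <= c%:E * gint t (fun b => f (y + b)%R))%E) ->
  (gint s g <= c%:E * gint (s + t)%R f)%E.
Proof.
move=> s0 t0 c0 cf cg f0 g0 gf.
have mi := measurable_gint_shift t cf f0.
have mgs : measurable_fun [set: R] (fun a : R => (gauss s a)%:E).
  by apply/measurable_EFinP; exact: measurable_gauss.
have i0 a : (0 <= (gauss s a)%:E * gint t (fun b => f (a + b)%R))%E.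
  by rewrite mule_ge0// ?lee_fin ?gauss_ge0// gint_ge0.
rewrite -(gint_semigroup s0 t0 cf f0) -ge0_integralZl//; last exact: emeasurable_funM.
apply: ge0_le_integral => //.
- by move=> y _; rewrite lee_fin mulr_ge0// gauss_ge0.
- exact: measurable_fgauss.
- by apply: measurable_funeM; exact: emeasurable_funM.
- move=> y _; rewrite EFinM muleC muleCA; apply: lee_wpmul2l; last exact: gf.
  by rewrite lee_fin gauss_ge0.
Qed.

Lemma gintD s f g : continuous f -> continuous g -> (forall y, 0 <= f y) ->
  (forall y, 0 <= g y) -> (gint s (fun y => f y + g y)%R = gint s f + gint s g)%E.
Proof.
move=> cf cg f0 g0; rewrite /gint -ge0_integralD//.
- by apply: eq_integral => y _; rewrite -EFinD mulrDl.
- by move=> y _; rewrite lee_fin mulr_ge0// gauss_ge0.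
- exact: measurable_fgauss.
- by move=> y _; rewrite lee_fin mulr_ge0// gauss_ge0.
- exact: measurable_fgauss.
Qed.

Lemma gintZ s (c : R) f : 0 <= c -> continuous f -> (forall y, 0 <= f y) ->
  (gint s (fun y => c * f y)%R = c%:E * gint s f)%E.
Proof.
move=> c0 cf f0; rewrite /gint -ge0_integralZl//.
- by apply: eq_integral => y _; rewrite -EFinM mulrA.
- exact: measurable_fgauss.
- by move=> y _; rewrite lee_fin mulr_ge0// gauss_ge0.
Qed.

End Gaussian.

Section Walk.
Context {R : realType}.

Lemma expR_le_quad (z : R) : z <= 1 / 2 -> expR z <= 1 + z + 2 * z ^+ 2.
Proof.
move=> z2; have := expR_ge1Dx (- z); rewrite expRN => h.
have e0 := expR_gt0 z.
have h1 : (1 - z) * expR z <= 1 by rewrite -ler_pdivlMr// mul1r.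
have h2 : 1 <= (1 - z) * (1 + z + 2 * z ^+ 2) by have := sqr_ge0 z; nra.
by rewrite -(@ler_pM2l _ (1 - z)); lra.
Qed.

(* The cubic remainder is dominated by even powers, whose Gaussian means are explicit. *)
Lemma powR_ge_quartic (r w h : R) : 0 < r <= 2 -> 0 <= w -> 0 < h ->
  1 + r * (w - 1) + r * (r - 1) / 2 * (w - 1) ^+ 2 -
  36 * (h * (w - 1) ^+ 2 + (w - 1) ^+ 4 / h) <= w `^ r.
Proof.
move=> r02 w0 h0; set y := w - 1; have wy : w = 1 + y by rewrite /y; ring.
have amgm : `|y| ^+ 3 <= 1 / 2 * (h * y ^+ 2 + y ^+ 4 / h).
  have -> : y ^+ 4 = `|y| ^+ 4 by rewrite !(exprM _ 2 2) real_normK// num_real.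
  rewrite -(@real_normK _ y) ?num_real//.
  move: `|y| (normr_ge0 y) => z z0.
  have : 0 <= (h - z) ^+ 2 * (z ^+ 2 / h) by rewrite mulr_ge0 ?sqr_ge0// divr_ge0 ?sqr_ge0// ltW.
  have -> : (h - z) ^+ 2 * (z ^+ 2 / h) = h * z ^+ 2 - 2 * z ^+ 3 + z ^+ 4 / h by field; rewrite gt_eqF.
  lra.
have [yh|yh] := leP `|y| (1 / 2).
  have := powR1D_taylor r02 yh; rewrite -wy ler_norml => /andP[+ _]; lra.
(* Away from 1 the subtracted terms, at least [72 * |y| ^+ 3], outweigh all the others, so the left
   side is nonpositive. *)
apply: le_trans (powR_ge0 _ _).
have y3 : 1 / 8 <= `|y| ^+ 3.
  have -> : 1 / 8 = (1 / 2) ^+ 3 :> R by lra.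
  by rewrite lerXn2r ?nnegrE; lra.
have r1 : r * y <= 2 * `|y|.
  apply: le_trans (ler_norm _) _; rewrite normrM gtr0_norm; last by lra.
  by rewrite ler_wpM2r//; lra.
have r2 : r * (r - 1) / 2 * y ^+ 2 <= y ^+ 2.
  by rewrite ler_piMl ?sqr_ge0//; nra.
have y1 : `|y| <= 4 * `|y| ^+ 3.
  rewrite exprS; have : 1 / 4 <= `|y| ^+ 2 by rewrite expr2; nra.
  by have := normr_ge0 y; nra.
have y2 : y ^+ 2 <= 2 * `|y| ^+ 3.
  rewrite -(@real_normK _ y) ?num_real//.
  have : 0 <= `|y| ^+ 2 * (2 * `|y| - 1) by apply: mulr_ge0; [exact: sqr_ge0|lra].
  lra.
lra.
Qed.


End Walk.

(** An upper bound for 3024 + 108 + 2, the coefficients of the quartic, added quadratic and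
    curvature errors in [gauss_step_ge]. *)
HB.lock Definition gauss_cst {R : realType} (k : R) : R := 3300 * k ^+ 4.

Section GaussStep.
Context {R : realType} (Om : finType) (i0 : Om) (x : Om -> R) (K : R).
Hypotheses (K1 : 1 <= K) (xK : forall i, `|x i| <= K).
Implicit Types (v : Om -> R) (t y h r : R).
Local Notation Z := (part [set: Om]).
Local Notation u := (avg [set: Om] x).

Let K0 : 0 <= K. Proof. by apply: le_trans K1. Qed.

(** The exponential is the likelihood ratio at [y] of N(t x_i, t) against N(0, t), so this is an
    unnormalized posterior for a Gaussian observation. *)
Definition gtilt t y v : Om -> R := fun i => v i * expR (x i * y - t * x i ^+ 2 / 2).

Definition gpart r t v y : R := Z (gtilt t y v) `^ r.

Lemma Z_gt0 v : pos v -> 0 < Z v.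
Proof.
move=> v0; rewrite /part (bigD1 i0) ?inE//= ltr_wpDr//; apply: sumr_ge0 => i _; exact: ltW.
Qed.

Lemma gtilt_pos t y v : pos v -> pos (gtilt t y v).
Proof. by move=> v0 i; rewrite mulr_gt0// expR_gt0. Qed.

Lemma sum_weights v : pos v -> \sum_i v i / Z v = 1.
Proof.
move=> v0; rewrite -mulr_suml -[X in X / _]/(\sum_i v i).
have -> : \sum_i v i = Z v by rewrite /part; apply: eq_bigl => i; rewrite inE.
by rewrite mulfV// gt_eqF// Z_gt0.
Qed.

Lemma avg_weights v : pos v -> u v = \sum_i v i / Z v * x i.
Proof.
move=> v0; rewrite /avg mulr_suml; apply: eq_big => i; first by rewrite inE.
by move=> _; rewrite mulrAC.
Qed.

Lemma continuous_sum (I : finType) (A : {set I}) (f : I -> R -> R) :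
  (forall i, continuous (f i)) -> continuous (fun y => \sum_(i in A) f i y).
Proof.
move=> fc; have h (l : seq I) : continuous (fun y => \sum_(i <- l | i \in A) f i y).
  elim: l => [|i l IH].
    by under eq_fun do rewrite big_nil; move=> y; exact: cvg_cst.
  under eq_fun do rewrite big_cons.
  by case: (i \in A) => // y; apply: cvgD; [exact: fc|exact: IH].
exact: h.
Qed.

Lemma continuous_gpart r t v : pos v -> continuous (gpart r t v).
Proof.
move=> v0 y; apply: (@continuous_comp _ _ _ (fun y => Z (gtilt t y v)) (@powR R ^~ r)).
  apply: continuous_sum => i {}y; apply: cvgM; first exact: cvg_cst.
  apply: (@continuous_comp _ _ _ (fun y : R => x i * y - t * x i ^+ 2 / 2) expR); last exact: continuous_expR.
  apply: cvgB; last exact: cvg_cst.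
  by apply: cvgM; [exact: cvg_cst|exact: cvg_id].
apply: differentiable_continuous; apply/derivable1_diffP; apply: derivable_powR.
by rewrite in_itv/= andbT Z_gt0//; exact: gtilt_pos.
Qed.

Let ee t i y := expR (x i * y - t * x i ^+ 2 / 2).

Let ee_mean t i : 0 < t -> gauss_mean t (ee t i) 1.
Proof.
move=> t0; have := gauss_meanZ (expR (- (t * x i ^+ 2 / 2))) (gauss_mean_expR (x i) t0).
rewrite -expRD (_ : - _ + _ = 0); last by field.
rewrite expR0 => h; apply: gauss_mean_eq h _ => y.
by rewrite -expRD /ee; congr expR; ring.
Qed.

Let ee2_mean t i j : 0 < t -> gauss_mean t (fun y => ee t i y * ee t j y) (expR (t * (x i * x j))).
Proof.
move=> t0; have := gauss_meanZ (expR (- (t * (x i ^+ 2 + x j ^+ 2) / 2))) (gauss_mean_expR (x i + x j) t0).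
rewrite -expRD (_ : - _ + _ = t * (x i * x j)); last by field.
move=> h; apply: gauss_mean_eq h _ => y.
by rewrite -!expRD; congr expR; field.
Qed.

Let eek_mean t i (k : nat) : 0 < t ->
  gauss_mean t (fun y => ee t i y ^+ k) (expR ((k%:R ^+ 2 - k%:R) / 2 * (t * x i ^+ 2))).
Proof.
move=> t0; have := gauss_meanZ (expR (- (k%:R * (t * x i ^+ 2) / 2))) (gauss_mean_expR (k%:R * x i) t0).
rewrite -expRD (_ : - _ + _ = (k%:R ^+ 2 - k%:R) / 2 * (t * x i ^+ 2)); last by field.
move=> h; apply: gauss_mean_eq h _ => y.
by rewrite -expRD /ee -expRM_natl; congr expR; field.
Qed.

Let cov_mean t i j : 0 < t -> gauss_mean t (fun y => (ee t i y - 1) * (ee t j y - 1))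
  (expR (t * (x i * x j)) - 1).
Proof.
move=> t0; have h1 := gauss_meanD (gauss_meanD (ee2_mean i j t0) (gauss_meanZ (-1) (ee_mean i t0)))
  (gauss_meanD (gauss_meanZ (-1) (ee_mean j t0)) (gauss_mean_cst 1 t0)).
have -> : expR (t * (x i * x j)) - 1 = expR (t * (x i * x j)) + -1 * 1 + (-1 * 1 + 1) by ring.
by apply: gauss_mean_eq h1 _ => y; ring.
Qed.

Let quart_mean t i : 0 < t -> gauss_mean t (fun y => (ee t i y - 1) ^+ 4)
  (expR (6 * (t * x i ^+ 2)) - 4 * expR (3 * (t * x i ^+ 2)) + 6 * expR (t * x i ^+ 2) - 3).
Proof.
move=> t0.
have h := gauss_meanD (gauss_meanD (eek_mean i 4 t0) (gauss_meanZ (-4) (eek_mean i 3 t0)))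
  (gauss_meanD (gauss_meanD (gauss_meanZ 6 (eek_mean i 2 t0)) (gauss_meanZ (-4) (ee_mean i t0)))
    (gauss_mean_cst 1 t0)).
have e : expR (6 * (t * x i ^+ 2)) - 4 * expR (3 * (t * x i ^+ 2)) + 6 * expR (t * x i ^+ 2) - 3 =
  expR ((4%:R ^+ 2 - 4%:R) / 2 * (t * x i ^+ 2)) + -4 * expR ((3%:R ^+ 2 - 3%:R) / 2 * (t * x i ^+ 2)) +
  (6 * expR ((2%:R ^+ 2 - 2%:R) / 2 * (t * x i ^+ 2)) + -4 * 1 + 1).
  have -> : (4%:R ^+ 2 - 4%:R) / 2 = 6 :> R by lra.
  have -> : (3%:R ^+ 2 - 3%:R) / 2 = 3 :> R by lra.
  have -> : (2%:R ^+ 2 - 2%:R) / 2 = 1 :> R by lra.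
  by rewrite mul1r; ring.
rewrite e; apply: gauss_mean_eq h _ => y; ring.
Qed.


Let jensen_sqr (m z : Om -> R) : (forall i, 0 <= m i) -> \sum_i m i = 1 ->
  (\sum_i m i * z i) ^+ 2 <= \sum_i m i * z i ^+ 2.
Proof.
move=> m0 m1; set b := \sum_i m i * z i.
have : 0 <= \sum_i m i * (z i - b) ^+ 2.
  by apply: sumr_ge0 => i _; rewrite mulr_ge0 ?sqr_ge0.
have -> : \sum_i m i * (z i - b) ^+ 2 = \sum_i (m i * z i ^+ 2 + (- (2 * b) * (m i * z i) + b ^+ 2 * m i)).
  by apply: eq_bigr => i _; ring.
by rewrite !big_split/= -!mulr_sumr m1 -/b; lra.
Qed.

Lemma quadratic_part_le (r h k E U : R) : 0 < r <= 2 -> 0 <= h -> U <= E ->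
  E <= U + 2 * (h ^+ 4 * k) -> U <= h ^+ 2 * k ->
  r * (r - 1) / 2 * U - 2 * (h ^+ 4 * k) <= r * (r - 1) / 2 * E /\
  h * E <= h ^+ 3 * k + 2 * (h ^+ 5 * k).
Proof.
move=> /andP[r0 r2] h0 UE EU Uk; split; last first.
  have := ler_wpM2l h0 (le_trans EU (lerD Uk (lexx _))).
  by move/le_trans; apply; rewrite le_eqVlt; apply/orP; left; apply/eqP; ring.
have EU0 : 0 <= E - U by lra.
have c1 : - 1 <= r * (r - 1) / 2 by have := sqr_ge0 (r - 1 / 2); lra.
have := ler_wpM2r EU0 c1; move: (r * (r - 1) / 2) => c; lra.
Qed.

(** The constant and linear coefficients cancel: 1 - 4 + 6 - 3 = 0 and 6 - 12 + 6 = 0. The quadratic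
    ones give 2 * 36 + 6 * 2 = 84. *)
Lemma quartic_exp_le (z : R) : `|z| <= 1 / 12 ->
  expR (6 * z) - 4 * expR (3 * z) + 6 * expR z - 3 <= 84 * z ^+ 2.
Proof.
rewrite ler_norml => /andP[_ z1].
have a2 := expR_ge1Dx (3 * z).
have a1 : expR (6 * z) <= 1 + 6 * z + 2 * (6 * z) ^+ 2 by apply: expR_le_quad; lra.
have a3 : expR z <= 1 + z + 2 * z ^+ 2 by apply: expR_le_quad; lra.
lra.
Qed.

(** Let w be the factor by which the Gaussian tilt multiplies [Z v]. It has mean 1, variance close
    to [h ^+ 2 * u v ^+ 2] and fourth central moment O(h^4). In the minorant of [powR_ge_quartic]
    the weights [h] and [1 / h] turn both error terms into O(h^3). *)
Lemma gauss_step_ge r h v : 0 < r <= 2 -> 0 < h <= 1 -> 12 * (K ^+ 2 * h ^+ 2) <= 1 ->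
  pos v ->
  ((Z v `^ r * (1 + r * (r - 1) / 2 * (h ^+ 2 * u v ^+ 2) - gauss_cst K * h ^+ 3))%:E
    <= gint (h ^+ 2) (gpart r (h ^+ 2) v))%E.
Proof.
move=> r02 /andP[h0 h1] Kh v0.
have h20 : 0 < h ^+ 2 by exact: exprn_gt0.
have Zp := Z_gt0 v0.
pose m i := v i / Z v.
have m0 i : 0 <= m i by rewrite divr_ge0// ltW.
have m1 : \sum_i m i = 1 by exact: sum_weights.
have um : u v = \sum_i m i * x i by exact: avg_weights.
pose e i y := ee (h ^+ 2) i y.
pose ww y := \sum_i m i * e i y.
have ww0 y : 0 <= ww y by apply: sumr_ge0 => i _; rewrite mulr_ge0// expR_ge0.
have gpE y : gpart r (h ^+ 2) v y = Z v `^ r * ww y `^ r.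
  rewrite /gpart -(powRM r (ltW Zp) (ww0 y)); congr powR.
  rewrite /part mulr_sumr; apply: eq_big => i; first by rewrite inE.
  move=> _; rewrite /gtilt /m /e /ee -/(Z v) mulrA; congr (_ * _).
  by rewrite mulrC divfK// gt_eqF.
pose c2 := r * (r - 1) / 2 - 36 * h; pose c4 := 36 / h.
have c40 : 0 <= c4 by rewrite divr_ge0// ltW.
pose q y := 1 + r * (\sum_i m i * (e i y - 1)) +
  c2 * (\sum_i \sum_j m i * (m j * ((e i y - 1) * (e j y - 1)))) +
  - c4 * (\sum_i m i * (e i y - 1) ^+ 4).
have ww1 y : ww y - 1 = \sum_i m i * (e i y - 1).
  by under [RHS]eq_bigr do rewrite mulrBr mulr1; rewrite sumrB m1.
have qle y : Z v `^ r * q y <= gpart r (h ^+ 2) v y.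
  rewrite gpE ler_wpM2l ?powR_ge0//; apply: le_trans (powR_ge_quartic r02 (ww0 y) h0).
  (* Jensen for the square, applied twice, reduces the fourth moment of the mixture to that of a
     single lognormal factor. *)
  have j4 : (ww y - 1) ^+ 4 <= \sum_i m i * (e i y - 1) ^+ 4.
    rewrite ww1 (exprM _ 2 2).
    apply: (@le_trans _ _ ((\sum_i m i * (e i y - 1) ^+ 2) ^+ 2)).
      rewrite lerXn2r ?nnegrE ?sqr_ge0//; last exact: jensen_sqr.
      by apply: sumr_ge0 => i _; rewrite mulr_ge0 ?sqr_ge0.
    apply: le_trans (jensen_sqr _ m0 m1) _.
    by apply: ler_sum => i _; rewrite -exprM.
  have e2 : (ww y - 1) ^+ 2 = \sum_i \sum_j m i * (m j * ((e i y - 1) * (e j y - 1))).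
    rewrite ww1 expr2 mulr_suml; apply: eq_bigr => i _; rewrite mulr_sumr.
    by apply: eq_bigr => j _; ring.
  rewrite /q -e2 -ww1.
  have := ler_wpM2l c40 j4.
  have -> : (ww y - 1) ^+ 4 / h = c4 * (ww y - 1) ^+ 4 / 36 by rewrite /c4; field; rewrite gt_eqF.
  by rewrite /c2; lra.
have qmean : gauss_mean (h ^+ 2) q (1 + r * (\sum_i m i * (1 + - 1)) +
   c2 * (\sum_i \sum_j m i * (m j * (expR (h ^+ 2 * (x i * x j)) - 1))) +
   - c4 * (\sum_i m i * (expR (6 * (h ^+ 2 * x i ^+ 2)) - 4 * expR (3 * (h ^+ 2 * x i ^+ 2)) +
       6 * expR (h ^+ 2 * x i ^+ 2) - 3))).
  apply: gauss_meanD; last first.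
    by apply: gauss_meanZ; apply: gauss_mean_sum => // i; apply: gauss_meanZ; exact: quart_mean.
  apply: gauss_meanD; last first.
    apply: gauss_meanZ; apply: gauss_mean_sum => // i; apply: gauss_mean_sum => // j.
    by apply: gauss_meanZ; apply: gauss_meanZ; exact: cov_mean.
  apply: gauss_meanD; first exact: gauss_mean_cst.
  apply: gauss_meanZ; apply: gauss_mean_sum => // i; apply: gauss_meanZ.
  by apply: gauss_meanD; [exact: ee_mean|exact: gauss_mean_cst].
have cg : continuous (gpart r (h ^+ 2) v) by exact: continuous_gpart.
have := gauss_mean_le (gauss_meanZ (Z v `^ r) qmean) cg (fun y => powR_ge0 _ _) qle.
apply: le_trans.
rewrite lee_fin ler_wpM2l ?powR_ge0//.
clear qmean qle cg gpE ww1 ww0 q ww e.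
have -> : \sum_i m i * (1 + - 1) = 0 by apply: big1 => i _; rewrite subrr mulr0.
have xx i j : `|x i * x j| <= K ^+ 2 by rewrite normrM expr2 ler_pM.
have KK : K ^+ 2 <= K ^+ 4 by rewrite ler_weXn2l.
have h34 : h ^+ 4 <= h ^+ 3 by rewrite [leLHS]exprS ler_piMl// exprn_ge0// ltW.
have h35 : h ^+ 5 <= h ^+ 3 by rewrite [leLHS](exprD _ 2 3) ler_piMl ?exprn_ge0 ?exprn_ile1// ltW.
have h40 : 0 <= h ^+ 4 by rewrite exprn_ge0// ltW.
have h30 : 0 <= h ^+ 3 by rewrite exprn_ge0// ltW.
have K40 : 0 <= K ^+ 4 by rewrite exprn_ge0.
have zb i j : `|h ^+ 2 * (x i * x j)| <= K ^+ 2 * h ^+ 2.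
  rewrite normrM (ger0_norm (ltW h20)) mulrC; apply: ler_wpM2r; [exact: ltW|exact: xx].
have zsq i j : (h ^+ 2 * (x i * x j)) ^+ 2 <= h ^+ 4 * K ^+ 4.
  have -> : h ^+ 4 * K ^+ 4 = (K ^+ 2 * h ^+ 2) ^+ 2 by ring.
  rewrite -[leLHS]real_normK ?num_real//; apply: lerXn2r; rewrite ?nnegrE//.
  by apply: mulr_ge0; apply: exprn_ge0 => //; exact: ltW.
set E2 := \sum_i \sum_j _.
have mm : \sum_i \sum_j m i * (m j * 1) = 1.
  by under eq_bigr do rewrite -mulr_sumr -mulr_suml m1 mul1r mulr1.
have u2 : h ^+ 2 * u v ^+ 2 = \sum_i \sum_j m i * (m j * (h ^+ 2 * (x i * x j))).
  rewrite um (expr2 (\sum_i _)) mulr_suml mulr_sumr; apply: eq_bigr => i _; rewrite mulr_sumr mulr_sumr.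
  by apply: eq_bigr => j _; ring.
have E2lo : h ^+ 2 * u v ^+ 2 <= E2.
  rewrite u2; apply: ler_sum => i _; apply: ler_sum => j _.
  by rewrite !ler_wpM2l// lerBrDl expR_ge1Dx.
have E2hi : E2 <= h ^+ 2 * u v ^+ 2 + 2 * (h ^+ 4 * K ^+ 4).
  have -> : 2 * (h ^+ 4 * K ^+ 4) = \sum_i \sum_j m i * (m j * (2 * (h ^+ 4 * K ^+ 4))).
    rewrite -[LHS]mul1r -mm mulr_suml; apply: eq_bigr => i _; rewrite mulr_suml.
    by apply: eq_bigr => j _; ring.
  rewrite u2 -big_split; apply: ler_sum => i _; rewrite -big_split; apply: ler_sum => j _ /=.
  rewrite -!mulrDr !ler_wpM2l// lerBlDl.
  have zz := zb i j; have := zsq i j; move: (h ^+ 2 * (x i * x j)) zz => z; rewrite ler_norml => /andP[_ z1] z2.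
  by have := @expR_le_quad _ z; lra.
have ub : h ^+ 2 * u v ^+ 2 <= h ^+ 2 * K ^+ 4.
  apply: ler_wpM2l; [exact: ltW|apply: le_trans KK].
  rewrite -[leLHS]real_normK ?num_real// lerXn2r ?nnegrE//.
  exact: avg_le.
have QE : \sum_i m i * (expR (6 * (h ^+ 2 * x i ^+ 2)) - 4 * expR (3 * (h ^+ 2 * x i ^+ 2)) +
       6 * expR (h ^+ 2 * x i ^+ 2) - 3) <= 84 * (h ^+ 4 * K ^+ 4).
  have -> : 84 * (h ^+ 4 * K ^+ 4) = \sum_i m i * (84 * (h ^+ 4 * K ^+ 4)).
    by rewrite -mulr_suml m1 mul1r.
  apply: ler_sum => i _; rewrite ler_wpM2l//.
  apply: (@le_trans _ _ (84 * (h ^+ 2 * x i ^+ 2) ^+ 2)).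
    by apply: quartic_exp_le; rewrite expr2; apply: le_trans (zb i i) _; lra.
  by have := zsq i i; rewrite -expr2 => zz; rewrite ler_wpM2l.
have Q4 := ler_wpM2l c40 QE.
clear u2 um mm m1 m0 zb zsq xx QE v0.
move: E2 (h ^+ 2 * u v ^+ 2) (\sum_i _) E2lo E2hi ub Q4 => E2 U QS E2lo E2hi ub Q4.
have c4e : c4 * (84 * (h ^+ 4 * K ^+ 4)) = 3024 * (h ^+ 3 * K ^+ 4).
  by rewrite /c4; field; rewrite gt_eqF.
have [c2e hE] := quadratic_part_le r02 (ltW h0) E2lo E2hi ub.
have k1 : h ^+ 4 * K ^+ 4 <= h ^+ 3 * K ^+ 4 by rewrite ler_wpM2r.
have k2 : h ^+ 5 * K ^+ 4 <= h ^+ 3 * K ^+ 4 by rewrite ler_wpM2r.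
have k3 : 0 <= h ^+ 3 * K ^+ 4 by exact: mulr_ge0.
rewrite gauss_cst.unlock /c2; lra.
Qed.

End GaussStep.

(** * From sign steps to Gaussian increments *)

Section WalkGauss.
Context {R : realType} (Om : finType) (i0 : Om) (x : Om -> R) (K : R).
Hypotheses (K1 : 1 <= K) (xK : forall i, `|x i| <= K).
Implicit Types (v : Om -> R) (t y h r : R).
Local Notation Z := (part [set: Om]).
Local Notation u := (avg [set: Om] x).

Let K0 : 0 <= K. Proof. by apply: le_trans K1. Qed.

Definition step_cst : R := 2 * (72 * K ^+ 3 + gauss_cst K).

Let gc0 : 0 <= gauss_cst K.
Proof. by rewrite gauss_cst.unlock; apply: mulr_ge0; [exact: ler0n|exact: exprn_ge0]. Qed.

Lemma op_signE h (F : (Om -> R) -> R) v :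
  op (x, sign_law h) F v = 1 / 2 * F (tilt x h v) + 1 / 2 * F (tilt x (- h) v).
Proof. by rewrite /op /Ex !big_cons big_nil addr0. Qed.

Lemma op_walk_le r h v : 0 < r <= 2 -> 0 <= h -> K * `|h| <= 1 / 2 -> pos v ->
  op (x, sign_law h) (fun w => Z w `^ r) v <=
  Z v `^ r * (1 + r * (r - 1) / 2 * (h ^+ 2 * u v ^+ 2) + 72 * K ^+ 3 * h ^+ 3).
Proof.
move=> r02 h0 Kh v0; have Zp := Z_gt0 i0 v0.
have uK : `|u v| <= K by exact: avg_le.
have b z : `|z| = h -> `|z * u v| <= 1 / 2 /\ `|z * u v| ^+ 3 <= K ^+ 3 * h ^+ 3.
  move=> zh; rewrite normrM zh; rewrite (ger0_norm h0) in Kh.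
  have hK : h * `|u v| <= K * h by rewrite mulrC ler_wpM2r.
  split; first exact: le_trans Kh.
  by rewrite -exprMn lerXn2r ?nnegrE// mulr_ge0.
have t z : `|z| = h -> Z (tilt x z v) `^ r <= Z v `^ r *
    (1 + r * (z * u v) + r * (r - 1) / 2 * (h ^+ 2 * u v ^+ 2) + 72 * (K ^+ 3 * h ^+ 3)).
  move=> zh; have [b1 b2] := b z zh.
  rewrite part_tilt// powRM; [|exact: ltW|]; last first.
    by move: b1; rewrite ler_norml => /andP[? ?]; lra.
  rewrite ler_wpM2l ?powR_ge0//.
  have := powR1D_taylor r02 b1; rewrite ler_norml => /andP[_].
  have -> : (z * u v) ^+ 2 = h ^+ 2 * u v ^+ 2 by rewrite exprMn -zh real_normK ?num_real.
  by lra.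
have h1 := t h (ger0_norm h0).
have h2 := t (- h); rewrite normrN in h2; have {h2} := h2 (ger0_norm h0).
rewrite op_signE; move: h1; set P := Z v `^ r; lra.
Qed.

Definition small_step h :=
  [/\ 0 < h <= 1, 12 * (K ^+ 2 * h ^+ 2) <= 1 & gauss_cst K * h ^+ 3 <= 1 / 4].

(** The sign step and the Gaussian increment of variance [h ^+ 2] share mean and variance, hence the
    same second-order expansion. The factor 2 in [step_cst] pays for dividing by the Gaussian side,
    which is at least 2/3 of [Z v] to the power [r]. *)
Lemma walk_step_le r h v : 0 < r <= 2 -> small_step h -> pos v ->
  ((op (x, sign_law h) (fun w => Z w `^ r) v)%:E <=
   (1 + step_cst * h ^+ 3)%:E * gint (h ^+ 2) (gpart x r (h ^+ 2) v))%E.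
Proof.
move=> r02 [h01 Kh gh] v0; have /andP[h0 h1] := h01.
have Zp := Z_gt0 i0 v0.
have lo := gauss_step_ge i0 K1 xK r02 h01 Kh v0.
have Kh' : K * `|h| <= 1 / 2.
  rewrite gtr0_norm//; have : (K * h) ^+ 2 <= (1 / 2) ^+ 2 by rewrite exprMn; lra.
  by rewrite ler_pXn2r ?nnegrE// ?mulr_ge0// ltW.
have up := op_walk_le r02 (ltW h0) Kh' v0.
have e2 : 0 <= gauss_cst K * h ^+ 3 by apply: mulr_ge0 => //; rewrite exprn_ge0// ltW.
have e1 : 0 <= 72 * K ^+ 3 * h ^+ 3.
  by apply: mulr_ge0; [apply: mulr_ge0 => //; exact: exprn_ge0|rewrite exprn_ge0// ltW].
have s0 : 0 <= 1 + step_cst * h ^+ 3 by rewrite /step_cst; lra.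
have s0' : (0 <= (1 + step_cst * h ^+ 3)%:E)%E by rewrite lee_fin.
apply: le_trans (lee_wpmul2l s0' lo).
rewrite -EFinM lee_fin; apply: (le_trans up); rewrite [leRHS]mulrCA ler_wpM2l ?powR_ge0//.
have uK : h ^+ 2 * u v ^+ 2 <= 1 / 12.
  apply: (@le_trans _ _ (h ^+ 2 * K ^+ 2)); last by lra.
  rewrite ler_wpM2l ?sqr_ge0// -[leLHS]real_normK ?num_real// lerXn2r ?nnegrE//.
  exact: avg_le.
have D : - (1 / 12) <= r * (r - 1) / 2 * (h ^+ 2 * u v ^+ 2).
  have : `|r * (r - 1) / 2 * (h ^+ 2 * u v ^+ 2)| <= 1 * (1 / 12).
    rewrite normrM ler_pM//; last by rewrite ger0_norm//; exact: (mulr_ge0 (sqr_ge0 _) (sqr_ge0 _)).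
    by rewrite ler_norml; apply/andP; split; nra.
  by rewrite ler_norml => /andP[+ _]; lra.
move: D; move: (r * (r - 1) / 2 * _) => D Dlo.
have -> : 1 + step_cst * h ^+ 3 = 1 + 2 * (72 * K ^+ 3 * h ^+ 3 + gauss_cst K * h ^+ 3).
  by rewrite /step_cst; ring.
move: e1 e2 gh; move: (72 * K ^+ 3 * h ^+ 3) (gauss_cst K * h ^+ 3) => e1 e2 *; nra.
Qed.

Lemma gtilt_tilt t y z v : gtilt x t y (tilt x z v) = tilt x z (gtilt x t y v).
Proof. by apply/funext => i; rewrite /gtilt /tilt mulrAC. Qed.

Lemma gpart_gtilt r s t y b v : gpart x r s (gtilt x t y v) b = gpart x r (t + s) v (y + b).
Proof.
rewrite /gpart; congr (part _ _ `^ r); apply/funext => i.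
by rewrite /gtilt -mulrA -expRD; congr (_ * expR _); field.
Qed.

(** By induction all steps but one are already Gaussian. Sign tilts and Gaussian tilts commute, so
    the remaining step may act on [gtilt x t y v], where [walk_step_le] applies, and the semigroup
    property merges the variances. At least one step is taken so that the variance is positive. *)
Lemma walk_le r h v k : 0 < r <= 2 -> small_step h -> pos v ->
  ((iter k.+1 (op (x, sign_law h)) (fun w => Z w `^ r) v)%:E <=
   ((1 + step_cst * h ^+ 3) ^+ k.+1)%:E *
     gint (k.+1%:R * h ^+ 2) (gpart x r (k.+1%:R * h ^+ 2) v))%E.
Proof.
move=> r02 sh; have [/andP[h0 h1] Kh gh] := sh.
have h20 : 0 < h ^+ 2 by exact: exprn_gt0.
have s0 : 0 <= 1 + step_cst * h ^+ 3.
  apply: addr_ge0 => //; apply: mulr_ge0; last by rewrite exprn_ge0// ltW.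
  apply: mulr_ge0 => //; apply: addr_ge0 => //; apply: mulr_ge0; [exact: ler0n|exact: exprn_ge0].
have gp0 s w y : 0 <= gpart x r s w y by exact: powR_ge0.
have tp z w : `|z| = h -> pos w -> pos (tilt x z w).
  move=> zh; apply: tilt_pos => //; rewrite zh.
  have : (K * h) ^+ 2 <= (1 / 2) ^+ 2 by rewrite exprMn; lra.
  by rewrite ler_pXn2r ?nnegrE// ?mulr_ge0// ltW.
have gc s w : pos w -> continuous (gpart x r s w) by exact: continuous_gpart.
elim: k v => [|k IH] v v0; first by rewrite !mul1r expr1; exact: walk_step_le.
rewrite iterS op_signE; set A := iter k.+1 _ _ in IH *.
set t := k.+1%:R * h ^+ 2 in IH.
have t0 : 0 < t by rewrite mulr_gt0// ltr0n.
have tp1 := tp h v (gtr0_norm h0) v0.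
have tp2 : pos (tilt x (- h) v) by apply: tp => //; rewrite normrN gtr0_norm.
have C0 : 0 <= (1 + step_cst * h ^+ 3) ^+ k.+1 by exact: exprn_ge0.
pose g y := 1 / 2 * gpart x r t (tilt x h v) y + 1 / 2 * gpart x r t (tilt x (- h) v) y.
have c2 w : pos w -> continuous (fun y => 1 / 2 * gpart x r t w y).
  by move=> w0 y; apply: cvgM; [exact: cvg_cst|exact: gc].
have cg : continuous g.
  by move=> y; apply: cvgD; exact: c2.
have g0 y : 0 <= g y by rewrite addr_ge0// mulr_ge0.
have st : ((1 / 2 * A (tilt x h v) + 1 / 2 * A (tilt x (- h) v))%:E <=
    ((1 + step_cst * h ^+ 3) ^+ k.+1)%:E * gint t g)%E.
  rewrite gintD//; [|exact: c2|exact: c2|by move=> y; rewrite mulr_ge0|by move=> y; rewrite mulr_ge0].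
  rewrite !gintZ//; [|exact: gc|exact: gc].
  have q0 : (0 <= ((1 / 2)%R : R)%:E)%E by rewrite lee_fin.
  have gi w : (0 <= ((1 / 2)%R : R)%:E * gint t (gpart x r t w))%E by rewrite mule_ge0// gint_ge0.
  rewrite ge0_muleDr// EFinD; apply: leeD.
    by rewrite EFinM muleCA; apply: lee_wpmul2l => //; exact: IH.
  by rewrite EFinM muleCA; apply: lee_wpmul2l => //; exact: IH.
apply: (le_trans st).
have := @gint_le_step R t (h ^+ 2) (1 + step_cst * h ^+ 3) (gpart x r (t + h ^+ 2) v) g t0 h20 s0 (gc _ _ v0) cg (gp0 _ _) g0.
move=> /(_ _)/Wrap[y|hs].
  have -> : g y = op (x, sign_law h) (fun w => Z w `^ r) (gtilt x t y v).
    by rewrite op_signE /g /gpart !gtilt_tilt.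
  have := walk_step_le r02 sh (gtilt_pos x t y v0).
  suff -> : gpart x r (h ^+ 2) (gtilt x t y v) = fun b => gpart x r (t + h ^+ 2) v (y + b) by [].
  by apply/funext => b; rewrite gpart_gtilt.
have -> : k.+2%:R * h ^+ 2 = t + h ^+ 2 by rewrite /t -[in LHS]natr1; ring.
by rewrite [_ ^+ k.+2]exprSr EFinM -muleA; apply: lee_wpmul2l.
Qed.

End WalkGauss.

(** * Means against the Gaussian density and against [normal_prob] *)

Section NormalProb.
Context {R : realType}.
Implicit Types (f g : R -> R).
Local Notation mu := (@lebesgue_measure R).
Local Notation N01 := (@normal_prob R 0 1).

Lemma gauss1E y : gauss 1 y = normal_pdf 0 1 y :> R.
Proof. by rewrite /gauss sqrtr1. Qed.

Lemma normal_ae_density :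
  ae_eq mu setT (Radon_Nikodym_SigmaFinite.f N01 mu) (fun x => (normal_pdf 0 1 x)%:E).
Proof.
apply: integral_ae_eq => //=.
- apply: Radon_Nikodym_SigmaFinite.f_integrable; exact: normal_prob_dominates.
- by apply/measurable_EFinP; exact: measurable_normal_pdf.
- move=> E E01 mE; rewrite -Radon_Nikodym_SigmaFinite.f_integral//.
  exact: normal_prob_dominates.
Qed.

Lemma ge0_integral_normal (f : R -> \bar R) : measurable_fun setT f -> (forall x, 0 <= f x)%E ->
  (\int[N01]_x f x = \int[mu]_x (f x * (normal_pdf 0 1 x)%:E))%E.
Proof.
move=> mf f0.
rewrite -(Radon_Nikodym_SigmaFinite.change_of_variables (normal_prob_dominates 0 1) f0)//.
apply: ae_eq_integral => //.
- apply: emeasurable_funM => //.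
  apply: (measurable_int mu).
  exact: (Radon_Nikodym_SigmaFinite.f_integrable (normal_prob_dominates 0 1)).
- apply: emeasurable_funM => //.
  by apply/measurable_EFinP; exact: measurable_normal_pdf.
- apply: ae_eqe_mul2l; exact: normal_ae_density.
Qed.

Lemma normal_mean f m : measurable_fun setT f -> gauss_mean 1 f m ->
  N01.-integrable setT (EFin \o f) /\ (\int[N01]_x (f x)%:E = m%:E)%E.
Proof.
move=> mf [fi fe].
have i : N01.-integrable setT (EFin \o f).
  apply/integrableP; split; first exact/measurable_EFinP.
  rewrite ge0_integral_normal//; last first.
    by apply: measurableT_comp => //; exact/measurable_EFinP.
  case/integrableP : fi => _; apply: le_lt_trans.
  rewrite le_eqVlt; apply/orP; left; apply/eqP; apply: eq_integral => x _ /=.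
  by rewrite -EFinM gauss1E normrM (ger0_norm (normal_pdf_ge0 _ _ _)).
split => //.
rewrite -(Radon_Nikodym_change_of_variables (normal_prob_dominates 0 1))// -fe.
apply: ae_eq_integral => //.
- apply: emeasurable_funM; first exact/measurable_EFinP.
  apply: (measurable_int mu); apply: Radon_Nikodym_integrable; exact: normal_prob_dominates.
- by case/integrableP : fi.
- have -> : (fun x => (f x * gauss 1 x)%:E) = (fun x => (f x)%:E * (normal_pdf 0 1 x)%:E)%E.
    by apply/funext => x; rewrite EFinM gauss1E.
  apply: ae_eqe_mul2l.
  apply: ae_eq_trans normal_ae_density.
  exact/ae_eq_sym/(ae_eq_Radon_Nikodym_SigmaFinite (normal_prob_dominates 0 1)).
Qed.

End NormalProb.

Section GaussianChange.
Context {R : realType}.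
Implicit Types (f g : R -> R) (s t k y : R).
Local Notation mu := (@lebesgue_measure R).

(** The Cameron-Martin formula: completing the square turns the exponential weight into a shift of
    the mean. *)
Lemma gint_tilt t k f : 0 < t -> continuous f -> (forall y, 0 <= f y) ->
  gint t (fun y => expR (k * y - t * k ^+ 2 / 2) * f y) = gint t (fun y => f (y + t * k)).
Proof.
move=> t0 cf f0; rewrite /gint.
rewrite [RHS](integral_shift (t * k) (f := fun y => f (y + t * k) * gauss t y)).
- apply: eq_integral => y _; congr (_%:E); rewrite subrK mulrAC [RHS]mulrC; congr (_ * _).
  rewrite !gaussE// mulrCA -expRD; congr (_ * expR _).
  by field; rewrite gt_eqF.
- move=> y; apply: cvgM; last exact: continuous_gauss.
  apply: (@continuous_comp _ _ _ (fun y : R => y + t * k) f); last exact: cf.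
  by apply: cvgD; [exact: cvg_id|exact: cvg_cst].
- by move=> y; rewrite mulr_ge0// gauss_ge0.
Qed.

Lemma gint_scale t f : 0 < t -> continuous f -> (forall y, 0 <= f y) ->
  gint t f = gint 1 (fun y => f (Num.sqrt t * y)).
Proof.
move=> t0 cf f0; have s0 : 0 < Num.sqrt t by rewrite sqrtr_gt0.
have d : ((fun y : R => Num.sqrt t * y)^`())%classic = cst (Num.sqrt t).
  apply/funext => y; rewrite derive1E.
  have := @is_deriveZ R R R id (Num.sqrt t) y 1 1 _.
  by move=> h; have [_] := h; rewrite /GRing.scale/= mulr1.
rewrite /gint (@increasing_ge0_integration_by_substitutionT R (fun y => Num.sqrt t * y) (fun y => f y * gauss t y)).
- apply: eq_integral => y _; congr (_%:E); rewrite d/= !fctE/= -mulrA; congr (_ * _).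
  rewrite !gaussE// !normal_peak_sqrt// mulrAC; congr (_ * expR _).
    rewrite mulr1 -[X in _ * X]invrK -invfM; congr (_^-1).
    by rewrite sqrtrM ?mulfK ?gt_eqF// mulr_ge0// pi_ge0.
  by rewrite exprMn sqr_sqrtr ?ltW//; field; rewrite gt_eqF.
- by move=> x y xy; rewrite ltr_pM2l.
- by rewrite d; move=> x; exact: cvg_cst.
- by rewrite d; exact: is_cvg_cst.
- by rewrite d; exact: is_cvg_cst.
- by move=> x; apply: derivableM => //; exact: derivable_cst.
- by apply: gt0_cvgMrNy => //; exact: cvg_id.
- by apply: gt0_cvgMry => //; exact: cvg_id.
- by move=> y; apply: cvgM; [exact: cf|exact: continuous_gauss].
- by move=> y; rewrite mulr_ge0// gauss_ge0.
Qed.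

Lemma gint_le_mean t u a g : gauss_mean t u a -> continuous g -> (forall y, 0 <= g y) ->
  (forall y, g y <= u y) -> (gint t g <= a%:E)%E.
Proof.
move=> [ui ue] cg g0 gu; rewrite -ue; apply: ge0_le_integral => //.
- by move=> y _; rewrite lee_fin mulr_ge0// gauss_ge0.
- exact: measurable_fgauss.
- by case/integrableP : ui.
- by move=> y _; rewrite lee_fin ler_wpM2r// gauss_ge0.
Qed.

Lemma gauss_mean_dominated t f g a : continuous f -> gauss_mean t g a ->
  (forall y, `|f y| <= g y) -> exists m, gauss_mean t f m.
Proof.
move=> cf [gi _] fg.
have fi : mu.-integrable setT (fun y => (f y * gauss t y)%:E).
  apply: le_integrable gi => //; first exact: measurable_fgauss.
  move=> y _ /=; rewrite lee_fin !normrM ler_wpM2r//.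
  by apply: le_trans (fg y) _; exact: ler_norm.
exists (fine (\int[mu]_y (f y * gauss t y)%:E)%E); split => //.
by rewrite fineK//; apply: integrable_fin_num.
Qed.

Lemma expR_le_taylor1 (x : R) : expR x <= 1 + x + 4 * (x ^+ 2 * expR `|x|).
Proof.
have e1 : 1 <= expR `|x| by rewrite -expR0 ler_expR.
have [x2|x2] := leP x (1 / 2).
  have := expR_le_quad x2; have : x ^+ 2 <= x ^+ 2 * expR `|x| by rewrite ler_peMr// sqr_ge0.
  have := sqr_ge0 x; lra.
have x0 : 0 < x by lra.
rewrite gtr0_norm//.
have x4 : 1 / 4 <= x ^+ 2.
  have -> : 1 / 4 = 1 / 2 * (1 / 2) :> R by lra.
  by rewrite expr2; apply: ler_pM; lra.
have : 1 / 4 * expR x <= x ^+ 2 * expR x by rewrite ler_wpM2r// expR_ge0.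
lra.
Qed.

Lemma sqr_le_expR (B : R) : 0 <= B -> B ^+ 2 <= 2 * expR B.
Proof. by move=> B0; have := expR_ge1Dxn 1 B0; rewrite (_ : 2`! = 2)%N//; lra. Qed.

End GaussianChange.

(** * The log-partition function of a scalar Gaussian channel *)

Section LogPartition.
Context {R : realType} (Om : finType) (i0 : Om) (x w : Om -> R) (K : R).
Hypotheses (K1 : 1 <= K) (xK : forall i, `|x i| <= K).
Hypotheses (w0 : pos w) (w1 : \sum_i w i = 1).
Implicit Types (t y r : R).
Local Notation Z := (part [set: Om]).

Let K0 : 0 <= K. Proof. by apply: le_trans K1. Qed.

Definition logz t y : R := ln (Z (gtilt x t y w)).

Let ZE t y : Z (gtilt x t y w) = \sum_i w i * expR (x i * y - t * x i ^+ 2 / 2).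
Proof. by rewrite /part; apply: eq_bigl => i; rewrite inE. Qed.

Lemma logz_le t y : 0 <= t -> `|logz t y| <= K * `|y| + t * K ^+ 2.
Proof.
move=> t0; set B := K * `|y| + t * K ^+ 2.
have Zp : 0 < Z (gtilt x t y w) by apply: (Z_gt0 i0); exact: gtilt_pos.
have b i : `|x i * y - t * x i ^+ 2 / 2| <= B.
  apply: le_trans (ler_normB _ _) _; apply: lerD; first by rewrite normrM ler_wpM2r.
  rewrite -mulrA normrM (ger0_norm t0) ler_wpM2l// ger0_norm; last first.
    by apply: divr_ge0 => //; exact: sqr_ge0.
  have : x i ^+ 2 <= K ^+ 2 by rewrite -[leLHS]real_normK ?num_real// lerXn2r ?nnegrE.
  have := sqr_ge0 (x i); lra.
have hi : Z (gtilt x t y w) <= expR B.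
  rewrite ZE -[leRHS]mul1r -[in leRHS]w1 mulr_suml; apply: ler_sum => i _.
  rewrite ler_wpM2l ?ler_expR//; first exact: ltW.
  by apply: le_trans (b i); exact: ler_norm.
have lo : expR (- B) <= Z (gtilt x t y w).
  rewrite ZE -[leLHS]mul1r -[in leLHS]w1 mulr_suml; apply: ler_sum => i _.
  rewrite ler_wpM2l ?ler_expR//; first exact: ltW.
  by have := b i; rewrite ler_norml => /andP[].
rewrite /logz ler_norml; apply/andP; split.
  by rewrite -[leLHS]expRK ler_ln// posrE// expR_gt0.
by rewrite -[leRHS]expRK ler_ln// posrE// expR_gt0.
Qed.

Lemma gpart_logz r t y : gpart x r t w y = expR (r * logz t y).
Proof.
by rewrite /gpart /powR /logz gt_eqF// (Z_gt0 i0)//; exact: gtilt_pos.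
Qed.

Lemma continuous_logz t : continuous (logz t).
Proof.
move=> y.
have c : continuous (gpart x 1 t w) by exact: continuous_gpart.
have -> : logz t = @ln R \o gpart x 1 t w.
  by apply/funext => z /=; rewrite gpart_logz mul1r expRK.
apply: continuous_comp; first exact: c.
by apply: continuous_ln; rewrite gpart_logz expR_gt0.
Qed.

(** The log-partition function when label [i] is planted and [y] is standard normal noise; averaged
    over [i] and [y] it gives the expectation in the free energy. *)
Definition field t i y : R := logz t (Num.sqrt t * y + t * x i).

Lemma continuous_field t i : continuous (field t i).
Proof.
move=> y; apply: (@continuous_comp _ _ _ (fun y : R => Num.sqrt t * y + t * x i) (logz t)); last exact: continuous_logz.
apply: cvgD; last exact: cvg_cst.
by apply: cvgM; [exact: cvg_cst|exact: cvg_id].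
Qed.

Lemma field_le t i y : 0 <= t -> `|field t i y| <= K * Num.sqrt t * `|y| + 2 * (t * K ^+ 2).
Proof.
move=> t0; apply: le_trans (logz_le _ t0) _.
have : `|Num.sqrt t * y + t * x i| <= Num.sqrt t * `|y| + t * K.
  apply: le_trans (ler_normD _ _) _; rewrite !normrM (ger0_norm (sqrtr_ge0 t)) (ger0_norm t0) lerD2l.
  by rewrite ler_wpM2l.
move=> /(ler_wpM2l K0); rewrite expr2; lra.
Qed.

(** It dominates [expR (2 * B)], where [B] is the bound of [field_le], and has an explicit Gaussian
    mean because |y| is replaced by the sum over both signs. The 2 in the exponent absorbs the
    polynomial in [B ^+ 2 * expR B]. *)
Let envelope t y : R := expR (4 * (t * K ^+ 2)) *
  (expR (2 * (K * Num.sqrt t) * y) + expR (- (2 * (K * Num.sqrt t)) * y)).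

Let envelope_ge t y : expR (2 * (K * Num.sqrt t * `|y| + 2 * (t * K ^+ 2))) <= envelope t y.
Proof.
rewrite mulrDr addrC expRD (_ : 2 * (2 * _) = 4 * (t * K ^+ 2)); last by ring.
rewrite ler_wpM2l ?expR_ge0// mulrA.
have [y0|y0] := leP 0 y; first by rewrite ger0_norm// lerDl expR_ge0.
by rewrite ltr0_norm// mulrN -mulNr lerDr expR_ge0.
Qed.

Let envelope_mean t : exists a, gauss_mean 1 (envelope t) a.
Proof.
eexists; apply: gauss_meanZ; apply: gauss_meanD; apply: gauss_mean_expR; exact: ltr01.
Qed.

Let Bge0 t y : 0 <= t -> 0 <= K * Num.sqrt t * `|y| + 2 * (t * K ^+ 2).
Proof.
by move=> t0; apply: addr_ge0; rewrite !mulr_ge0// ?sqrtr_ge0// exprn_ge0.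
Qed.

Lemma field_mean t i : 0 <= t -> exists m, gauss_mean 1 (field t i) m.
Proof.
move=> t0; have [a ha] := envelope_mean t.
apply: gauss_mean_dominated ha _; first exact: continuous_field.
move=> y; apply: le_trans (field_le _ _ t0) _; apply: le_trans (envelope_ge t y).
have := expR_ge1Dx (2 * (K * Num.sqrt t * `|y| + 2 * (t * K ^+ 2))).
have := Bge0 y t0; lra.
Qed.

(** One factor of the partition function is expanded over the labels; by [gint_tilt] each likelihood
    ratio becomes a shift of the observation, which plants that label. *)
Lemma gpart_split r t : 0 < t ->
  gint t (gpart x (1 + r) t w) =
  (\sum_i (w i)%:E * gint 1 (fun y => expR (r * field t i y)))%E.
Proof.
move=> t0.
have c1 : continuous (gpart x r t w) by exact: continuous_gpart.
have p0 y : 0 <= gpart x r t w y by exact: powR_ge0.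
have e y : gpart x (1 + r) t w y = \sum_i w i * (expR (x i * y - t * x i ^+ 2 / 2) * gpart x r t w y).
  rewrite !gpart_logz mulrDl expRD mul1r /logz lnK ?posrE; last first.
    by apply: (Z_gt0 i0); exact: gtilt_pos.
  by rewrite ZE mulr_suml; apply: eq_bigr => i _; rewrite mulrA.
rewrite /gint; under eq_integral do rewrite e mulr_suml -sumEFin.
have ce i : continuous (fun y => expR (x i * y - t * x i ^+ 2 / 2) * gpart x r t w y).
  move=> y; apply: cvgM; last exact: c1.
  apply: (@continuous_comp _ _ _ (fun y : R => x i * y - t * x i ^+ 2 / 2) expR); last exact: continuous_expR.
  apply: cvgB; last exact: cvg_cst.
  by apply: cvgM; [exact: cvg_cst|exact: cvg_id].
have pe i y : 0 <= expR (x i * y - t * x i ^+ 2 / 2) * gpart x r t w y by rewrite mulr_ge0// expR_ge0.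
rewrite ge0_integral_sum//.
- apply: eq_bigr => i _.
  transitivity (gint t (fun y => w i * (expR (x i * y - t * x i ^+ 2 / 2) * gpart x r t w y))).
    by [].
  rewrite (gintZ t (ltW (w0 i)) (ce i) (pe i)) (gint_tilt (x i) t0 c1 p0).
  have cs : continuous (fun y => gpart x r t w (y + t * x i)).
    move=> y; apply: (@continuous_comp _ _ _ (fun y : R => y + t * x i)); last exact: c1.
    by apply: cvgD; [exact: cvg_id|exact: cvg_cst].
  rewrite (gint_scale t0 cs (fun y => p0 _)).
  by congr (_ * gint 1 _)%E; apply/funext => y; rewrite gpart_logz.
- move=> i; apply: (measurable_fgauss t (f := fun y => w i * (expR (x i * y - t * x i ^+ 2 / 2) * gpart x r t w y))).
  by move=> y; apply: cvgM; [exact: cvg_cst|exact: ce].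
- move=> i y _; rewrite lee_fin mulr_ge0 ?gauss_ge0// mulr_ge0//; exact: ltW.
Qed.

(** The derivative of E Z^(1+r) at r = 0 is E[Z log Z], the mean of log Z in the planted model. [C]
    is the same for all [r]. *)
Lemma gpart_taylor t (m : Om -> R) : 0 < t -> (forall i, gauss_mean 1 (field t i) (m i)) ->
  exists2 C, 0 <= C & forall r, `|r| <= 1 ->
    (gint t (gpart x (1 + r) t w) <= (1 + r * (\sum_i w i * m i) + C * r ^+ 2)%:E)%E.
Proof.
move=> t0 hm; have [a ha] := envelope_mean t.
exists (8 * `|a|); first by rewrite mulr_ge0.
move=> r r1; rewrite gpart_split//.
have b i : (gint 1 (fun y => expR (r * field t i y))%R <= (1 + r * m i + 8 * r ^+ 2 * a)%:E)%E.
  have hu := gauss_meanD (gauss_meanD (gauss_mean_cst 1 ltr01) (gauss_meanZ r (hm i))) (gauss_meanZ (8 * r ^+ 2) ha).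
  apply: (gint_le_mean hu).
  - move=> y; apply: (@continuous_comp _ _ _ (fun y => r * field t i y) expR); last exact: continuous_expR.
    by apply: cvgM; [exact: cvg_cst|exact: continuous_field].
  - by move=> y; exact: expR_ge0.
  move=> y; apply: le_trans (expR_le_taylor1 _) _; rewrite lerD2l.
  set B := K * Num.sqrt t * `|y| + 2 * (t * K ^+ 2).
  have B0 : 0 <= B by apply: Bge0; exact: ltW.
  have fB : `|field t i y| <= B by apply: field_le; exact: ltW.
  have rB : `|r * field t i y| <= B.
    by rewrite normrM -[leRHS]mul1r ler_pM.
  have f2 : (r * field t i y) ^+ 2 <= r ^+ 2 * B ^+ 2.
    rewrite exprMn ler_wpM2l ?sqr_ge0// -[leLHS]real_normK ?num_real//.
    by rewrite lerXn2r ?nnegrE.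
  have e2 : expR `|r * field t i y| <= expR B by rewrite ler_expR.
  apply: (@le_trans _ _ (4 * (r ^+ 2 * B ^+ 2 * expR B))).
    by rewrite ler_wpM2l// ler_pM ?sqr_ge0 ?expR_ge0.
  have en := envelope_ge t y; rewrite -/B in en.
  have e3 : B ^+ 2 * expR B <= 2 * expR (2 * B).
    have -> : 2 * B = B + B by ring.
    by rewrite (expRD B B); have := ler_wpM2r (expR_ge0 B) (sqr_le_expR B0); lra.
  have r20 := sqr_ge0 r.
  have := ler_wpM2l r20 (le_trans e3 (ler_wpM2l _ en)); rewrite -/(envelope t y).
  by move=> /(_ (ler0n _ _)); lra.
apply: (@le_trans _ _ (\sum_i (w i)%:E * (1 + r * m i + 8 * r ^+ 2 * a)%:E)%E).
  by apply: lee_sum => i _; apply: lee_wpmul2l; [rewrite lee_fin ltW|exact: b].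
under eq_bigr do rewrite -EFinM; rewrite sumEFin lee_fin.
have -> : \sum_i w i * (1 + r * m i + 8 * r ^+ 2 * a) =
    (\sum_i w i) * (1 + 8 * r ^+ 2 * a) + r * (\sum_i w i * m i).
  by rewrite mulr_suml mulr_sumr -big_split/=; apply: eq_bigr => i _; ring.
rewrite w1 mul1r.
have : r ^+ 2 * a <= r ^+ 2 * `|a| by rewrite ler_wpM2l ?sqr_ge0// ler_norm.
lra.
Qed.

End LogPartition.

Lemma gauss_mean_norm {R : realType} (t : R) (f : R -> R) m : gauss_mean t f m ->
  exists a, gauss_mean t (fun y => `|f y|) a.
Proof.
move=> [fi _]; have ni : (@lebesgue_measure R).-integrable setT (fun y => (`|f y| * gauss t y)%:E).
  apply: eq_integrable (integrable_abse fi) => // y _ /=.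
  by rewrite normrM (ger0_norm (gauss_ge0 t y)).
exists (fine (\int[@lebesgue_measure R]_y (`|f y| * gauss t y)%:E)%E); split => //.
by rewrite fineK//; apply: integrable_fin_num.
Qed.

Section FreeEnergy.
Context {R : realType} (p : R).
Hypothesis hp : 0 < p < 1.
Implicit Types (lambda q : R).

Definition sval (i : 'I_2) : R := P0_atom p (i == ord0).

Definition swt (i : 'I_2) : R := if i == ord0 then p else 1 - p.

Definition sbound : R := 1 + Num.sqrt ((1 - p) / p) + Num.sqrt (p / (1 - p)).

Lemma sum_I2 (f : 'I_2 -> R) : \sum_i f i = f ord0 + f ord_max.
Proof. by rewrite big_ord_recr/= big_ord1; congr (f _ + f _); exact/val_inj. Qed.

Lemma sbound_ge1 : 1 <= sbound.
Proof. by rewrite /sbound -addrA lerDl addr_ge0// sqrtr_ge0. Qed.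

Lemma sval_le i : `|sval i| <= sbound.
Proof.
have a0 := sqrtr_ge0 ((1 - p) / p); have b0 := sqrtr_ge0 (p / (1 - p)).
rewrite /sval /P0_atom /sbound; case: ifP => _; last rewrite normrN.
  by rewrite ger0_norm//; lra.
by rewrite ger0_norm//; lra.
Qed.

Lemma swt_pos : pos swt.
Proof. by move=> i; rewrite /swt; have := hp; case: ifP => _ /andP[? ?]; lra. Qed.

Lemma sum_swt : \sum_i swt i = 1.
Proof. by rewrite sum_I2 /swt/= addrC subrK. Qed.

Lemma integral_P0 (g : R -> R) : measurable_fun setT g ->
  (\int[P0 p]_x (g x)%:E = (\sum_i swt i * g (sval i))%:E)%E.
Proof.
move=> mg; have p01 : 0 <= p <= 1 by have := hp; lra.
have ge0 (f : R -> \bar R) : measurable_fun setT f -> (forall y, 0 <= f y)%E ->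
    (\int[P0 p]_x f x = p%:E * f (P0_atom p true) + (1 - p)%:E * f (P0_atom p false))%E.
  by move=> mf f0; rewrite ge0_integral_distribution// integral_bernoulli_prob// => x /=; exact: f0.
have geR (f : R -> R) : measurable_fun setT f -> (forall y, 0 <= f y) ->
    (\int[P0 p]_x (f x)%:E = (\sum_i swt i * f (sval i))%:E)%E.
  move=> mf f0; rewrite ge0//; first by rewrite sum_I2.
  exact/measurable_EFinP.
have ii (f : R -> R) : measurable_fun setT f -> (forall y, 0 <= f y) ->
    (P0 p).-integrable setT (EFin \o f).
  move=> mf f0; apply/integrableP; split; first exact/measurable_EFinP.
  by under eq_integral do rewrite /= ger0_norm//; rewrite geR// ltry.
pose gp x := Num.max (g x) 0; pose gm x := Num.max (- g x) 0.
have gE x : g x = gp x - gm x.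
  rewrite /gp /gm; have [a0|a0] := leP 0 (g x); first by rewrite max_r ?oppr_le0// subr0.
  by rewrite max_l ?oppr_ge0 ?ltW// sub0r opprK.
have mp : measurable_fun setT gp by exact: measurable_maxr.
have mm : measurable_fun setT gm by apply: measurable_maxr => //; exact: measurableT_comp.
have p0 x : 0 <= gp x by rewrite le_max lexx orbT.
have m0 x : 0 <= gm x by rewrite le_max lexx orbT.
under eq_integral do rewrite gE EFinB.
rewrite integralB//; [|exact: ii|exact: ii].
rewrite !geR// -EFinB -sumrB; congr (_%:E).
by apply: eq_bigr => i _; rewrite gE mulrBr.
Qed.

(** Fubini, after checking absolute integrability of the logarithm. The expectation sees [lambda]
    and [q] only through their product, on which the threshold argument relies. *)
Lemma free_energyE lambda q (m : 'I_2 -> R) : 0 <= lambda * q ->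
  (forall i, gauss_mean 1 (field sval swt (lambda * q) i) (m i)) ->
  free_energy p lambda q = - (lambda / 4) * q ^+ 2 + \sum_i swt i * m i.
Proof.
move=> lq0 hm; rewrite /free_energy; congr (_ + _).
set t := lambda * q in lq0 hm *.
pose G (w : R * R) := ln (\sum_i swt i * expR (sval i * (Num.sqrt t * w.1 + t * w.2) - t * sval i ^+ 2 / 2)).
have GE : (fun w : R * R => ln (\int[P0 p]_x expR (Num.sqrt t * w.1 * x + t * x * w.2 - lambda / 2 * q * x ^+ 2))) = G.
  apply/funext => w; rewrite /G; congr ln; rewrite /Rintegral integral_P0/=.
    by apply: eq_bigr => i _; congr (_ * expR _); rewrite /t; field.
  apply: measurableT_comp => //; apply: measurable_funB.
    by apply: measurable_funD; [exact: measurable_funM|apply: measurable_funM => //; exact: measurable_funM].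
  by apply: measurable_funM => //; exact: measurable_funX.
rewrite GE /Rintegral.
have mG : measurable_fun setT G.
  apply: measurableT_comp => //; apply: measurable_sum => i.
  apply: measurable_funM => //; apply: measurableT_comp => //; apply: measurable_funB => //.
  apply: measurable_funM => //; apply: measurable_funD; exact: measurable_funM.
have G1 y i : G (y, sval i) = field sval swt t i y.
  rewrite /G /field /logz /part; congr ln.
  by apply: eq_big => j; rewrite ?inE.
have mG2 y : measurable_fun setT (fun z => G (y, z)).
  apply: measurableT_comp => //; exact: measurable_pair1.
have mf i : measurable_fun setT (field sval swt t i).
  by have -> : field sval swt t i = (fun y => G (y, sval i)); [apply/funext => y; rewrite G1|apply: measurableT_comp => //; exact: measurable_pair2].
have in2 y : (\int[P0 p]_z (G (y, z))%:E = (\sum_i swt i * field sval swt t i y)%:E)%E.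
  by rewrite integral_P0//; under eq_bigr do rewrite G1.
have hs : gauss_mean 1 (fun y => \sum_i swt i * field sval swt t i y) (\sum_i swt i * m i).
  by apply: gauss_mean_sum => // i; exact: gauss_meanZ.
have [_ Ns] := normal_mean (measurable_sum _ (fun i => measurable_funM (measurable_cst _) (mf i))) hs.
have Gi : (normal_prob 0 1 \x P0 p)%E.-integrable setT (EFin \o G).
  apply/integrable12ltyP; first exact/measurable_EFinP.
  have e y : (\int[P0 p]_z `|(EFin \o G) (y, z)| = (\sum_i swt i * `|field sval swt t i y|)%:E)%E.
    transitivity (\int[P0 p]_z (`|G (y, z)|)%:E)%E; first by [].
    rewrite integral_P0; last exact: measurableT_comp.
    by congr (_%:E); apply: eq_bigr => i _; rewrite G1.
  under eq_integral do rewrite e.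
  have /choice[m' hm'] i : exists a, gauss_mean 1 (fun y => `|field sval swt t i y|) a.
    exact: gauss_mean_norm (hm i).
  have hs' : gauss_mean 1 (fun y => \sum_i swt i * `|field sval swt t i y|) (\sum_i swt i * m' i).
    by apply: gauss_mean_sum => // i; exact: gauss_meanZ.
  have mn i : measurable_fun setT (fun y => swt i * `|field sval swt t i y|).
    by apply: measurable_funM => //; exact: measurableT_comp.
  by have [_ ->] := normal_mean (measurable_sum _ mn) hs'; rewrite ltry.
rewrite -[RHS]/(fine (\sum_i swt i * m i)%:E) -Ns; congr fine.
rewrite -(integral12_prod_meas1 Gi); apply: eq_integral => y _; exact: in2.
Qed.

End FreeEnergy.

Section WalkLimit.
Context {R : realType} (p : R).
Hypothesis hp : 0 < p < 1.
Implicit Types (lambda q r : R).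
Local Notation Z := (part [set: 'I_2]).

(** The scalar-channel part of the free energy, a function of [lambda * q]. *)
Definition psi lambda q : R := free_energy p lambda q + lambda / 4 * q ^+ 2.

Lemma psi_mean lambda q : 0 <= lambda * q ->
  exists2 m : 'I_2 -> R, (forall i, gauss_mean 1 (field (sval p) (swt p) (lambda * q) i) (m i)) &
    psi lambda q = \sum_i swt p i * m i.
Proof.
move=> lq0.
have /choice[m hm] i : exists a, gauss_mean 1 (field (sval p) (swt p) (lambda * q) i) a.
  exact: (field_mean ord0 (sbound_ge1 p) (sval_le p) (swt_pos hp) (sum_swt p)).
exists m => //; rewrite /psi (free_energyE hp lq0 hm); ring.
Qed.

Lemma psi0 lambda : psi lambda 0 = 0.
Proof.
have [|m hm ->] := @psi_mean lambda 0; first by rewrite mulr0.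
apply: big1 => i _; suff -> : m i = 0 by rewrite mulr0.
have f0 y : field (sval p) (swt p) (lambda * 0) i y = 0.
  rewrite /field /logz /part /gtilt mulr0 sqrtr0 !mul0r addr0.
  under eq_bigr do rewrite mulr0 !mul0r subr0 expR0 mulr1.
  by rewrite -[RHS]ln1 -(sum_swt p); congr ln; apply: eq_bigl => j; rewrite inE.
have [_ e1] := hm i; have [_ e2] := gauss_mean_cst 0 (@ltr01 R).
apply: EFin_inj; rewrite -e1 -e2; apply: eq_integral => y _.
by rewrite f0.
Qed.

Definition walk M gam r : R :=
  iter M (op (sval p, sign_law (Num.sqrt (gam / M%:R)))) (fun w => Z w `^ (1 + r)) (swt p).

Lemma walk0 M r : walk M 0 r = 1.
Proof.
rewrite /walk mul0r sqrtr0.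
have -> : op (sval p, sign_law 0) = @id (('I_2 -> R) -> R).
  apply/funext => F; apply/funext => v; rewrite op_signE oppr0.
  have -> : tilt (sval p) 0 v = v by apply/funext => i; rewrite /tilt mul0r addr0 mulr1.
  by rewrite -mulrDl -[RHS]mul1r; congr (_ * _); field.
rewrite iter_fix// -[LHS]/(Z (swt p) `^ (1 + r)).
have -> : Z (swt p) = 1.
  by rewrite -(sum_swt p); apply: eq_bigl => j; rewrite inE.
by rewrite powR1.
Qed.

(** The order of the quantifiers matters: [C] precedes [r], so that [r] can later be chosen small
    against it, while [W] may depend on [r] and [eta]. *)
Lemma walk_limit lambda q : 0 <= lambda * q ->
  exists2 C : R, 0 <= C & forall r, - (1 / 2) <= r -> r <= 1 -> forall eta, 0 < eta ->
    exists W : R, forall M : nat, (0 < M)%N -> W <= M%:R ->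
      walk M (lambda * q) r <= expR (r * psi lambda q + C * r ^+ 2 + eta).
Proof.
move=> lq0; have [m hm ->] := psi_mean lq0.
set gam := lambda * q in lq0 hm *; have K1 := sbound_ge1 p.
set K := sbound p in K1.
(* At [gam = 0] the Gaussian density degenerates, but the walk stands still and [walk0] gives its
   value. *)
have [g0|g0] := eqVneq gam 0.
  exists 0 => // r _ _ eta eta0; exists 0 => M M0 _; rewrite g0 walk0.
  have -> : \sum_i swt p i * m i = 0.
    have z : 0 <= lambda * 0 by rewrite mulr0.
    have [m' hm'] := psi_mean z; rewrite psi0 => e; rewrite [RHS]e.
    apply: eq_bigr => i _; congr (_ * _).
    have [_ e1] := hm i; have [_ e2] := hm' i.
    by apply: EFin_inj; rewrite -e1 -e2 g0 mulr0.
  by rewrite mulr0 mul0r !add0r -[leLHS]expR0 ler_expR ltW.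
have gp : 0 < gam by rewrite lt_neqAle eq_sym g0.
have [C C0 hC] := gpart_taylor ord0 K1 (sval_le p) (swt_pos hp) (sum_swt p) gp hm.
exists C => // r r1 r2 eta eta0.
have gc0 : 0 <= gauss_cst K.
  by rewrite gauss_cst.unlock; apply: mulr_ge0; [exact: ler0n|apply: exprn_ge0; lra].
have sc0 : 0 <= step_cst K.
  rewrite /step_cst; apply: mulr_ge0 => //; apply: addr_ge0 => //.
  by apply: mulr_ge0; [exact: ler0n|apply: exprn_ge0; lra].
(* [W = gam * D ^+ 2] forces [D * h <= 1], and each summand of [D] yields one condition on [h]; the
   last one makes the accumulated error at most [eta]. *)
pose D := 1 + 12 * K ^+ 2 + 4 * gauss_cst K + step_cst K * gam / eta.
have a1 : 0 <= 12 * K ^+ 2 by apply: mulr_ge0 => //; exact: sqr_ge0.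
have a2 : 0 <= step_cst K * gam / eta by apply: divr_ge0; [apply: mulr_ge0 => //; exact: ltW|exact: ltW].
have D0 : 0 < D by rewrite /D; lra.
exists (gam * D ^+ 2) => M M0 DM.
have MN : 0 < M%:R :> R by rewrite ltr0n.
set h := Num.sqrt (gam / M%:R).
have h0 : 0 < h by rewrite sqrtr_gt0 divr_gt0.
have h2 : h ^+ 2 = gam / M%:R by rewrite sqr_sqrtr// divr_ge0// ltW.
have hD : D * h <= 1.
  have : (D * h) ^+ 2 <= 1 ^+ 2.
    by rewrite exprMn h2 expr1n mulrA ler_pdivrMr// mul1r mulrC.
  by rewrite ler_pXn2r ?nnegrE// mulr_ge0// ltW.
have b1 : 12 * K ^+ 2 * h <= 1.
  by apply: le_trans hD; rewrite ler_wpM2r ?(ltW h0)// /D; lra.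
have b2 : 4 * gauss_cst K * h <= 1.
  by apply: le_trans hD; rewrite ler_wpM2r ?(ltW h0)// /D; lra.
have b3 : step_cst K * gam / eta * h <= 1.
  by apply: le_trans hD; rewrite ler_wpM2r ?(ltW h0)// /D; lra.
have b4 : h <= 1.
  by apply: le_trans hD; rewrite -[leLHS]mul1r ler_wpM2r ?(ltW h0)// /D; lra.
have h21 : h ^+ 2 <= h by rewrite expr2 ler_piMl// ltW.
have h31 : h ^+ 3 <= h.
  by apply: le_trans h21; rewrite exprS ler_piMl// exprn_ge0// ltW.
have sh : small_step K h.
  split; first by rewrite h0.
    have := ler_wpM2l a1 h21; lra.
  have := ler_wpM2l gc0 h31; lra.
have r02 : 0 < 1 + r <= 2 by lra.
case: M M0 DM MN @h h0 h2 hD b1 b2 b3 b4 h21 h31 sh => [//|k] _ _ MN h h0 h2 hD b1 b2 b3 b4 h21 h31 sh.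
have := walk_le ord0 K1 (sval_le p) k r02 sh (swt_pos hp).
have Mh : k.+1%:R * h ^+ 2 = gam by rewrite h2 mulrC divfK// gt_eqF.
rewrite Mh => hw.
have rn : `|r| <= 1 by rewrite ler_norml; lra.
have Cn : (0 <= ((1 + step_cst K * h ^+ 3) ^+ k.+1)%:E)%E.
  by rewrite lee_fin exprn_ge0// addr_ge0// mulr_ge0// exprn_ge0// ltW.
have := le_trans hw (lee_wpmul2l Cn (hC r rn)).
rewrite -EFinM lee_fin => /le_trans; apply.
have e3 : (1 + step_cst K * h ^+ 3) ^+ k.+1 <= expR eta.
  apply: (@le_trans _ _ (expR (step_cst K * h ^+ 3) ^+ k.+1)).
    rewrite lerXn2r ?nnegrE ?expR_ge0 ?expR_ge1Dx//.
    by rewrite addr_ge0// mulr_ge0// exprn_ge0// ltW.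
  rewrite -expRM_natl ler_expR.
  have -> : k.+1%:R * (step_cst K * h ^+ 3) = step_cst K * (k.+1%:R * h ^+ 2) * h by ring.
  rewrite Mh; have := ler_wpM2r (ltW eta0) b3; rewrite mul1r.
  have -> : step_cst K * gam / eta * h * eta = step_cst K * gam * h by field; rewrite gt_eqF.
  by [].
rewrite expRD mulrC; apply: ler_pM => //.
- have := hC r rn; have : (0 <= gint gam (gpart (sval p) (1 + r) gam (swt p)))%E.
    by apply: gint_ge0 => y; exact: powR_ge0.
  by move=> /le_trans /[apply]; rewrite lee_fin.
- by rewrite -addrA expR_ge1Dx.
Qed.

End WalkLimit.

(** * Upper bounds for the block model *)

Lemma part_setT {R : realType} (T : finType) (v : T -> R) : part [set: T] v = \sum_i v i.
Proof. by apply: eq_bigl => i; rewrite inE. Qed.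

Section GraphSum.
Context {R : realType} (Om I : finType) (a : I -> Om -> R) (m e k : R).
Implicit Types (v : Om -> R) (G : {ffun I -> bool}) (l : seq I).

Definition two_point_law : seq (R * R) := [:: (m, e); (1 - m, - k)].

Definition jump (b : bool) : R := if b then e else - k.

Definition weight (b : bool) : R := if b then m else 1 - m.

Let upd G i b : {ffun I -> bool} := [ffun j => if j == i then b else G j].

Let inl l G := [forall i, (i \notin l) ==> ~~ G i].

(** Expanding the two-point laws gives a sum over graphs supported on [l]. For the head edge [i]
    they split into those containing [i], reindexed by switching [i] off, and the others. *)
Lemma ops_graph_seq l F v : uniq l ->
  ops [seq (a i, two_point_law) | i <- l] F v =
  \sum_(G | inl l G) (\prod_(i <- l) weight (G i)) *
    F (fun w => v w * \prod_(i <- l) (1 + jump (G i) * a i w)).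
Proof.
elim: l v => [|i l IH] v.
  move=> _ /=; rewrite (big_pred1 [ffun=> false]).
    rewrite big_nil mul1r; congr F; apply/funext => w.
    by rewrite big_nil mulr1.
  move=> G; apply/forallP/eqP => [h|-> j]; last by rewrite ffunE implybT.
  by apply/ffunP => j; rewrite ffunE; apply/negbTE; exact: (implyP (h j)).
move=> /= /andP[il ul].
rewrite -/(ops _ _) /op /Ex /two_point_law !big_cons big_nil addr0 /=.
rewrite !IH//.
rewrite [RHS](bigID (fun G => G i))/=; congr (_ + _).
  rewrite mulr_sumr.
  rewrite [RHS](reindex_onto (fun G => upd G i true) (fun G => upd G i false))/=; last first.
    move=> G /andP[_ Gi]; apply/ffunP => j; rewrite !ffunE.
    by case: eqVneq => // ->.
  apply: eq_big => [G|G hG].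
    rewrite !ffunE eqxx andbT; apply/idP/andP => [/forallP h|[/forallP h /eqP hi]].
      split.
        apply/forallP => j; rewrite inE negb_or ffunE; apply/implyP => /andP[/negbTE-> jl].
        exact: (implyP (h j)).
      apply/eqP/ffunP => j; rewrite !ffunE; case: eqVneq => // ->.
      by apply/esym/negbTE; exact: (implyP (h i)).
    apply/forallP => j; apply/implyP => jl; have [->|ji] := eqVneq j i.
      by rewrite -hi !ffunE eqxx.
    by have := h j; rewrite inE negb_or ji jl ffunE (negbTE ji).
  have ne j : j \in l -> (j == i) = false.
    by move=> jl; apply/negbTE; apply: contraNneq il => <-.
  rewrite !big_cons ffunE eqxx /= mulrA; congr (_ * _ * _).
    by apply: eq_big_seq => j jl; rewrite ffunE ne.
  congr F; apply/funext => w; rewrite big_cons ffunE eqxx /tilt mulrA; congr (_ * _).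
  by apply: eq_big_seq => j jl; rewrite ffunE ne.
rewrite mulr_sumr; apply: eq_big => [G|G hG].
  apply/forallP/andP => [h|[/forallP h Gi] j].
    split; last exact: (implyP (h i)).
    by apply/forallP => j; rewrite inE negb_or; apply/implyP => /andP[_ jl]; exact: (implyP (h j)).
  apply/implyP => jl; have [->//|ji] := eqVneq j i.
  by have := h j; rewrite inE negb_or ji jl.
have /negbTE Gi : ~~ G i by exact: (implyP (forallP hG i)).
rewrite !big_cons Gi /= mulrA; congr (_ * F _).
by apply/funext => w; rewrite big_cons Gi /tilt mulrA.
Qed.

Lemma ops_graph F v :
  ops [seq (a i, two_point_law) | i <- index_enum I] F v =
  \sum_(G : {ffun I -> bool}) (\prod_i weight (G i)) *
    F (fun w => v w * \prod_i (1 + jump (G i) * a i w)).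
Proof.
rewrite ops_graph_seq ?index_enum_uniq//; apply: eq_bigl => G.
by apply/forallP => i; rewrite mem_index_enum.
Qed.

End GraphSum.

Section ProductForm.
Context {R : realType} (J : finType) (n : nat) (s : J -> R) (K : R) (L : seq (R * R)).
Hypotheses (sK : forall j, `|s j| <= K) (LK : mean_zero_law K L).
Local Notation lab := {ffun 'I_n -> J}.
Implicit Types (w : 'I_n -> J -> R) (F : (lab -> R) -> R) (f : 'I_n -> (J -> R) -> R).

Definition prodv w : lab -> R := fun x => \prod_i w i (x i).

(** A node channel changes a single coordinate, so this factorization survives it; after all rounds
    the average over labelings is the n-th power of a one-vertex walk. *)
Definition prodform F f := forall w, (forall i, pos (w i)) -> F (prodv w) = \prod_i f i (w i).

Definition anode (i : 'I_n) : lab -> R := fun x => s (x i).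

Lemma op_prodform F f i : prodform F f ->
  prodform (op (anode i, L) F) (fun j => if j == i then op (s, L) (f j) else f j).
Proof.
move=> Ff w w0; pose w' x j := if j == i then tilt s x (w j) else w j.
have e x : tilt (anode i) x (prodv w) = prodv (w' x).
  apply/funext => y; rewrite /tilt /prodv (bigD1 i)//= [RHS](bigD1 i)//= /w' eqxx.
  rewrite mulrAC; congr (_ * _); apply: eq_bigr => j ji.
  by rewrite (negbTE ji).
rewrite (bigD1 i)//= eqxx /op /Ex mulr_suml; apply: eq_big_seq => k kL.
rewrite e Ff; last first.
  move=> j; rewrite /w'; case: ifP => // _; apply: tilt_pos (w0 j) => //.
  by case: LK => _ _ _; apply.
rewrite (bigD1 i)//= /w' eqxx mulrA; congr (_ * _); apply: eq_bigr => j ji.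
by rewrite (negbTE ji).
Qed.

Lemma ops_prodform F f l : uniq l -> prodform F f ->
  prodform (ops [seq (anode i, L) | i <- l] F) (fun j => if j \in l then op (s, L) (f j) else f j).
Proof.
move=> ul Ff; elim: l ul => [_ |i l IH /= /andP[il ul]]; first exact: Ff.
have := op_prodform i (IH ul) => h w w0; rewrite -/(ops _ _) h//; apply: eq_bigr => j _.
by rewrite inE; case: eqVneq => [->|_] //=; rewrite (negbTE il).
Qed.

Lemma iter_prodform F f M : prodform F f ->
  prodform (iter M (ops [seq (anode i, L) | i <- index_enum 'I_n]) F)
           (fun j => iter M (op (s, L)) (f j)).
Proof.
move=> Ff; elim: M => [//|M IH] w w0 /=.
rewrite (ops_prodform (index_enum_uniq _) IH)//.
by apply: eq_bigr => j _; rewrite mem_index_enum.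
Qed.

Lemma part_prodform r : prodform (fun v => part [set: lab] v `^ r) (fun _ u => part [set: J] u `^ r).
Proof.
move=> w w0; have -> : part [set: lab] (prodv w) = \prod_i part [set: J] (w i).
  rewrite part_setT /prodv; under [RHS]eq_bigr do rewrite part_setT.
  by rewrite bigA_distr_bigA.
have h (l : seq 'I_n) : 0 <= \prod_(i <- l) part [set: J] (w i) /\
   (\prod_(i <- l) part [set: J] (w i)) `^ r = \prod_(i <- l) part [set: J] (w i) `^ r.
  elim: l => [|i l [IH1 IH2]]; first by rewrite !big_nil powR1.
  have p0 := part_ge0 [set: J] (w0 i).
  by rewrite !big_cons mulr_ge0// powRM// IH2.
by have [_] := h (index_enum _).
Qed.

End ProductForm.

Section AvgLinear.
Context {R : realType} (Om : finType) (S : {set Om}).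
Implicit Types (v a b : Om -> R).

Lemma avgD v a b : avg S (fun w => a w + b w) v = avg S a v + avg S b v.
Proof.
by rewrite /avg -mulrDl -big_split/=; congr (_ / _); apply: eq_bigr => w _; rewrite mulrDr.
Qed.

Lemma avgZ v c a : avg S (fun w => c * a w) v = c * avg S a v.
Proof.
by rewrite /avg mulrA mulr_sumr; congr (_ / _); apply: eq_bigr => w _; rewrite mulrCA.
Qed.

Lemma avg_sum v (I : finType) (a : I -> Om -> R) :
  avg S (fun w => \sum_i a i w) v = \sum_i avg S (a i) v.
Proof.
rewrite /avg -mulr_suml exchange_big/=; congr (_ / _).
by apply: eq_bigr => w _; rewrite mulr_sumr.
Qed.

Lemma avg_cst v c : part S v != 0 -> avg S (fun=> c) v = c.
Proof. by move=> p0; rewrite /avg -mulr_suml -/(part S v) mulrAC mulfV// mul1r. Qed.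

Lemma avg_mono v a b : pos v -> (forall w, w \in S -> a w <= b w) -> avg S a v <= avg S b v.
Proof.
move=> v0 ab; rewrite /avg ler_wpM2r ?invr_ge0 ?part_ge0//.
by apply: ler_sum => w wS; rewrite ler_wpM2l ?ab//; exact: ltW.
Qed.

Lemma eq_avg v a b : a =1 b -> avg S a v = avg S b v.
Proof. by move=> ab; congr avg; apply/funext. Qed.
End AvgLinear.

Section Pairs.
Context {R : realType} (n : nat).

Lemma sum_pairs (f : 'I_n -> 'I_n -> R) : (forall i j, f i j = f j i) ->
  2 * (\sum_(e : vertex_pair n) f (val e).1 (val e).2) =
  \sum_i \sum_j f i j - \sum_i f i i.
Proof.
move=> fC; rewrite -(big_sub (fun u : 'I_n * 'I_n => (u.1 < u.2)%N) (fun u => f u.1 u.2)).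
rewrite pair_bigA/=.
rewrite [X in _ = X - _](bigID (fun u : 'I_n * 'I_n => (u.1 < u.2)%N))/=.
rewrite [X in _ = _ + X - _](bigID (fun u : 'I_n * 'I_n => u.1 == u.2))/=.
have -> : \sum_(u : 'I_n * 'I_n | ~~ (u.1 < u.2)%N && (u.1 == u.2)) f u.1 u.2 = \sum_i f i i.
  rewrite (reindex_onto (fun i : 'I_n => (i, i)) fst)/=; last first.
    by move=> [i j] /= /andP[_ /eqP->].
  by apply: eq_bigl => i; rewrite ltnn !eqxx.
have -> : \sum_(u : 'I_n * 'I_n | ~~ (u.1 < u.2)%N && (u.1 != u.2)) f u.1 u.2 =
    \sum_(u : 'I_n * 'I_n | (u.1 < u.2)%N) f u.1 u.2.
  rewrite (reindex_onto (fun u : 'I_n * 'I_n => (u.2, u.1)) (fun u => (u.2, u.1)))/=; last first.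
    by move=> [].
  apply: eq_big => [[i j]|[i j] _] /=; last exact: fC.
  by rewrite eqxx andbT -leqNgt -(inj_eq val_inj)/= ltn_neqAle andbC eq_sym.
by ring.
Qed.
End Pairs.

(** * Drift of the edge channels against drift of the node channels *)

Section Drift.
Context {R : realType} (n : nat) (s : 'I_2 -> R) (K : R).
Hypotheses (K1 : 1 <= K) (sK : forall j, `|s j| <= K) (n0 : (0 < n)%N).
Local Notation lab := (labeling n).
Implicit Types (v : lab -> R) (S : {set lab}) (X x : lab) (q r lam del : R).
Local Notation N := (n%:R : R).

Definition aedge (e : vertex_pair n) : lab -> R := fun x => s (x (val e).1) * s (x (val e).2).

Let K0 : 0 <= K. Proof. by apply: le_trans K1. Qed.
Let N0 : 0 < N. Proof. by rewrite ltr0n. Qed.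

Lemma aedge_le e x : `|aedge e x| <= K ^+ 2.
Proof. by rewrite normrM expr2 ler_pM. Qed.

Definition ovl X x : R := \sum_i s (X i) * s (x i).

Let mean S v i := avg S (anode s i) v.
Let cov S v i j := avg S (fun x => s (x i) * s (x j)) v.

Let diag_le S v : pos v -> \sum_i cov S v i i ^+ 2 <= N * K ^+ 4.
Proof.
move=> v0; apply: (@le_trans _ _ (\sum_(i < n) K ^+ 4)); last first.
  by rewrite sumr_const card_ord mulr_natl lexx.
apply: ler_sum => i _; rewrite -[leLHS]real_normK ?num_real// (exprM _ 2 2).
rewrite lerXn2r ?nnegrE ?exprn_ge0//; apply: avg_le => //; first exact: exprn_ge0.
by move=> x; rewrite normrM expr2 ler_pM.
Qed.

(* Average over two replicas of [(n R - n q)^2 >= 0]. *)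
Let replica S v q : pos v -> part S v != 0 ->
  - (N ^+ 2 * q ^+ 2) <= \sum_i \sum_j cov S v i j ^+ 2 - 2 * N * q * (\sum_i mean S v i ^+ 2).
Proof.
move=> v0 p0.
pose g (x : lab) := avg S (fun y : lab => (\sum_i s (x i) * s (y i) - N * q) ^+ 2) v.
have gE x : g x = \sum_i \sum_j (cov S v i j * (s (x i) * s (x j))) +
    (- (2 * N * q) * (\sum_i mean S v i * s (x i)) + N ^+ 2 * q ^+ 2).
  rewrite /g; rewrite (eq_avg _ _ (b := fun y : lab => \sum_i (\sum_j ((s (x i) * s (x j)) * (s (y i) * s (y j)))) +
     (- (2 * N * q) * (\sum_i s (x i) * s (y i)) + N ^+ 2 * q ^+ 2))).
    rewrite !avgD (avg_cst (N ^+ 2 * q ^+ 2) p0) avgZ !avg_sum; congr (_ + (_ * _ + _)).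
      apply: eq_bigr => i _; rewrite avg_sum; apply: eq_bigr => j _.
      by rewrite avgZ mulrC.
    by apply: eq_bigr => i _; rewrite avgZ mulrC.
  move=> y; have -> : \sum_i (\sum_j ((s (x i) * s (x j)) * (s (y i) * s (y j)))) =
     (\sum_i s (x i) * s (y i)) ^+ 2.
    rewrite expr2 mulr_suml; apply: eq_bigr => i _; rewrite mulr_sumr.
    by apply: eq_bigr => j _; ring.
  by ring.
have : 0 <= avg S g v.
  have <- : avg S (fun=> 0) v = 0 by rewrite avg_cst.
  apply: avg_mono => // x _.
  have <- : avg S (fun=> 0) v = 0 by rewrite avg_cst.
  by apply: avg_mono => // y _; exact: sqr_ge0.
rewrite (eq_avg _ _ gE) !avgD (avg_cst (N ^+ 2 * q ^+ 2) p0) avgZ !avg_sum.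
have -> : \sum_i avg S (fun x => \sum_j cov S v i j * (s (x i) * s (x j))) v =
   \sum_i \sum_j cov S v i j ^+ 2.
  apply: eq_bigr => i _; rewrite avg_sum; apply: eq_bigr => j _.
  by rewrite avgZ expr2.
have -> : \sum_i avg S (fun x => mean S v i * s (x i)) v = \sum_i mean S v i ^+ 2.
  by apply: eq_bigr => i _; rewrite avgZ expr2.
lra.
Qed.

Let edges_sum o S r v :
  2 * (\sum_(e : vertex_pair n) ell o S r (aedge e) v) =
  \sum_i \sum_j r * (spin o (fun x => s (x i) * s (x j)) * cov S v i j + (r - 1) / 2 * cov S v i j ^+ 2) -
  \sum_i r * (spin o (fun x => s (x i) * s (x i)) * cov S v i i + (r - 1) / 2 * cov S v i i ^+ 2).
Proof.
rewrite -(@sum_pairs _ n (fun i j => r * (spin o (fun x => s (x i) * s (x j)) * cov S v i j + (r - 1) / 2 * cov S v i j ^+ 2)))//.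
move=> i j; have -> : cov S v i j = cov S v j i by apply: eq_avg => x; rewrite mulrC.
suff -> : spin o (fun x => s (x i) * s (x j)) = spin o (fun x => s (x j) * s (x i)) by [].
by rewrite /spin; case: o => // X; rewrite mulrC.
Qed.

(** With R the overlap per vertex, the planted part is an average of R^2 over [S], where R^2 - 2 q R
    <= del^2 - q^2 by the choice of [S]. The two-replica part has coefficient (r - 1)/2 <= 0, so
    [replica] bounds it by (1 - r)/2 * q^2. Together they give del^2 - q^2 / 2, and the diagonal
    terms go into [K ^+ 4]. *)
Lemma drift_planted X S r v lam q del : pos v -> part S v != 0 -> 0 < r <= 1 ->
  0 <= lam -> 0 <= q -> 0 <= del ->
  (forall x, x \in S -> `|ovl X x - N * q| <= N * del) ->
  lam / N * (\sum_(e : vertex_pair n) ell (Some X) S r (aedge e) v) <=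
  lam * q * (\sum_(i < n) ell (Some X) S r (anode s i) v) +
  (r * (N * (lam * (del ^+ 2 / 2 - q ^+ 2 / 4))) + lam * K ^+ 4).
Proof.
move=> v0 p0 /andP[r0 r1] l0 q0 d0 hS.
have rep := replica q v0 p0; have dg := diag_le S v0.
have es := edges_sum (Some X) S r v.
set E := \sum_(e : vertex_pair n) _ in es *.
set T2 := \sum_i \sum_j cov S v i j ^+ 2 in rep.
set U2 := \sum_i mean S v i ^+ 2 in rep.
set D2 := \sum_i cov S v i i ^+ 2 in dg.
pose T1 := \sum_i \sum_j (s (X i) * s (X j)) * cov S v i j.
pose D1 := \sum_i (s (X i) * s (X i)) * cov S v i i.
pose U1 := \sum_i s (X i) * mean S v i.
have eE : 2 * E = r * (T1 + (r - 1) / 2 * T2) - r * (D1 + (r - 1) / 2 * D2).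
  rewrite es /T1 /T2 /D1 /D2 !mulrDr !mulr_sumr; congr (_ - _).
    rewrite -big_split; apply: eq_bigr => i _; rewrite !mulr_sumr -big_split.
    by apply: eq_bigr => j _ /=; ring.
  by rewrite -big_split; apply: eq_bigr => i _ /=; ring.
have -> : \sum_(i < n) ell (Some X) S r (anode s i) v = r * (U1 + (r - 1) / 2 * U2).
  rewrite /U1 /U2 mulrDr !mulr_sumr -big_split; apply: eq_bigr => i _ /=.
  by rewrite /ell /mean /= /anode; ring.
have D10 : 0 <= D1.
  apply: sumr_ge0 => i _; rewrite mulr_ge0 -?expr2 ?sqr_ge0//.
  have <- : avg S (fun=> 0) v = 0 by rewrite avg_cst.
  by apply: avg_mono => // y _; rewrite -expr2 sqr_ge0.
have TU : T1 - 2 * N * q * U1 <= N ^+ 2 * (del ^+ 2 - q ^+ 2).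
  have -> : T1 - 2 * N * q * U1 = avg S (fun x => ovl X x ^+ 2 + - (2 * N * q) * ovl X x) v.
    rewrite avgD avgZ /ovl avg_sum mulNr; congr (_ - _ * _); last first.
      by apply: eq_bigr => i _; rewrite avgZ.
    rewrite (eq_avg _ _ (b := fun x : lab => \sum_i \sum_j (s (X i) * s (X j)) * (s (x i) * s (x j)))).
      rewrite avg_sum; apply: eq_bigr => i _; rewrite avg_sum; apply: eq_bigr => j _.
      by rewrite avgZ.
    move=> x; rewrite expr2 mulr_suml; apply: eq_bigr => i _; rewrite mulr_sumr.
    by apply: eq_bigr => j _; ring.
  rewrite -[leRHS](avg_cst _ p0); apply: avg_mono => // x xS.
  have := hS x xS => h; have : (ovl X x - N * q) ^+ 2 <= (N * del) ^+ 2.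
    rewrite -[leLHS]real_normK ?num_real// lerXn2r ?nnegrE//.
    by rewrite mulr_ge0// ltW.
  by rewrite !exprMn; lra.
have D20 : 0 <= D2 by apply: sumr_ge0 => i _; exact: sqr_ge0.
rewrite -subr_ge0.
have NN : N != 0 by rewrite gt_eqF.
have key : 2 * E <= 2 * N * q * (r * (U1 + (r - 1) / 2 * U2)) +
    r * (N ^+ 2 * (del ^+ 2 - q ^+ 2 / 2)) + N * K ^+ 4.
  have h1 : r * (T1 - 2 * N * q * U1) <= r * (N ^+ 2 * (del ^+ 2 - q ^+ 2)).
    by rewrite ler_wpM2l// ltW.
  have h2 : r * ((r - 1) / 2) * (T2 - 2 * N * q * U2) <= r * ((1 - r) / 2) * (N ^+ 2 * q ^+ 2).
    have : r * ((1 - r) / 2) * - (T2 - 2 * N * q * U2) <= r * ((1 - r) / 2) * (N ^+ 2 * q ^+ 2).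
      by apply: ler_wpM2l; [nra|lra].
    lra.
  have h3 : r * ((1 - r) / 2) * D2 <= N * K ^+ 4.
    have NK : 0 <= N * K ^+ 4 by rewrite mulr_ge0 ?exprn_ge0// ltW.
    apply: le_trans dg; rewrite ler_piMl//; nra.
  have h4 : 0 <= r * D1 by rewrite mulr_ge0// ltW.
  have h5 : r * ((1 - r) / 2) * (N ^+ 2 * q ^+ 2) <= r * (1 / 2) * (N ^+ 2 * q ^+ 2).
    apply: ler_wpM2r; first by rewrite mulr_ge0 ?sqr_ge0.
    by apply: ler_wpM2l; lra.
  rewrite eE; lra.
have lN : 0 <= lam / (2 * N) by rewrite divr_ge0// mulr_ge0// ltW.
have := ler_wpM2l lN key.
have -> : lam / (2 * N) * (2 * E) = lam / N * E by field.
have -> : lam / (2 * N) * (2 * N * q * (r * (U1 + (r - 1) / 2 * U2)) + r * (N ^+ 2 * (del ^+ 2 - q ^+ 2 / 2)) + N * K ^+ 4) =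
  lam * q * (r * (U1 + (r - 1) / 2 * U2)) + r * (N * (lam * (del ^+ 2 / 2 - q ^+ 2 / 4))) + lam * K ^+ 4 / 2 by field.
have : 0 <= lam * K ^+ 4 by rewrite mulr_ge0// exprn_ge0.
lra.
Qed.

(** Without a planted configuration only the two-replica part is left, and [replica] alone suffices,
    with no restriction on overlaps. *)
Lemma drift_free S r v lam q : pos v -> part S v != 0 -> 0 < r <= 1 ->
  0 <= lam -> 0 <= q ->
  lam / N * (\sum_(e : vertex_pair n) ell None S r (aedge e) v) <=
  lam * q * (\sum_(i < n) ell None S r (anode s i) v) +
  (r * (1 - r) * (N * (lam * (q ^+ 2 / 4))) + lam * K ^+ 4).
Proof.
move=> v0 p0 /andP[r0 r1] l0 q0.
have rep := replica q v0 p0; have dg := diag_le S v0.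
have es := edges_sum None S r v.
set E := \sum_(e : vertex_pair n) _ in es *.
set T2 := \sum_i \sum_j cov S v i j ^+ 2 in rep.
set U2 := \sum_i mean S v i ^+ 2 in rep.
set D2 := \sum_i cov S v i i ^+ 2 in dg.
have eE : 2 * E = r * ((r - 1) / 2) * T2 - r * ((r - 1) / 2) * D2.
  rewrite es /T2 /D2 !mulr_sumr; congr (_ - _).
    apply: eq_bigr => i _; rewrite !mulr_sumr.
    by apply: eq_bigr => j _ /=; ring.
  by apply: eq_bigr => i _ /=; ring.
have -> : \sum_(i < n) ell None S r (anode s i) v = r * ((r - 1) / 2) * U2.
  rewrite /U2 !mulr_sumr; apply: eq_bigr => i _ /=.
  by rewrite /ell /mean /= /anode; ring.
have NN : N != 0 by rewrite gt_eqF.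
have D20 : 0 <= D2 by apply: sumr_ge0 => i _; exact: sqr_ge0.
have key : 2 * E <= 2 * N * q * (r * ((r - 1) / 2) * U2) +
    r * ((1 - r) / 2) * (N ^+ 2 * q ^+ 2) + N * K ^+ 4.
  have h2 : r * ((1 - r) / 2) * - (T2 - 2 * N * q * U2) <= r * ((1 - r) / 2) * (N ^+ 2 * q ^+ 2).
    by apply: ler_wpM2l; [nra|lra].
  have h3 : r * ((1 - r) / 2) * D2 <= N * K ^+ 4.
    have NK : 0 <= N * K ^+ 4 by rewrite mulr_ge0 ?exprn_ge0// ltW.
    apply: le_trans dg; rewrite ler_piMl//; nra.
  rewrite eE; lra.
have lN : 0 <= lam / (2 * N) by rewrite divr_ge0// mulr_ge0// ltW.
have := ler_wpM2l lN key.
have -> : lam / (2 * N) * (2 * E) = lam / N * E by field.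
have -> : lam / (2 * N) * (2 * N * q * (r * ((r - 1) / 2) * U2) + r * ((1 - r) / 2) * (N ^+ 2 * q ^+ 2) + N * K ^+ 4) =
  lam * q * (r * ((r - 1) / 2) * U2) + r * (1 - r) * (N * (lam * (q ^+ 2 / 4))) + lam * K ^+ 4 / 2 by field.
have : 0 <= lam * K ^+ 4 by rewrite mulr_ge0// exprn_ge0.
lra.
Qed.

End Drift.

(** * The edge law and the likelihood ratio of the block model *)

Section SbmLaw.
Context {R : realType} (p lambda d : R) (n : nat).
Hypothesis hp : 0 < p < 1.
Local Notation N := (n%:R : R).
Local Notation eps := (epsilon lambda d).
Local Notation mu := (d / N).
Local Notation s := (sval p).
Local Notation K := (sbound p).

(** A missing edge contributes [- kappa], chosen so that the two-point law is centred. *)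
Definition kappa : R := mu * eps / (1 - mu).

Definition sbm_law : seq (R * R) := two_point_law mu eps kappa.

(* Law of a graph whose edges are independent of the labels; the likelihood ratio of the block
   model is [post G X / labeling_mass p X]. *)
Definition base_mass (G : graph n) : R := \prod_e weight mu (G e).

Definition post (G : graph n) : labeling n -> R :=
  fun X => labeling_mass p X * \prod_e (1 + jump eps kappa (G e) * aedge s e X).

Lemma sval_mul (i j : 'I_2) : s i * s j =
  if i != j then -1 else if i == ord0 then (1 - p) / p else p / (1 - p).
Proof.
have [p0 p1] := andP hp; have q0 : 0 < 1 - p by lra.
have a0 : 0 <= (1 - p) / p by rewrite divr_ge0// ltW.
have b0 : 0 <= p / (1 - p) by rewrite divr_ge0// ltW.
have ab : Num.sqrt ((1 - p) / p) * Num.sqrt (p / (1 - p)) = 1.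
  rewrite -sqrtrM//; have -> : (1 - p) / p * (p / (1 - p)) = 1; last by rewrite sqrtr1.
  by field; rewrite !gt_eqF.
have I2 (k : 'I_2) : k = ord0 \/ k = ord_max.
  by case: k => [[|[|//]] hk]; [left|right]; exact/val_inj.
rewrite /sval /P0_atom; case: (I2 i) => ->; case: (I2 j) => -> /=.
- by rewrite -expr2 sqr_sqrtr.
- by rewrite mulrN ab.
- by rewrite mulNr mulrC ab.
- by rewrite mulrNN -expr2 sqr_sqrtr.
Qed.

Lemma connectivityE i j : connectivity p lambda d n i j = mu * (1 + eps * (s i * s j)).
Proof.
rewrite /connectivity !mxE sval_mul; case: ifP => _; first by ring.
by case: ifP => _; ring.
Qed.

Lemma sbm_massE (X : labeling n) (G : graph n) : mu != 1 ->
  sbm_mass p lambda d X G = base_mass G * post G X.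
Proof.
move=> m1; have m1' : 1 - mu != 0 by rewrite subr_eq0 eq_sym.
rewrite /sbm_mass /base_mass /post mulrCA; congr (_ * _).
rewrite /graph_mass -big_split/=; apply: eq_bigr => e _.
rewrite connectivityE /weight /jump /aedge; case: ifP => _; first by [].
rewrite /kappa; set m := mu in m1' *; by field.
Qed.

Hypotheses (d0 : 0 < d) (l0 : 0 < lambda) (mu2 : mu <= 1 / 2) (n0 : (0 < n)%N).

Let N0 : 0 < N. Proof. by rewrite ltr0n. Qed.
Let mu0 : 0 < mu. Proof. by rewrite divr_gt0. Qed.
Let eps0 : 0 < eps. Proof. by rewrite sqrtr_gt0 divr_gt0. Qed.

Lemma mu_neq1 : mu != 1.
Proof. by move: (mu2) => h; apply/eqP => e; move: h; rewrite e; lra. Qed.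

Lemma sqr_eps : d * eps ^+ 2 = lambda.
Proof. by rewrite sqr_sqrtr; [field; rewrite gt_eqF|rewrite divr_ge0// ltW]. Qed.

Lemma kappa_bounds : 0 <= kappa /\ kappa <= 2 * (mu * eps).
Proof.
have q : 1 / 2 <= 1 - mu by move: (mu2) => h; lra.
have e : 0 <= mu * eps by rewrite mulr_ge0// ltW.
rewrite /kappa; split; first by rewrite divr_ge0//; lra.
by rewrite ler_pdivrMr; [have := ler_wpM2l e q; lra|lra].
Qed.

Lemma sbm_law_mean_zero B : 0 <= B -> B * eps <= 1 / 2 -> mean_zero_law B sbm_law.
Proof.
move=> B0 Be; have [k0 k1] := kappa_bounds; have h := mu2; have h' := mu0.
have ke : kappa <= eps.
  apply: (le_trans k1); rewrite mulrA -[leRHS]mul1r; apply: ler_wpM2r; first exact: ltW.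
  by lra.
split.
- by move=> k; rewrite !inE => /orP[] /eqP -> /=; lra.
- by rewrite !big_cons big_nil/=; ring.
- rewrite /Ex !big_cons big_nil/= addr0 /kappa.
  have : 1 - mu != 0 by apply: lt0r_neq0; lra.
  by move: (mu) => m m1; field.
- move=> k; rewrite !inE => /orP[] /eqP -> /=.
    by rewrite gtr0_norm.
  rewrite normrN ger0_norm//; apply: le_trans Be; exact: ler_wpM2l.
Qed.

(** A missing edge contributes a relative O(d/n) to the second moment. The additional factor [eps]
    in the third moment is what large degrees make small. *)
Lemma sbm_moments : [/\ mom1 sbm_law = 2 * (mu * eps),
  mom2 sbm_law <= 2 * (lambda / N), mom3 sbm_law <= 2 * (lambda * eps / N) &
  `|mom2 sbm_law - lambda / N| <= 2 * (lambda * d / N ^+ 2)].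
Proof.
have [k0 k1] := kappa_bounds; have h := mu2; have h' := mu0; have e0 := eps0.
have m1' : 1 - mu != 0 by apply: lt0r_neq0; lra.
have me : mu * eps ^+ 2 = lambda / N.
  by rewrite -[X in _ = X / N]sqr_eps; field; rewrite gt_eqF.
have mk : (1 - mu) * kappa = mu * eps by rewrite /kappa mulrC divfK.
have M2 : mom2 sbm_law = mu * eps ^+ 2 + mu * eps * kappa.
  by rewrite /mom2 /Ex !big_cons big_nil/= addr0 sqrrN [kappa ^+ 2]expr2 mulrA mk.
have ln0 : 0 <= lambda / N by rewrite divr_ge0// ltW.
have e2 : mu * eps * kappa <= lambda / N * (2 * mu).
  have : mu * eps * kappa <= mu * eps * (2 * (mu * eps)).
    by rewrite ler_wpM2l// mulr_ge0// ltW.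
  by rewrite -me; lra.
have e20 : 0 <= mu * eps * kappa by apply: mulr_ge0 => //; apply: mulr_ge0; exact: ltW.
have e3 : lambda / N * (2 * mu) <= lambda / N * 1 by apply: ler_wpM2l => //; lra.
split.
- rewrite /mom1 /Ex !big_cons big_nil/= addr0 gtr0_norm// normrN ger0_norm// mk; lra.
- by rewrite M2 me; lra.
- rewrite /mom3 /Ex !big_cons big_nil/= addr0 gtr0_norm// normrN ger0_norm//.
  have -> : (1 - mu) * kappa ^+ 3 = (1 - mu) * kappa * kappa * kappa by ring.
  have -> : mu * eps ^+ 3 = mu * eps ^+ 2 * eps by ring.
  rewrite mk me; have ke : kappa <= eps.
    apply: (le_trans k1); rewrite mulrA -[leRHS]mul1r; apply: ler_wpM2r; first exact: ltW.
    by lra.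
  have : mu * eps * kappa * kappa <= lambda / N * eps.
    by apply: ler_pM => //; lra.
  lra.
- rewrite M2 me addrAC subrr add0r ger0_norm//.
  by apply: (le_trans e2); rewrite le_eqVlt; apply/orP; left; apply/eqP; field; rewrite gt_eqF.
Qed.

End SbmLaw.

Section Regime.
Context {R : realType} (p lambda : R).
Hypotheses (hp : 0 < p < 1) (l0 : 0 < lambda).
Local Notation eps d := (epsilon lambda d).
Local Notation s := (sval p).
Local Notation K := (sbound p).
Local Notation B := (sbound p ^+ 2).
Local Notation C := (expansion_cst B).
Local Notation L d n := (sbm_law lambda d n).
Implicit Types (d eta r q : R) (n : nat).

(** In order: erasure of each edge, third-order remainder of the rounds, replacement of the second
    moment by [lambda / n], and diagonal terms. *)
Definition err d n : R :=
  4 * #|{: vertex_pair n}|%:R * edge_err B (L d n) +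
  2 * (C * expR 1 * (#|{: vertex_pair n}|%:R * mom3 (L d n))) +
  2 * B ^+ 2 * #|{: vertex_pair n}|%:R * `|mom2 (L d n) - lambda / n%:R| + lambda * K ^+ 4.

(* The pairs [(d, n)] for which the total error of the interpolation is at most [eta * n]. *)
Definition regime eta d n : Prop :=
  [/\ 0 < d, (0 < n)%N, d / n%:R <= 1 / 2, B * eps d <= 1 / 2 &
      2 * B ^+ 2 * mom2 (L d n) + edge_err B (L d n) <= 1 / 2 /\ err d n <= eta * n%:R].

Let K1 : 1 <= K. Proof. exact: sbound_ge1. Qed.
Let K0 : 0 <= K. Proof. by apply: le_trans K1. Qed.
Let B1 : 1 <= B. Proof. by rewrite exprn_ege1. Qed.
Let B0 : 0 <= B. Proof. by apply: le_trans B1. Qed.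
Let C0 : 0 <= C. Proof. exact: expansion_cst_ge0. Qed.

Lemma card_vertex_pair n : #|{: vertex_pair n}|%:R <= n%:R ^+ 2 :> R.
Proof.
rewrite expr2 -natrM ler_nat card_sig; apply: leq_trans (max_card _) _.
by rewrite card_prod card_ord.
Qed.

(** Over at most n^2 edges the third moments add up to order [lambda * eps * n], which is made
    smaller than [eta * n] by taking [d] large. The other errors stay bounded in [n] for fixed [d],
    so [n0] may depend on [d]. *)
Lemma regime_eventually eta : 0 < eta -> exists d0 : R, forall d, d0 <= d ->
  exists n0 : R, forall n, n0 <= n%:R -> regime eta d n.
Proof.
have [b1 b0 c0' k1 lp] := And5 B1 B0 C0 K1 l0.
move=> eta0; pose E : R := expR 1; have E0 : 0 <= E := expR_ge0 _.
(* 12 = 4 * 2 + 2 * 2, the coefficients of [eps d * n] contributed by the first two terms of [err]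
   through [a1] and [a2] below. *)
pose A1 := 12 * (C * E * lambda).
have CE : 0 <= C * E * lambda by rewrite mulr_ge0 ?mulr_ge0// ltW.
have A10 : 0 <= A1 by rewrite /A1; lra.
pose c := Num.min (1 / (2 * B)) (eta / (2 * (A1 + 1))).
have c0 : 0 < c.
  by rewrite /c lt_min; apply/andP; split; apply: divr_gt0; lra.
exists (lambda / c ^+ 2) => d hd.
have d0 : 0 < d by apply: lt_le_trans hd; rewrite divr_gt0// exprn_gt0.
have e0 : 0 < eps d by rewrite sqrtr_gt0 divr_gt0.
have ec : eps d <= c.
  have : eps d ^+ 2 <= c ^+ 2.
    rewrite sqr_sqrtr; last by rewrite divr_ge0// ltW.
    by move: hd; rewrite ler_pdivrMr ?exprn_gt0// ler_pdivrMr// mulrC.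
  by rewrite ler_pXn2r// nnegrE ltW.
have [eB eA] : B * eps d <= 1 / 2 /\ A1 * eps d <= eta / 2.
  move: ec; rewrite /c le_min => /andP[h1 h2]; split.
    have := ler_wpM2l B0 h1; have -> : B * (1 / (2 * B)) = 1 / 2; last by [].
    by field; apply: lt0r_neq0; lra.
  have A2 : 0 <= A1 + 1 by lra.
  have := ler_wpM2l A2 h2; have -> : (A1 + 1) * (eta / (2 * (A1 + 1))) = eta / 2.
    by field; apply: lt0r_neq0; lra.
  lra.
pose c1 := C * E * (2 * (lambda * eps d) + 4 * (lambda * d * eps d)).
have c10 : 0 <= c1.
  rewrite /c1; apply: mulr_ge0; first exact: mulr_ge0.
  by rewrite addr_ge0// !mulr_ge0// ltW.
pose c2 := 16 * (C * E * (lambda * d * eps d)) + 4 * (B ^+ 2 * (lambda * d)) + lambda * K ^+ 4.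
have c20 : 0 <= c2.
  have x0 : 0 <= lambda * d by apply: mulr_ge0; exact: ltW.
  have x1 : 0 <= C * E * (lambda * d * eps d).
    by apply: mulr_ge0; [exact: mulr_ge0|apply: mulr_ge0 => //; exact: ltW].
  have x2 : 0 <= B ^+ 2 * (lambda * d) by apply: mulr_ge0 => //; exact: exprn_ge0.
  have x3 : 0 <= lambda * K ^+ 4 by apply: mulr_ge0; [exact: ltW|exact: exprn_ge0].
  rewrite /c2; lra.
have t1 : 0 <= 2 * d by rewrite mulr_ge0// ltW.
have t2 : 0 <= 2 * (C * lambda) by rewrite !mulr_ge0// ltW.
have t3 : 0 <= 2 * (4 * (B ^+ 2 * lambda) + c1).
  by rewrite mulr_ge0// addr_ge0// !mulr_ge0 ?exprn_ge0// ltW.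
have t4 : 0 <= 2 * c2 / eta by rewrite divr_ge0 ?mulr_ge0// ltW.
exists (1 + 2 * d + 2 * (C * lambda) + 2 * (4 * (B ^+ 2 * lambda) + c1) + 2 * c2 / eta) => n hn.
have [n1 n2 n3 n4 n5] := le_terms5 ler01 t1 t2 t3 t4 hn.
have n0 : (0 < n)%N by rewrite -(ler_nat R).
have N0 : 0 < n%:R :> R by rewrite ltr0n.
have muh : d / n%:R <= 1 / 2 by rewrite ler_pdivrMr//; exact: le_half.
have [M1 M2 M3 M4] := sbm_moments d0 l0 muh n0.
have [q1 q2 q3] := mom_ge0 (sbm_law_mean_zero d0 l0 muh n0 B0 eB).
have CM : C * mom2 (L d n) <= 1.
  apply: (@le_trans _ _ (C * (2 * (lambda / n%:R)))); first by rewrite ler_wpM2l.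
  have -> : C * (2 * (lambda / n%:R)) = 2 * (C * lambda) / n%:R by ring.
  by rewrite ler_pdivrMr// mul1r.
have ni : 0 <= n%:R^-1 :> R by rewrite invr_ge0 ltW.
have n21 : n%:R^-1 ^+ 2 <= n%:R^-1 :> R.
  by rewrite expr2 ler_piMl// invf_le1.
have m12 : mom2 (L d n) * mom1 (L d n) <= 4 * (lambda * d * eps d) * n%:R^-1 ^+ 2.
  rewrite M1; apply: (@le_trans _ _ (2 * (lambda / n%:R) * (2 * (d / n%:R * eps d)))).
    by apply: ler_wpM2r => //; rewrite -M1.
  by rewrite le_eqVlt; apply/orP; left; apply/eqP; ring.
have EE : edge_err B (L d n) <= C * E * (2 * (lambda * eps d) * n%:R^-1 + 4 * (lambda * d * eps d) * n%:R^-1 ^+ 2).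
  rewrite /edge_err; apply: ler_pM.
  - by rewrite mulr_ge0// expR_ge0.
  - by rewrite addr_ge0// mulr_ge0.
  - by rewrite ler_wpM2l// ler_expR.
  - by apply: lerD => //; apply: (le_trans M3); rewrite mulrA.
have lde : 0 <= lambda * d * eps d by rewrite !mulr_ge0// ltW.
have EE1 : edge_err B (L d n) <= c1 * n%:R^-1.
  apply: (le_trans EE); rewrite /c1 -[leRHS]mulrA; apply: ler_wpM2l; first exact: mulr_ge0.
  by rewrite [leRHS]mulrDl lerD2l; apply: ler_wpM2l => //; rewrite mulr_ge0.
split=> //; split.
  have b : 2 * B ^+ 2 * mom2 (L d n) <= 2 * B ^+ 2 * (2 * (lambda / n%:R)).
    by apply: ler_wpM2l => //; rewrite mulr_ge0// exprn_ge0.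
  apply: (le_trans (lerD b EE1)).
  have -> : 2 * B ^+ 2 * (2 * (lambda / n%:R)) + c1 * n%:R^-1 = (4 * (B ^+ 2 * lambda) + c1) / n%:R by ring.
  by rewrite ler_pdivrMr//; exact: le_half.
have cv := card_vertex_pair n; set V := #|{: vertex_pair n}|%:R in cv *.
have V0 : 0 <= V by exact: ler0n.
have ee0 := edge_err_ge0 B1 (sbm_law_mean_zero d0 l0 muh n0 B0 eB).
have N2 : 0 <= n%:R ^+ 2 :> R by exact: exprn_ge0.
have nn : n%:R != 0 :> R by rewrite gt_eqF.
have a1 : V * edge_err B (L d n) <= C * E * (2 * (lambda * eps d) * n%:R + 4 * (lambda * d * eps d)).
  apply: (@le_trans _ _ (n%:R ^+ 2 * (C * E * (2 * (lambda * eps d) * n%:R^-1 + 4 * (lambda * d * eps d) * n%:R^-1 ^+ 2)))).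
    exact: ler_pM.
  by rewrite le_eqVlt; apply/orP; left; apply/eqP; field.
have a2 : C * E * (V * mom3 (L d n)) <= C * E * (2 * (lambda * eps d) * n%:R).
  apply: ler_wpM2l; first exact: mulr_ge0.
  apply: (@le_trans _ _ (n%:R ^+ 2 * (2 * (lambda * eps d / n%:R)))).
    exact: ler_pM.
  by rewrite le_eqVlt; apply/orP; left; apply/eqP; field.
have a3 : B ^+ 2 * (V * `|mom2 (L d n) - lambda / n%:R|) <= B ^+ 2 * (2 * (lambda * d)).
  apply: ler_wpM2l; first exact: exprn_ge0.
  apply: (@le_trans _ _ (n%:R ^+ 2 * (2 * (lambda * d / n%:R ^+ 2)))).
    exact: ler_pM.
  by rewrite le_eqVlt; apply/orP; left; apply/eqP; field.
have a4 : A1 * eps d * n%:R <= eta / 2 * n%:R by rewrite ler_wpM2r// ltW.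
have a5 : c2 <= eta / 2 * n%:R.
  by move: n5; rewrite ler_pdivrMr// => /le_half; rewrite [n%:R * _]mulrC !mulrA mul1r [_^-1 * _]mulrC.
clear EE EE1 CM m12 n3 n4 n5 t1 t2 t3 t4 eB eA hd hn c10 c20 M1 M2 M3 M4 q1 q2 q3 n21 muh ee0 cv N2.
rewrite /err -/V -/E; move: a1 a2 a3 a4 a5; rewrite /A1 /c2; lra.
Qed.

End Regime.

Section SbmBounds.
Context {R : realType} (p lambda : R).
Hypotheses (hp : 0 < p < 1) (l0 : 0 < lambda).
Local Notation eps d := (epsilon lambda d).
Local Notation s := (sval p).
Local Notation K := (sbound p).
Local Notation B := (sbound p ^+ 2).
Local Notation C := (expansion_cst B).
Local Notation L d n := (sbm_law lambda d n).
Implicit Types (d eta r q del : R) (n : nat).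

Let K1 : 1 <= K. Proof. exact: sbound_ge1. Qed.
Let K0 : 0 <= K. Proof. by apply: le_trans K1. Qed.
Let B1 : 1 <= B. Proof. by rewrite exprn_ege1. Qed.
Let B0 : 0 <= B. Proof. by apply: le_trans B1. Qed.
Let KB : K <= B. Proof. by rewrite expr2 ler_peMr. Qed.

Lemma labeling_mass_prodv n : @labeling_mass R p n = prodv (fun (_ : 'I_n) => swt p).
Proof. by apply/funext => X. Qed.

Lemma labeling_mass_pos n : pos (@labeling_mass R p n).
Proof. by move=> X; apply: prodr_gt0 => i _; exact: swt_pos. Qed.

Definition node_round n (M : nat) q :=
  [seq (anode s i, sign_law (Num.sqrt (lambda * q / M%:R))) | i <- index_enum 'I_n].

Lemma ops_ge0 (Om : finType) (l : seq (@chan R Om)) F k v :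
  (forall c, List.In c l -> good_chan k c) -> leF (fun=> 0) F -> pos v -> 0 <= ops l F v.
Proof.
move=> lk F0 v0; have := ops_le lk F0 v0.
have e G : (fun u : Om -> R => 0 * G u : R) = fun=> 0 by apply/funext => u; rewrite mul0r.
suff -> : ops l (fun=> 0) = fun=> 0 by [].
by rewrite -[in LHS](e F) opsZ e.
Qed.

Lemma node_step_small (M : nat) q : (0 < M)%N -> 0 <= q ->
  4 * (B ^+ 2 * (lambda * q)) <= M%:R -> B * `|Num.sqrt (lambda * q / M%:R)| <= 1 / 2.
Proof.
move=> M0 q0 hM; have MN : 0 < M%:R :> R by rewrite ltr0n.
have lq : 0 <= lambda * q by rewrite mulr_ge0// ltW.
rewrite ger0_norm ?sqrtr_ge0//.
have : (B * Num.sqrt (lambda * q / M%:R)) ^+ 2 <= (1 / 2) ^+ 2.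
  rewrite exprMn sqr_sqrtr; last by apply: divr_ge0 => //; exact: ltW.
  by rewrite mulrA ler_pdivrMr//; lra.
by rewrite ler_pXn2r ?nnegrE// mulr_ge0// sqrtr_ge0.
Qed.

Lemma bound_edges n : bounded_by B [seq aedge s e | e <- index_enum (vertex_pair n)].
Proof.
move=> a; elim: (index_enum _) => [//|e l IH] /= [<-|/IH//] w.
exact: aedge_le (sval_le p) e w.
Qed.

Lemma bound_nodes n : bounded_by B [seq anode s i | i <- index_enum 'I_n].
Proof.
move=> a; elim: (index_enum _) => [//|e l IH] /= [<-|/IH//] w.
exact: le_trans (sval_le p _) KB.
Qed.

(** [ops_edges_le_nodes] read on graphs through [ops_graph]. The hypothesis uses the ideal variance
    [lambda / n]; the deviation [D] from the true one is part of [err]. *)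
Lemma sbm_le_nodes eta d n o S r q main : regime p lambda eta d n -> 0 < r <= 1 -> 0 <= q ->
  (forall v, pos v ->
    lambda / n%:R * (\sum_(e : vertex_pair n) ell o S r (aedge s e) v) <=
    lambda * q * (\sum_(i < n) ell o S r (anode s i) v) + (main + lambda * K ^+ 4)) ->
  exists W : R, forall M : nat, (0 < M)%N -> W <= M%:R ->
    \sum_G base_mass d G * Phi o S r (post p lambda d G) <=
    expR (main + eta * n%:R + W * Num.sqrt M%:R^-1) *
      ops (pw M (node_round n M q)) (Phi o S r) (@labeling_mass R p n).
Proof.
move=> [d0 n0 mu2 Be [small Eerr]] /andP[r0 r1] q0 Hd.
have LK := sbm_law_mean_zero d0 l0 mu2 n0 B0 Be.
have eb := @bound_edges n; have vb := @bound_nodes n.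
have lq : 0 <= lambda * q by rewrite mulr_ge0// ltW.
set V := #|{: vertex_pair n}|%:R : R.
pose D := 2 * B ^+ 2 * V * `|mom2 (L d n) - lambda / n%:R|.
have szE : (size [seq aedge s e | e <- index_enum (vertex_pair n)])%:R = V.
  by rewrite size_map -sum1_size sum1_card.
have Hd' v : pos v -> mom2 (L d n) * (\sum_(a <- [seq aedge s e | e <- index_enum (vertex_pair n)]) ell o S r a v) <=
   lambda * q * (\sum_(a <- [seq anode s i | i <- index_enum 'I_n]) ell o S r a v) +
   (main + lambda * K ^+ 4 + D).
  move=> v0; have sl := sum_ell_le o S r0 r1 B1 eb v0.
  rewrite szE in sl; rewrite !big_map in sl *.
  have := Hd v v0; set Ee := \sum_(e : vertex_pair n) _ in sl *.
  set Ev := \sum_(i < n) _ => h.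
  have : (mom2 (L d n) - lambda / n%:R) * Ee <= D.
    apply: le_trans (ler_norm _) _; rewrite normrM mulrC.
    have -> : D = V * (2 * B ^+ 2) * `|mom2 (L d n) - lambda / n%:R| by rewrite /D; ring.
    by rewrite ler_wpM2r.
  lra.
have [W hW] := ops_edges_le_nodes r0 r1 B1 LK small lq eb vb Hd'.
have b0 : 0 <= 4 * (B ^+ 2 * (lambda * q)) by apply: mulr_ge0 => //; apply: mulr_ge0 => //; exact: exprn_ge0.
have Wn := ler_norm W.
exists (`|W| + 4 * (B ^+ 2 * (lambda * q))) => M M0 WM.
have MN : 0 < M%:R :> R by rewrite ltr0n.
have Bh : B * `|Num.sqrt (lambda * q / M%:R)| <= 1 / 2.
  by apply: node_step_small => //; have := normr_ge0 W; lra.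
have WM' : W <= M%:R by lra.
have := hW M M0 WM' _ (@labeling_mass_pos n).
rewrite szE -!map_comp.
have -> : ops [seq ((fun a => (a, L d n)) \o aedge s) e | e <- index_enum (vertex_pair n)] (Phi o S r) (@labeling_mass R p n) =
    \sum_G base_mass d G * Phi o S r (post p lambda d G).
  exact: ops_graph.
move/le_trans; apply; apply: ler_wpM2r.
  apply: (ops_ge0 (k := B)); last exact: labeling_mass_pos.
    move=> c /In_pw /In_map_chan[i _ ->]; split => /=.
      by move=> w; exact: le_trans (sval_le p _) KB.
    exact: mean_zero_sign.
  by move=> v v0; exact: Phi_ge0.
have e0 := edge_err_ge0 B1 LK.
apply: (@le_trans _ _ (expR (4 * V * edge_err B (L d n)) * expR (main + lambda * K ^+ 4 + D + 2 * (C * expR 1 * (V * mom3 (L d n))) + W * Num.sqrt M%:R^-1))).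
  apply: ler_wpM2r; first exact: expR_ge0.
  have -> : 4 * V * edge_err B (L d n) = (size [seq aedge s e | e <- index_enum (vertex_pair n)])%:R * (4 * edge_err B (L d n)).
    by rewrite szE; ring.
  rewrite expRM_natl size_map; apply: lerXn2r; rewrite ?nnegrE ?expR_ge0 ?expR_ge1Dx//.
  by rewrite addr_ge0// mulr_ge0.
have Ws : W * Num.sqrt M%:R^-1 <= (`|W| + 4 * (B ^+ 2 * (lambda * q))) * Num.sqrt M%:R^-1.
  by rewrite ler_wpM2r ?sqrtr_ge0//; lra.
rewrite -expRD ler_expR; move: Eerr; rewrite /err -/V /D; lra.
Qed.

Lemma node_round_good n M q : (0 < M)%N -> 0 <= q -> 4 * (B ^+ 2 * (lambda * q)) <= M%:R ->
  forall c, List.In c (@node_round n M q) -> good_chan B c.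
Proof.
move=> M0 q0 hM c /In_map_chan[i _ ->]; split => /=.
  by move=> w; exact: le_trans (sval_le p _) KB.
by apply: mean_zero_sign; exact: node_step_small.
Qed.

Lemma nodes_walk n M q r : (0 < M)%N -> 0 <= q -> 4 * (B ^+ 2 * (lambda * q)) <= M%:R ->
  ops (pw M (@node_round n M q)) (fun v => part [set: labeling n] v `^ (1 + r)) (@labeling_mass R p n) =
  walk p M (lambda * q) r ^+ n.
Proof.
move=> M0 q0 hM; have MN : 0 < M%:R :> R by rewrite ltr0n.
have Bh := node_step_small M0 q0 hM.
have sB j : `|s j| <= B by apply: le_trans KB; exact: sval_le.
have := iter_prodform sB (mean_zero_sign Bh) M (@part_prodform R _ n (1 + r)).
move=> /(_ (fun=> swt p) (fun=> swt_pos hp)).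
rewrite -labeling_mass_prodv ops_pw => ->.
by rewrite /walk prodr_const card_ord.
Qed.


End SbmBounds.

Section SbmMoments.
Context {R : realType} (p lambda : R).
Hypotheses (hp : 0 < p < 1) (l0 : 0 < lambda).
Local Notation s := (sval p).
Local Notation B := (sbound p ^+ 2).
Implicit Types (d eta r q del : R) (n : nat).

Definition near_overlap n (X : labeling n) q del : {set labeling n} :=
  [set x | `|ovl s X x - n%:R * q| <= n%:R * del]%SET.

Lemma exists_nat_ge (x : R) : exists2 M : nat, (0 < M)%N & x <= M%:R.
Proof.
exists (Num.bound x).+1 => //; apply: le_trans (ler_norm _) _.
apply: ltW; apply: lt_trans (archi_boundP (normr_ge0 x)) _.
have -> : Num.bound x = Num.bound `|x|.
  by rewrite /Num.bound normr_id.
by rewrite ltr_nat.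
Qed.

Lemma sqrt_inv_small (W eta : R) (M : nat) : 0 < eta -> (0 < M)%N -> (W / eta) ^+ 2 <= M%:R ->
  W * Num.sqrt M%:R^-1 <= eta.
Proof.
move=> e0 M0 h; have MN : 0 < M%:R :> R by rewrite ltr0n.
apply: (@le_trans _ _ (`|W| * Num.sqrt M%:R^-1)).
  by rewrite ler_wpM2r ?sqrtr_ge0// ler_norm.
rewrite -(@ler_pXn2r _ 2)// ?nnegrE ?mulr_ge0 ?sqrtr_ge0//; last exact: ltW.
rewrite exprMn sqr_sqrtr ?invr_ge0 ?(ltW MN)// real_normK ?num_real// ler_pdivrMr//.
by move: h; rewrite expr_div_n ler_pdivrMr ?exprn_gt0// mulrC.
Qed.

Lemma powR_succ (z r : R) : 0 <= z -> 0 < r -> z `^ (1 + r) = z * z `^ r.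
Proof.
move=> z0 r0; rewrite powRD ?powRr1//; apply/implyP => /eqP h; lra.
Qed.

Lemma part_le (Om : finType) (A : {set Om}) (v : Om -> R) : pos v ->
  part A v <= part [set: Om] v.
Proof.
move=> v0; rewrite part_setT /part [leRHS](bigID (mem A))/= lerDl.
by apply: sumr_ge0 => i _; exact: ltW.
Qed.

Lemma sum_Phi_le n (A : labeling n -> {set labeling n}) r : 0 < r ->
  leF (fun v => \sum_X Phi (Some X) (A X) r v) (fun v : labeling n -> R => part [set: labeling n] v `^ (1 + r)).
Proof.
move=> r0 v v0 /=; rewrite powR_succ ?part_ge0// [X in _ <= X * _]part_setT mulr_suml.
apply: ler_sum => X _; rewrite /Phi ler_wpM2l//; first exact: ltW.
by apply: ge0_ler_powR; rewrite ?nnegrE ?part_ge0// ?part_le//; exact: ltW.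
Qed.

Lemma walk_ge0 M q r : (0 < M)%N -> 0 <= q -> 4 * (B ^+ 2 * (lambda * q)) <= M%:R ->
  0 <= walk p M (lambda * q) r.
Proof.
move=> M0 q0 hM; rewrite /walk.
have := @ops_ge0 _ 'I_2 (pw M [:: (s, sign_law (Num.sqrt (lambda * q / M%:R)))])
  (fun w => part [set: 'I_2] w `^ (1 + r)) B (swt p).
rewrite ops_pw; apply; [|by move=> v v0; exact: powR_ge0|exact: swt_pos].
move=> c /In_pw /= [<-|//]; split; last by apply: mean_zero_sign; exact: node_step_small.
move=> w; apply: le_trans (sval_le p w) _; have K1 := sbound_ge1 p.
by rewrite expr2 ler_peMr//; apply: le_trans K1.
Qed.

(** The window around [q] serves only in the drift comparison and is then released by [sum_Phi_le].
    The three [eta] come from the regime, from finite [M], and from [walk_limit]. *)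
Lemma planted_bound q : 0 <= q -> exists2 C : R, 0 <= C &
  forall r del eta d n, 0 < r <= 1 -> 0 <= del -> 0 < eta -> regime p lambda eta d n ->
  \sum_(X : labeling n) \sum_(G : graph n) base_mass d G * Phi (Some X) (near_overlap X q del) r (post p lambda d G) <=
  expR (n%:R * (r * (lambda * (del ^+ 2 / 2 - q ^+ 2 / 4) + psi p lambda q) + C * r ^+ 2 + 3 * eta)).
Proof.
move=> q0; have lq : 0 <= lambda * q by rewrite mulr_ge0// ltW.
have [C C0 hC] := walk_limit hp lq; exists C => // r del eta d n /andP[r0 r1] d0 e0 reg.
have [_ n0 _ _ _] := reg; have N0 : 0 < n%:R :> R by rewrite ltr0n.
have N1 : 1 <= n%:R :> R by rewrite (ler_nat _ 1).
pose main := r * (n%:R * (lambda * (del ^+ 2 / 2 - q ^+ 2 / 4))).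
pose nodes M := @node_round _ p lambda n M q.
have rge : - (1 / 2) <= r by lra.
have [W1 hW1] := hC r rge r1 eta e0.
have gX (X : labeling n) : exists W : R, forall M : nat, (0 < M)%N -> W <= M%:R ->
    \sum_(G : graph n) base_mass d G * Phi (Some X) (near_overlap X q del) r (post p lambda d G) <=
    expR (main + eta * n%:R + W * Num.sqrt M%:R^-1) *
      ops (pw M (nodes M)) (Phi (Some X) (near_overlap X q del) r) (@labeling_mass R p n).
  (* An empty window has no Gibbs average, but then the left side is 0, as [r > 0]. *)
  have [S0|[x0 x0S]] := set_0Vmem (near_overlap X q del).
    exists (4 * (B ^+ 2 * (lambda * q))) => M M0 WM.
    rewrite big1 => [|G _].
      apply: mulr_ge0; first exact: expR_ge0.
      apply: (ops_ge0 (k := B)); [|by move=> v v0; exact: Phi_ge0|exact: labeling_mass_pos].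
      by move=> c /In_pw; apply: node_round_good.
    by rewrite /Phi S0 /part big_set0 powR0 ?gt_eqF// !mulr0.
  apply: (sbm_le_nodes hp l0 reg _ q0); first by rewrite r0.
  move=> v v0; apply: (drift_planted (sbound_ge1 p) (sval_le p) n0) => //.
  - rewrite gt_eqF// /part (bigD1 x0)//= ltr_wpDr//; apply: sumr_ge0 => i _; exact: ltW.
  - by rewrite r0.
  - exact: ltW.
  - by move=> x; rewrite inE.
have /choice[W hW] := gX.
(* One [M] has to serve every planted [X] before the sum over [X] is taken. *)
pose WT : R := \sum_X `|W X|.
have WX X : W X <= WT.
  apply: le_trans (ler_norm _) _; rewrite /WT (bigD1 X)//= lerDl.
  by apply: sumr_ge0.
have WT0 : 0 <= WT by apply: sumr_ge0.
have b0 : 0 <= 4 * (B ^+ 2 * (lambda * q)).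
  by apply: mulr_ge0 => //; apply: mulr_ge0 => //; apply: exprn_ge0; exact: sqr_ge0.
have [M M0 hM] := exists_nat_ge (WT + `|W1| + (WT / eta) ^+ 2 + 4 * (B ^+ 2 * (lambda * q))).
have sq := sqr_ge0 (WT / eta); have nW := normr_ge0 W1; have lW := ler_norm W1.
have [m1 m2 m3 m4] := le_terms4 WT0 nW sq b0 hM.
have Ws : WT * Num.sqrt M%:R^-1 <= eta by exact: sqrt_inv_small.
apply: (@le_trans _ _ (\sum_(X : labeling n) expR (main + 2 * eta * n%:R) *
    ops (pw M (nodes M)) (Phi (Some X) (near_overlap X q del) r) (@labeling_mass R p n))).
  apply: ler_sum => X _; apply: (le_trans (hW X M M0 _)); first exact: le_trans (WX X) m1.
  apply: ler_wpM2r.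
    apply: (ops_ge0 (k := B)); [|by move=> v v0; exact: Phi_ge0|exact: labeling_mass_pos].
    by move=> c /In_pw; exact: node_round_good.
  rewrite ler_expR; have : W X * Num.sqrt M%:R^-1 <= WT * Num.sqrt M%:R^-1.
    by rewrite ler_wpM2r ?sqrtr_ge0.
  have : eta <= eta * n%:R by rewrite ler_peMr// ltW.
  lra.
rewrite -mulr_sumr.
have eqs := ops_sum (pw M (nodes M)) (fun X : labeling n => Phi (Some X) (near_overlap X q del) r).
rewrite -[X in _ * X <= _](f_equal (@^~ (@labeling_mass R p n)) eqs).
have nG c : List.In c (pw M (nodes M)) -> good_chan B c.
  by move=> /In_pw; exact: node_round_good.
have le1 := ops_le nG (sum_Phi_le (fun X => near_overlap X q del) r0) (@labeling_mass_pos _ _ hp n).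
rewrite nodes_walk// in le1.
apply: (@le_trans _ _ (expR (main + 2 * eta * n%:R) * expR (r * psi p lambda q + C * r ^+ 2 + eta) ^+ n)).
  apply: ler_wpM2l; first exact: expR_ge0.
  apply: (le_trans le1); apply: lerXn2r; rewrite ?nnegrE ?expR_ge0//.
    exact: walk_ge0.
  by apply: hW1 => //; exact: le_trans lW m2.
rewrite -expRM_natl -expRD ler_expR /main; lra.
Qed.

(** Here [walk_limit] is applied with the negative parameter [r - 1], which gives [psi] its minus
    sign; its range requires [r >= 1 / 2]. *)
Lemma free_bound q : 0 <= q -> exists2 C : R, 0 <= C &
  forall r eta d n, 1 / 2 <= r < 1 -> 0 < eta -> regime p lambda eta d n ->
  \sum_(G : graph n) base_mass d G * part [set: labeling n] (post p lambda d G) `^ r <=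
  expR (n%:R * (r * (1 - r) * (lambda * (q ^+ 2 / 4)) - (1 - r) * psi p lambda q +
    C * (1 - r) ^+ 2 + 3 * eta)).
Proof.
move=> q0; have lq : 0 <= lambda * q by rewrite mulr_ge0// ltW.
have [C C0 hC] := walk_limit hp lq; exists C => // r eta d n /andP[r0 r1] e0 reg.
have [_ n0 _ _ _] := reg; have N0 : 0 < n%:R :> R by rewrite ltr0n.
have N1 : 1 <= n%:R :> R by rewrite (ler_nat _ 1).
pose main := r * (1 - r) * (n%:R * (lambda * (q ^+ 2 / 4))).
pose nodes M := @node_round _ p lambda n M q.
have rge : - (1 / 2) <= r - 1 by lra.
have rle : r - 1 <= 1 by lra.
have r01 : 0 < r <= 1 by lra.
have [W1 hW1] := hC (r - 1) rge rle eta e0.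
have [W hW] : exists W : R, forall M : nat, (0 < M)%N -> W <= M%:R ->
    \sum_(G : graph n) base_mass d G * Phi None [set: labeling n] r (post p lambda d G) <=
    expR (main + eta * n%:R + W * Num.sqrt M%:R^-1) *
      ops (pw M (nodes M)) (Phi None [set: labeling n] r) (@labeling_mass R p n).
  apply: (sbm_le_nodes hp l0 reg _ q0) => // v v0.
  apply: (drift_free (sbound_ge1 p) (sval_le p) n0) => //; last exact: ltW.
  by rewrite gt_eqF// (Z_gt0 [ffun=> ord0]).
have b0 : 0 <= 4 * (B ^+ 2 * (lambda * q)).
  by apply: mulr_ge0 => //; apply: mulr_ge0 => //; apply: exprn_ge0; exact: sqr_ge0.
have [M M0 hM] := exists_nat_ge (`|W| + `|W1| + (W / eta) ^+ 2 + 4 * (B ^+ 2 * (lambda * q))).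
have sq := sqr_ge0 (W / eta); have nW := normr_ge0 W1; have lW := ler_norm W1.
have nW' := normr_ge0 W; have lW' := ler_norm W.
have [m1 m2 m3 m4] := le_terms4 nW' nW sq b0 hM.
have Ws : W * Num.sqrt M%:R^-1 <= eta by exact: sqrt_inv_small.
have PE : Phi None [set: labeling n] r = fun v => part [set: labeling n] v `^ (1 + (r - 1)).
  by apply/funext => v; rewrite /Phi mul1r addrC subrK.
have WM : W <= M%:R by exact: le_trans lW' m1.
have := hW M M0 WM; rewrite PE nodes_walk//.
have -> : 1 + (r - 1) = r by ring.
move/le_trans; apply.
apply: (@le_trans _ _ (expR (main + 2 * eta * n%:R) * expR ((r - 1) * psi p lambda q + C * (r - 1) ^+ 2 + eta) ^+ n)).
  apply: ler_pM; rewrite ?expR_ge0 ?exprn_ge0//.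
  - exact: walk_ge0.
  - rewrite ler_expR; have : eta <= eta * n%:R by rewrite ler_peMr// ltW.
    lra.
  - apply: lerXn2r; rewrite ?nnegrE ?expR_ge0//; last by apply: hW1 => //; exact: le_trans lW m2.
    exact: walk_ge0.
rewrite -expRM_natl -expRD ler_expR /main; lra.
Qed.

End SbmMoments.

(** * Overlap of two posterior samples *)

Section Replica.
Context {R : realType} (p lambda : R).
Hypotheses (hp : 0 < p < 1) (l0 : 0 < lambda).
Local Notation s := (sval p).
Local Notation K := (sbound p).
Local Notation B := (sbound p ^+ 2).
Implicit Types (d eta r q del : R) (n : nat).

Section Fixed.
Variables (eta d : R) (n : nat).
Hypothesis reg : regime p lambda eta d n.
Local Notation post := (post p lambda d).
Local Notation Z G := (part [set: labeling n] (post G)).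

Lemma base_mass_ge0 (G : graph n) : 0 <= base_mass d G.
Proof.
have [d0 n0 mu2 _ _] := reg; apply: prodr_ge0 => e _; rewrite /weight.
have m0 : 0 < d / n%:R by rewrite divr_gt0// ltr0n.
by case: ifP => _; lra.
Qed.

Let LK : mean_zero_law B (sbm_law lambda d n).
Proof.
have [d0 n0 mu2 Be _] := reg.
by apply: (sbm_law_mean_zero d0 l0 mu2 n0 _ Be); exact: sqr_ge0.
Qed.

Lemma post_pos (G : graph n) : pos (post G).
Proof.
move=> X; apply: mulr_gt0; first exact: labeling_mass_pos.
apply: prodr_gt0 => e _; have [_ _ _ LB] := LK.
have jB : B * `|jump (epsilon lambda d) (kappa lambda d n) (G e)| <= 1 / 2.
  rewrite /jump; case: ifP => _.
    by apply: (LB (d / n%:R, epsilon lambda d)); rewrite inE eqxx.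
  by apply: (LB (1 - d / n%:R, - kappa lambda d n)); rewrite !inE eqxx orbT.
have := xa_half (a := aedge s e) X (aedge_le (sval_le p) e) jB.
by rewrite ler_norml => /andP[? ?]; lra.
Qed.

Lemma Zpost_gt0 (G : graph n) : 0 < Z G.
Proof. by apply: (Z_gt0 [ffun=> ord0]); exact: post_pos. Qed.

(** Every channel is centred, so it fixes the linear functional [fun v => v X]. *)
Lemma sum_base_post (X : labeling n) :
  \sum_(G : graph n) base_mass d G * post G X = labeling_mass p X.
Proof.
have <- := ops_graph (@aedge R n s) (d / n%:R) (epsilon lambda d) (kappa lambda d n) (fun v => v X) (@labeling_mass R p n).
have [L0 L1 Lm _] := LK.
have inv (a : labeling n -> R) : op (a, sbm_law lambda d n) (fun v => v X) = fun v => v X.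
  apply/funext => v; rewrite /op /tilt /=.
  have -> : (fun x => v X * (1 + x * a X)) = (fun x => v X + v X * a X * x).
    by apply/funext => x; ring.
  by rewrite ExD ExZ (Ex_cst _ L1) Lm mulr0 addr0.
elim: (index_enum _) => [//|e l IH] /=.
rewrite -/(ops _ _).
have -> : op (aedge s e, sbm_law lambda d n) (ops [seq (aedge s i, two_point_law (d / n%:R) (epsilon lambda d) (kappa lambda d n)) | i <- l] (fun v => v X)) =
   ops [seq (aedge s i, two_point_law (d / n%:R) (epsilon lambda d) (kappa lambda d n)) | i <- l] (fun v => v X).
  by rewrite -ops_op_comm inv.
exact: IH.
Qed.

Lemma sum_labeling_mass : \sum_(X : labeling n) labeling_mass p X = 1 :> R.
Proof.
rewrite /labeling_mass -(bigA_distr_bigA (fun (_ : 'I_n) j => if j == ord0 then p else 1 - p)).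
by apply: big1 => i _; exact: sum_swt.
Qed.

Lemma sum_base_Z : \sum_(G : graph n) base_mass d G * Z G = 1.
Proof.
under eq_bigr do rewrite part_setT mulr_sumr.
rewrite exchange_big/= -sum_labeling_mass; apply: eq_bigr => X _; exact: sum_base_post.
Qed.

Lemma sum_base : \sum_(G : graph n) base_mass d G = 1.
Proof.
rewrite /base_mass -(bigA_distr_bigA (fun (_ : vertex_pair n) b => weight (d / n%:R) b)).
by apply: big1 => e _; rewrite big_bool /weight /=; ring.
Qed.

(* Mean over two independent posterior samples [X] and [x]. *)
Definition rep (f : labeling n -> labeling n -> R) : R :=
  \sum_(G : graph n) base_mass d G * ((\sum_X \sum_x post G X * post G x * f X x) / Z G).

Lemma rep_le f g : (forall X x, f X x <= g X x) -> rep f <= rep g.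
Proof.
move=> fg; apply: ler_sum => G _; rewrite ler_wpM2l ?base_mass_ge0// ler_wpM2r//.
  by rewrite invr_ge0 ltW// Zpost_gt0.
apply: ler_sum => X _; apply: ler_sum => x _; rewrite ler_wpM2l// ltW// mulr_gt0//; exact: post_pos.
Qed.

Lemma repD f g : rep (fun X x => f X x + g X x) = rep f + rep g.
Proof.
rewrite /rep -big_split; apply: eq_bigr => G _ /=; rewrite -mulrDr -mulrDl; congr (_ * (_ / _)).
rewrite -big_split; apply: eq_bigr => X _ /=; rewrite -big_split; apply: eq_bigr => x _ /=.
by rewrite mulrDr.
Qed.

Lemma repZ c f : rep (fun X x => c * f X x) = c * rep f.
Proof.
rewrite /rep mulr_sumr; apply: eq_bigr => G _.
have -> : \sum_X \sum_x post G X * post G x * (c * f X x) = c * \sum_X \sum_x post G X * post G x * f X x.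
  rewrite mulr_sumr; apply: eq_bigr => X _.
  by rewrite mulr_sumr; apply: eq_bigr => x _; rewrite mulrCA.
by rewrite -mulrA mulrCA.
Qed.

Lemma rep_cst c : rep (fun _ _ => c) = c.
Proof.
rewrite /rep -[RHS]mul1r -sum_base_Z mulr_suml; apply: eq_bigr => G _.
rewrite -mulrA; congr (_ * _); have zn : Z G != 0 by rewrite gt_eqF// Zpost_gt0.
have -> : \sum_X \sum_x post G X * post G x * c = Z G * Z G * c.
  rewrite part_setT mulr_suml mulr_suml; apply: eq_bigr => X _.
  by rewrite mulr_sumr mulr_suml.
by field.
Qed.

Lemma rep_sum (I : finType) (f : I -> labeling n -> labeling n -> R) :
  rep (fun X x => \sum_i f i X x) = \sum_i rep (f i).
Proof.
have h (l : seq I) : rep (fun X x => \sum_(i <- l) f i X x) = \sum_(i <- l) rep (f i).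
  elim: l => [|i l IH].
    rewrite big_nil -[RHS](rep_cst 0); congr rep.
    by apply/funext => X; apply/funext => x; rewrite big_nil.
  rewrite big_cons -IH -repD; congr rep.
  by apply/funext => X; apply/funext => x; rewrite big_cons.
exact: h.
Qed.

Lemma rep_ovl_ge0 : 0 <= rep (fun X x => ovl s X x).
Proof.
apply: sumr_ge0 => G _; rewrite mulr_ge0 ?base_mass_ge0// divr_ge0//; last by rewrite ltW// Zpost_gt0.
have -> : \sum_X \sum_x post G X * post G x * ovl s X x =
    \sum_i (\sum_X post G X * s (X i)) ^+ 2.
  rewrite /ovl; under eq_bigr do under eq_bigr do rewrite mulr_sumr.
  under eq_bigr do rewrite exchange_big/=.
  rewrite exchange_big/=; apply: eq_bigr => i _; rewrite expr2 mulr_suml.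
  by apply: eq_bigr => X _; rewrite mulr_sumr; apply: eq_bigr => x _; ring.
by apply: sumr_ge0 => i _; exact: sqr_ge0.
Qed.

Definition set_indic (A : labeling n -> {set labeling n}) (X x : labeling n) : R :=
  if x \in A X then 1 else 0.

(* Splitting according to the size of the likelihood ratio [Z G]. *)
Lemma rep_in_set_le A r t : 0 < r <= 1 ->
  rep (set_indic A) <=
  \sum_(G : graph n) base_mass d G * (if Z G <= t then Z G else 0) +
  \sum_(X : labeling n) \sum_(G : graph n) base_mass d G *
     (if Z G <= t then 0 else Phi (Some X) (A X) r (post G) / Z G `^ r).
Proof.
move=> /andP[r0 r1]; rewrite [X in _ <= _ + X]exchange_big -big_split; apply: ler_sum => G _ /=.
rewrite -mulr_sumr -mulrDr ler_wpM2l ?base_mass_ge0//.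
have Zp := Zpost_gt0 G; have vp := post_pos G.
have e : \sum_X \sum_x post G X * post G x * set_indic A X x = \sum_X post G X * part (A X) (post G).
  apply: eq_bigr => X _; rewrite /part mulr_sumr [RHS]big_mkcond; apply: eq_bigr => x _.
  by rewrite /set_indic; case: ifP => _; rewrite ?mulr1 ?mulr0.
rewrite e mulr_suml.
have [zt|zt] := leP (Z G) t.
  rewrite [X in _ <= _ + X]big1// addr0 [leRHS]part_setT; apply: ler_sum => X _.
  rewrite -mulrA ler_piMr//; first exact: ltW.
  by rewrite ler_pdivrMr// mul1r part_le.
rewrite add0r; apply: ler_sum => X _; rewrite /Phi.
(* A posterior probability lies in [0, 1], so it is at most its own power with exponent [r <= 1]. *)
suff h : part (A X) (post G) / Z G <= part (A X) (post G) `^ r / Z G `^ r.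
  by have := ler_wpM2l (ltW (vp X)) h; rewrite !mulrA.
have p0 := part_ge0 (A X) vp.
have e1 : part (A X) (post G) = part (A X) (post G) / Z G * Z G by rewrite divfK// gt_eqF.
have y0 : 0 <= part (A X) (post G) / Z G by rewrite divr_ge0// ltW.
have y1 : part (A X) (post G) / Z G <= 1 by rewrite ler_pdivrMr// mul1r part_le.
rewrite {2}e1 powRM//; last exact: ltW.
rewrite -mulrA mulfV ?mulr1; last by rewrite gt_eqF// powR_gt0.
have [->|yn] := eqVneq (part (A X) (post G) / Z G) 0; first exact: powR_ge0.
by apply: ger1_powR => //; rewrite y1 andbT lt_neqAle eq_sym yn.
Qed.

End Fixed.
End Replica.

(** * Exponentially unlikely overlaps *)

Section NearOverlap.
Context {R : realType} (p lambda : R).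
Hypotheses (hp : 0 < p < 1) (l0 : 0 < lambda).
Local Notation s := (sval p).
Implicit Types (d eta q del c k : R) (n : nat).
Local Notation post := (post p lambda).
Local Notation rep := (rep p lambda).
Local Notation F q := (free_energy p lambda q).

(** Take the threshold t = e^a for Z. Below it, Z <= t^(1-r) Z^r; above it, Z^(-r') <= t^(-r'). The
    sign of [a] is free, and the two exponents are independent. *)
Lemma rep_in_set_expR eta d n (A : labeling n -> {set labeling n}) (a r r' : R) :
  regime p lambda eta d n -> 0 <= r <= 1 -> 0 < r' <= 1 ->
  rep d (set_indic A) <=
  expR (a * (1 - r)) * (\sum_(G : graph n) base_mass d G * part [set: labeling n] (post d G) `^ r) +
  expR (- (a * r')) * (\sum_(X : labeling n) \sum_(G : graph n)
     base_mass d G * Phi (Some X) (A X) r' (post d G)).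
Proof.
move=> reg /andP[r0 r1] /andP[s0 s1].
have s01 : 0 < r' <= 1 by rewrite s0.
apply: (le_trans (rep_in_set_le hp l0 reg A (expR a) s01)); apply: lerD.
  rewrite mulr_sumr; apply: ler_sum => G _; rewrite mulrCA.
  apply: ler_wpM2l; first exact: (base_mass_ge0 reg).
  have zp := Zpost_gt0 hp l0 reg G; set z := part _ _ in zp *.
  have [zt|zt] := leP z (expR a); last by rewrite mulr_ge0 ?expR_ge0 ?powR_ge0.
  have {1}-> : z = z `^ (1 - r) * z `^ r.
    rewrite -powRD ?subrK ?powRr1//; first exact: ltW.
    by apply/implyP => _; rewrite gt_eqF.
  apply: ler_wpM2r; first exact: powR_ge0.
  rewrite expRM; apply: ge0_ler_powR; rewrite ?nnegrE ?expR_ge0//; last exact: ltW.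
  by rewrite subr_ge0.
rewrite mulr_sumr; apply: ler_sum => X _; rewrite mulr_sumr; apply: ler_sum => G _.
rewrite mulrCA; apply: ler_wpM2l; first exact: (base_mass_ge0 reg).
have zp := Zpost_gt0 hp l0 reg G; set z := part _ _ in zp *.
have P0 : 0 <= Phi (Some X) (A X) r' (post d G) by apply: Phi_ge0; exact: (post_pos hp l0 reg).
have [zt|zt] := leP z (expR a); first by rewrite mulr_ge0 ?expR_ge0.
rewrite mulrC; apply: ler_wpM2r => //.
rewrite expRN lef_pV2 ?posrE ?expR_gt0 ?powR_gt0// expRM.
by apply: ge0_ler_powR; rewrite ?nnegrE ?expR_ge0//; exact: ltW.
Qed.

Lemma free_energy_psi q : psi p lambda q = F q + lambda / 4 * q ^+ 2.
Proof. by []. Qed.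

(** The threshold is exp(- c n / 8) with exponent 0 below it: under the planted law a smaller Z has
    probability at most the threshold. Above it the planted bound has rate at most - r c / 2, which
    outweighs the loss r c / 8. The choice of [r] makes [C * r <= c / 8]. *)
Lemma near_small q c del : 0 <= q -> 0 < c -> 0 <= del -> lambda * (del ^+ 2 / 2) <= c / 8 ->
  F q <= - c -> exists eta k : R, [/\ 0 < eta, 0 < k & forall d n, regime p lambda eta d n ->
    rep d (set_indic (fun X : labeling n => near_overlap p X q del)) <= 2 * expR (- (k * n%:R))].
Proof.
move=> q0 c0 d0 dc Fc; have [C C0 hC] := planted_bound hp l0 q0.
have D0 : 0 < c + 8 * C by lra.
pose r := c / (c + 8 * C).
have r0 : 0 < r by rewrite divr_gt0.
have r1 : r <= 1 by rewrite /r ler_pdivrMr//; lra.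
have Cr : C * r <= c / 8.
  by rewrite /r mulrA ler_pdivrMr//; have := sqr_ge0 c; lra.
have rc : 0 < r * c by rewrite mulr_gt0.
exists (r * c / 24), (r * c / 8); split; [lra|lra|] => d n reg.
have h01 : 0 <= (0 : R) <= 1 by rewrite lexx ler01.
have r01 : 0 < r <= 1 by rewrite r0.
apply: (le_trans (rep_in_set_expR _ (- (c / 8 * n%:R)) reg h01 r01)).
have N0 : 0 <= n%:R :> R by [].
have e1 : expR (- (c / 8 * n%:R) * (1 - 0)) <= expR (- (r * c / 8 * n%:R)).
  rewrite ler_expR; have : 0 <= (1 - r) * c * n%:R by rewrite !mulr_ge0 ?subr_ge0// ltW.
  lra.
have eta0 : 0 < r * c / 24 by lra.
have Cr2 : C * r ^+ 2 <= c / 8 * r by rewrite expr2 mulrA ler_wpM2r// ltW.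
have dr : r * (lambda * (del ^+ 2 / 2)) <= r * (c / 8) by rewrite ler_wpM2l// ltW.
have Fr : r * F q <= r * (- c) by rewrite ler_wpM2l// ltW.
have e3 : expR (- (- (c / 8 * n%:R) * r)) * (\sum_(X : labeling n) \sum_(G : graph n)
     base_mass d G * Phi (Some X) (near_overlap p X q del) r (post d G)) <= expR (- (r * c / 8 * n%:R)).
  apply: (le_trans (ler_wpM2l (expR_ge0 _) (hC _ _ _ d n r01 d0 eta0 reg))).
  rewrite free_energy_psi -expRD ler_expR.
  have h : r * (lambda * (del ^+ 2 / 2 - q ^+ 2 / 4) + (F q + lambda / 4 * q ^+ 2)) +
      C * r ^+ 2 + 3 * (r * c / 24) <= - (r * c / 2) by lra.
  have := ler_wpM2l N0 h; have : 0 <= r * c * n%:R by rewrite mulr_ge0// ltW.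
  lra.
have -> : \sum_(G : graph n) base_mass d G * part [set: labeling n] (post d G) `^ 0 = 1 :> R.
  rewrite -(sum_base d n); apply: eq_bigr => G _.
  by rewrite powRr0 mulr1.
lra.
Qed.

(** The threshold exp(c n / 2) is placed between two rates: after division by r c the free bound
    decays at rate 3/4, and the planted bound at overlap 0 grows at rate at most 3/8, so 1/2 leaves
    a margin of at least 1/8 on both sides. *)
Lemma near_zero_small q c del : 0 <= q -> 0 < c -> 0 <= del -> lambda * (del ^+ 2 / 2) <= c / 8 ->
  c <= F q -> exists eta k : R, [/\ 0 < eta, 0 < k & forall d n, regime p lambda eta d n ->
    rep d (set_indic (fun X : labeling n => near_overlap p X 0 del)) <= 2 * expR (- (k * n%:R))].
Proof.
move=> q0 c0 d0 dc Fc; have [C C0 hC] := free_bound hp l0 q0.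
have [C' C'0 hC'] := planted_bound hp l0 (lexx (0 : R)).
have D0 : 0 < 2 * c + 8 * C + 8 * C' by lra.
pose r := c / (2 * c + 8 * C + 8 * C').
have r0 : 0 < r by rewrite divr_gt0.
have r1 : r <= 1 / 2 by rewrite /r ler_pdivrMr//; lra.
have cc := sqr_ge0 c; have cC : 0 <= c * C by rewrite mulr_ge0// ltW.
have cC' : 0 <= c * C' by rewrite mulr_ge0// ltW.
have Cr : C * r <= c / 8 by rewrite /r mulrA ler_pdivrMr//; lra.
have Cr' : C' * r <= c / 8 by rewrite /r mulrA ler_pdivrMr//; lra.
have rc : 0 < r * c by rewrite mulr_gt0.
have eta0 : 0 < r * c / 24 by lra.
exists (r * c / 24), (r * c / 8); split; [lra|lra|] => d n reg.
have h01 : 0 <= 1 - r <= 1 by lra.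
have r01 : 0 < r <= 1 by lra.
apply: (le_trans (rep_in_set_expR _ (c / 2 * n%:R) reg h01 r01)).
have N0 : 0 <= n%:R :> R by [].
have rcn : 0 <= r * c * n%:R by rewrite mulr_ge0// ltW.
have Cr2 : C * r ^+ 2 <= c / 8 * r by rewrite expr2 mulrA ler_wpM2r// ltW.
have Cr2' : C' * r ^+ 2 <= c / 8 * r by rewrite expr2 mulrA ler_wpM2r// ltW.
have dr : r * (lambda * (del ^+ 2 / 2)) <= r * (c / 8) by rewrite ler_wpM2l// ltW.
have Fr : r * c <= r * F q by rewrite ler_wpM2l// ltW.
have h12 : 1 / 2 <= 1 - r < 1 by lra.
have e3 : expR (c / 2 * n%:R * (1 - (1 - r))) *
  (\sum_(G : graph n) base_mass d G * part [set: labeling n] (post d G) `^ (1 - r)) <= expR (- (r * c / 8 * n%:R)).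
  apply: (le_trans (ler_wpM2l (expR_ge0 _) (hC _ _ d n h12 eta0 reg))).
  rewrite free_energy_psi -expRD ler_expR.
  have lq : 0 <= r ^+ 2 * (lambda * (q ^+ 2 / 4)).
    by rewrite mulr_ge0 ?sqr_ge0// mulr_ge0 ?divr_ge0 ?sqr_ge0// ltW.
  have h : (1 - r) * (1 - (1 - r)) * (lambda * (q ^+ 2 / 4)) - (1 - (1 - r)) * (F q + lambda / 4 * q ^+ 2) +
      C * (1 - (1 - r)) ^+ 2 + 3 * (r * c / 24) <= - (3 / 4 * (r * c)).
    have -> : 1 - (1 - r) = r by ring.
    lra.
  have hn := ler_wpM2l N0 h; clear h Fr dr Cr2 Cr2' Cr Cr' Fc dc; lra.
have e4 : expR (- (c / 2 * n%:R * r)) * (\sum_(X : labeling n) \sum_(G : graph n)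
     base_mass d G * Phi (Some X) (near_overlap p X 0 del) r (post d G)) <= expR (- (r * c / 8 * n%:R)).
  apply: (le_trans (ler_wpM2l (expR_ge0 _) (hC' _ _ _ d n r01 d0 eta0 reg))).
  rewrite (psi0 hp) -expRD ler_expR; clear e3.
  have h : r * (lambda * (del ^+ 2 / 2 - 0 ^+ 2 / 4) + 0) + C' * r ^+ 2 + 3 * (r * c / 24) <= 3 / 8 * (r * c).
    lra.
  have hn := ler_wpM2l N0 h; clear h Fr dr Cr2 Cr2' Cr Cr' Fc dc; lra.
lra.
Qed.

End NearOverlap.

Section ReplicaOverlap.
Context {R : realType} (p lambda : R).
Hypotheses (hp : 0 < p < 1) (l0 : 0 < lambda).
Local Notation s := (sval p).
Local Notation B := (sbound p ^+ 2).
Implicit Types (d eta q del c k : R) (n : nat).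
Local Notation rep := (rep p lambda).
Local Notation F q := (free_energy p lambda q).
Local Notation absovl n := (fun X x : labeling n => `|ovl s X x| / n%:R).

(** The nesting of the two lower limits in [solvable_sbm]: [n] is large depending on [d]. *)
Definition eventually_dn (P : R -> nat -> Prop) : Prop :=
  exists d0 : R, forall d, d0 <= d -> exists n0 : R, forall n, n0 <= n%:R -> P d n.

Lemma eventually_regime eta k eps (P : R -> nat -> Prop) : 0 < eta -> 0 < k -> 0 < eps ->
  (forall d n, regime p lambda eta d n -> expR (- (k * n%:R)) <= eps -> P d n) ->
  eventually_dn P.
Proof.
move=> eta0 k0 eps0 H; have [d0 h0] := regime_eventually p l0 eta0.
exists d0 => d /h0[n0 hn]; exists (`|n0| + (eps * k)^-1) => n nn.
have ek : 0 < (eps * k)^-1 by rewrite invr_gt0 mulr_gt0.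
have ln := ler_norm n0; have nn0 := normr_ge0 n0.
apply: H; first by apply: hn; lra.
have nk : (eps * k)^-1 <= n%:R by lra.
have kn : eps^-1 <= k * n%:R.
  have := ler_wpM2l (ltW k0) nk; rewrite invfM mulrCA mulfV ?mulr1//; exact: lt0r_neq0.
rewrite expRN -[leRHS]invrK lef_pV2 ?posrE ?expR_gt0 ?invr_gt0//.
have := expR_ge1Dx (k * n%:R); lra.
Qed.

Lemma small_window c : 0 < c -> exists2 del : R, 0 < del & lambda * (del ^+ 2 / 2) <= c / 8.
Proof.
move=> c0; have lp := l0; have D0 : 0 < c + 4 * lambda by lra.
exists (c / (c + 4 * lambda)); first exact: divr_gt0.
set u := c / _; have u0 : 0 <= u by rewrite divr_ge0// ltW.
have u1 : u <= 1 by rewrite /u ler_pdivrMr//; lra.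
have lu : lambda * u <= c / 4.
  rewrite /u mulrA ler_pdivrMr//; have := sqr_ge0 c; lra.
have : lambda * u * u <= lambda * u.
  by rewrite ler_piMr// mulr_ge0// ltW.
lra.
Qed.

Lemma ovl_le n (X x : labeling n) : `|ovl s X x| <= n%:R * B.
Proof.
apply: (le_trans (ler_norm_sum _ _ _)).
rewrite -[n in n%:R]card_ord -sum1_card natr_sum mulr_suml; apply: ler_sum => i _.
by rewrite mul1r normrM expr2 ler_pM ?sval_le.
Qed.

Lemma overlap_detected q : 0 <= q -> 0 < F q -> exists2 c : R, 0 < c &
  eventually_dn (fun d n => (exists eta, regime p lambda eta d n) /\ c <= rep d (absovl n)).
Proof.
move=> q0 F0; have [del del0 hdel] := small_window F0.
have [eta [k [eta0 k0 h]]] := near_zero_small hp l0 q0 F0 (ltW del0) hdel (lexx _).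
exists (del / 2); first by rewrite divr_gt0.
apply: (eventually_regime (eps := 1 / 4) eta0 k0) => [|d n reg e4]; first by lra.
split; first by exists eta.
have [_ n0 _ _ _] := reg; have N0 : 0 < n%:R :> R by rewrite ltr0n.
apply: (@le_trans _ _ (rep d (fun X x => del + (- del) * set_indic (fun X : labeling n => near_overlap p X 0 del) X x))).
  rewrite (repD p lambda d) (rep_cst hp l0 reg) repZ.
  have := h d n reg; set y := rep _ _ => hy.
  have y2 : y <= 1 / 2 by lra.
  have := ler_wpM2l (ltW del0) y2; lra.
apply: (rep_le hp l0 reg) => X x; rewrite /set_indic inE mulr0 subr0.
have y0 : 0 <= `|ovl s X x| / n%:R by rewrite divr_ge0// ltW.
have [le|lt] := leP `|ovl s X x| (n%:R * del); first by rewrite mulr1 subrr.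
by rewrite mulr0 addr0 ler_pdivlMr// mulrC ltW.
Qed.

Lemma regime_le eta eta' d n : eta <= eta' -> regime p lambda eta d n -> regime p lambda eta' d n.
Proof.
move=> le [d0 n0 mu Be [sm er]]; split=> //; split=> //.
by apply: (le_trans er); rewrite ler_wpM2r.
Qed.

Lemma near_small_family (qs : nat -> R) c del J : 0 < c -> 0 <= del ->
  lambda * (del ^+ 2 / 2) <= c / 8 -> (forall j, 0 <= qs j /\ F (qs j) <= - c) ->
  exists eta k : R, [/\ 0 < eta, 0 < k & forall d n, regime p lambda eta d n ->
    forall j : 'I_J, rep d (set_indic (fun X : labeling n => near_overlap p X (qs j) del)) <=
      2 * expR (- (k * n%:R))].
Proof.
move=> c0 d0 dc hq; elim: J => [|J [eta [k [eta0 k0 IH]]]].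
  by exists 1, 1; split => // d n _ [].
have [q0 Fq] := hq J; have [eta' [k' [eta'0 k'0 h]]] := near_small hp l0 q0 c0 d0 dc Fq.
exists (Num.min eta eta'), (Num.min k k'); split; rewrite ?lt_min ?eta0 ?k0//.
move=> d n reg j; have N0 : 0 <= n%:R :> R by [].
have m1 : expR (- (k * n%:R)) <= expR (- (Num.min k k' * n%:R)).
  by rewrite ler_expR lerN2 ler_wpM2r// ge_min lexx.
have m2 : expR (- (k' * n%:R)) <= expR (- (Num.min k k' * n%:R)).
  by rewrite ler_expR lerN2 ler_wpM2r// ge_min lexx orbT.
have [jJ|jJ] := ltnP j J.
  have reg1 : regime p lambda eta d n by apply: regime_le reg; rewrite ge_min lexx.
  have := IH d n reg1 (Ordinal jJ); rewrite /=; lra.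
have -> : j = J :> nat by apply/eqP; rewrite eqn_leq jJ -ltnS ltn_ord.
have reg2 : regime p lambda eta' d n by apply: regime_le reg; rewrite ge_min lexx orbT.
have := h d n reg2; lra.
Qed.

(** Either [y <= q0], or [y] lies in one of the windows covering the range above [q0], and then [b]
    bounds it. *)
Lemma pos_part_grid (b y q0 del : R) (N : nat) : 0 <= b -> 0 <= q0 -> y <= b -> y <= q0 + N%:R * del ->
  (y + `|y|) / 2 <= q0 + b * \sum_(j < N) (if `|y - (q0 + j%:R * del)| <= del then 1 else 0).
Proof.
move=> b0 q00 yb; elim: N => [|N IH] yN.
  rewrite big_ord0 mulr0 addr0; have [h|h] := leP 0 y.
    by rewrite ger0_norm//; lra.
  by rewrite ltr0_norm//; lra.
rewrite big_ord_recr/=; set S := \sum_(j < N) _ in IH *.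
have S0 : 0 <= S by apply: sumr_ge0 => j _; case: ifP.
have bS : 0 <= b * S by rewrite mulr_ge0.
have [h|h] := leP y (q0 + N%:R * del).
  apply: (le_trans (IH h)); rewrite lerD2l ler_wpM2l// lerDl; by case: ifP.
rewrite ifT; last first.
  rewrite ger0_norm; last by lra.
  by move: yN; rewrite -natr1 mulrDl mul1r; lra.
have [h'|h'] := leP 0 y.
  by rewrite ger0_norm//; lra.
by rewrite ltr0_norm//; lra.
Qed.

(** Since |y| is twice the positive part minus y, and y has nonnegative mean, negative overlaps need
    no estimate of their own. On the grid all points are at least [q0], so a single gap
    [c * q0 ^+ 2] serves them all; [q0] and [eps] each cost at most theta / 2. *)
Lemma overlap_vanishes c : 0 < c -> (forall q, 0 <= q -> F q <= - (c * q ^+ 2)) ->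
  forall theta, 0 < theta ->
  eventually_dn (fun d n => (exists eta, regime p lambda eta d n) /\ rep d (absovl n) <= theta).
Proof.
move=> c0 hF theta th0; pose q0 := theta / 4.
have q00 : 0 < q0 by rewrite divr_gt0.
have c'0 : 0 < c * q0 ^+ 2 by rewrite mulr_gt0// exprn_gt0.
have [del del0 hdel] := small_window c'0.
have B0 : 0 <= B by exact: sqr_ge0.
have [N N0 hN] := exists_nat_ge (B / del).
have NB : B <= q0 + N%:R * del by move: hN; rewrite ler_pdivrMr//; lra.
pose qs j := q0 + j%:R * del.
have hqs j : 0 <= qs j /\ F (qs j) <= - (c * q0 ^+ 2).
  have jd : 0 <= j%:R * del by rewrite mulr_ge0// ltW.
  have qj : 0 <= qs j by rewrite /qs; lra.
  split=> //; apply: (le_trans (hF _ qj)); rewrite lerN2 ler_wpM2l//; first exact: ltW.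
  by rewrite lerXn2r ?nnegrE ?(ltW q00)// /qs lerDl.
have [eta [k [eta0 k0 H]]] := near_small_family N c'0 (ltW del0) hdel hqs.
have BN : 0 <= B * N%:R by rewrite mulr_ge0.
pose eps := theta / (8 * (B * N%:R + 1)).
have eps0 : 0 < eps by rewrite divr_gt0//; lra.
apply: (eventually_regime (eps := eps) eta0 k0 eps0) => d n reg e4.
split; first by exists eta.
have [_ n0 _ _ _] := reg; have n00 : 0 < n%:R :> R by rewrite ltr0n.
pose I (j : 'I_N) := set_indic (R := R) (fun X : labeling n => near_overlap p X (qs j) del).
apply: (@le_trans _ _ (rep d (fun X x => 2 * q0 + 2 * B * (\sum_j I j X x) + (- n%:R^-1) * ovl s X x))).
  apply: (rep_le hp l0 reg) => X x; have ob := ovl_le X x.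
  pose y := ovl s X x / n%:R.
  have yb : y <= B by rewrite /y ler_pdivrMr// mulrC; apply: le_trans ob; exact: ler_norm.
  have ya : `|ovl s X x| / n%:R = `|y|.
    by rewrite /y normrM [X in _ = _ * X]ger0_norm// invr_ge0 ltW.
  have := pos_part_grid B0 (ltW q00) yb (le_trans yb NB).
  have -> : \sum_(j < N) (if `|y - (q0 + j%:R * del)| <= del then 1 else 0) = \sum_j I j X x.
    apply: eq_bigr => j _; rewrite /I /set_indic inE.
    have -> : (`|ovl s X x - n%:R * qs j| <= n%:R * del) = (`|y - (q0 + j%:R * del)| <= del) :> bool.
      have -> : ovl s X x - n%:R * qs j = n%:R * (y - (q0 + j%:R * del)).
        by rewrite /y /qs mulrBr mulrCA mulfV ?mulr1// gt_eqF.
      by rewrite normrM [X in X * _]ger0_norm// ler_pM2l.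
    by [].
  rewrite ya [- _ * _]mulrC -/y mulrN; rewrite -/y; lra.
rewrite !repD (rep_cst hp l0 reg) !repZ (rep_sum hp l0 reg).
have o0 : 0 <= n%:R^-1 * rep d (fun X x : labeling n => ovl s X x).
  by rewrite mulr_ge0 ?invr_ge0//; exact: (rep_ovl_ge0 hp l0 reg).
have s1 : \sum_j rep d (I j) <= N%:R * (2 * eps).
  rewrite -[N in N%:R]card_ord -sum1_card natr_sum mulr_suml; apply: ler_sum => j _.
  rewrite mul1r; apply: (le_trans (H d n reg j)); lra.
have s2 := ler_wpM2l B0 s1.
have e5 : (B * N%:R + 1) * eps = theta / 8.
  by rewrite /eps; field; rewrite gt_eqF//; lra.
move: s2 o0 e5; rewrite /q0; lra.
Qed.

End ReplicaOverlap.

(** * Estimators *)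

Section OverlapFormula.
Context {R : realType} (p : R).
Hypothesis hp : 0 < p < 1.
Local Notation s := (sval p).
Local Notation K := (sbound p).

Definition sgap : R := s ord0 - s ord_max.

Lemma sgap_gt0 : 0 < sgap.
Proof.
have /andP[p0 p1] := hp; rewrite /sgap /sval /P0_atom/= opprK addr_gt0// sqrtr_gt0 divr_gt0//; lra.
Qed.

Lemma sum_swt_sval : \sum_i swt p i * s i = 0.
Proof.
have /andP[p0 p1] := hp; have q0 : 0 < 1 - p by lra.
rewrite sum_I2 /swt /sval /P0_atom/=.
have sp : Num.sqrt p != 0 by rewrite gt_eqF// sqrtr_gt0.
have sq : Num.sqrt (1 - p) != 0 by rewrite gt_eqF// sqrtr_gt0.
rewrite !sqrtrM ?(ltW p0) ?(ltW q0)// !sqrtrV ?(ltW p0) ?(ltW q0)//.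
have e1 : p / Num.sqrt p = Num.sqrt p by rewrite -[X in X / _](sqr_sqrtr (ltW p0)) expr2 mulfK.
have e2 : (1 - p) / Num.sqrt (1 - p) = Num.sqrt (1 - p).
  by rewrite -[X in X / _](sqr_sqrtr (ltW q0)) expr2 mulfK.
have -> : forall a b : R, p * (b / a) + (1 - p) * - (a / b) = p / a * b - (1 - p) / b * a by move=> a b; ring.
by rewrite e1 e2 mulrC subrr.
Qed.

Definition label_sign (i : 'I_2) : R := if i == ord0 then 1 else - 1.
Definition label_shift (i : 'I_2) : R := if i == ord0 then - s ord_max / sgap else s ord0 / sgap.

(** With two labels every indicator is affine in the standardized label; this turns the counts in
    the overlap into sums of [sval]. *)
Lemma labelE (a i : 'I_2) : (a == i)%:R = label_shift i + label_sign i / sgap * s a.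
Proof.
have g0 := lt0r_neq0 sgap_gt0; rewrite /label_shift /label_sign.
have h (j : 'I_2) : j = ord0 \/ j = ord_max.
  by case: j => [[|[|//]] jj]; [left|right]; apply: val_inj.
rewrite /sgap in g0 *.
by case: (h a) => ->; case: (h i) => -> /=; field.
Qed.

Definition label_sum n (X : labeling n) : R := \sum_i s (X i).

Lemma card_sumr n (A : {set 'I_n}) : #|A|%:R = \sum_k (k \in A)%:R :> R.
Proof. by rewrite -sum1_card natr_sum [LHS]big_mkcond; apply: eq_bigr => k _; case: ifP. Qed.

Lemma sum_affine n (a b : R) (S : 'I_n -> R) :
  \sum_k (a + b * S k) = n%:R * a + b * \sum_k S k.
Proof. by rewrite big_split/= -mulr_sumr sumr_const card_ord mulr_natl. Qed.

Lemma overlap_sumE n (x y : labeling n) (g : 'S_2) : (0 < n)%N ->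
  overlap_sum x y g = (\sum_i label_sign i * label_sign (g i)) / sgap ^+ 2 *
    (ovl s x y - label_sum x * label_sum y / n%:R).
Proof.
move=> n0; have g0 := lt0r_neq0 sgap_gt0.
have nn : n%:R != 0 :> R by rewrite pnatr_eq0 -lt0n.
set c := ovl _ _ _ - _; rewrite /overlap_sum !mulr_suml; apply: eq_bigr => i _.
have cE (x' : labeling n) j : #|community j x'|%:R = n%:R * label_shift j + label_sign j / sgap * label_sum x'.
  by rewrite card_sumr -sum_affine; apply: eq_bigr => k _; rewrite inE labelE.
rewrite !cE card_sumr.
have -> : \sum_k (k \in community i x :&: community (g i) y)%:R =
   n%:R * (label_shift i * label_shift (g i)) +
   label_shift i * (label_sign (g i) / sgap) * label_sum y +
   label_shift (g i) * (label_sign i / sgap) * label_sum x +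
   label_sign i / sgap * (label_sign (g i) / sgap) * ovl s x y.
  have -> u : n%:R * u = \sum_(k < n) u by rewrite sumr_const card_ord mulr_natl.
  rewrite /label_sum /ovl !mulr_sumr.
  rewrite -!big_split/=; apply: eq_bigr => k _.
  by rewrite !inE -mulnb natrM !labelE; ring.
by rewrite /c; field; rewrite nn g0.
Qed.

(** The identity and the transposition give opposite values of the sum, so the maximum over
    permutations is an absolute value. *)
Lemma overlapE n (x y : labeling n) : (0 < n)%N ->
  overlap x y = 2 / sgap ^+ 2 * (`|ovl s x y - label_sum x * label_sum y / n%:R| / n%:R) :> R.
Proof.
move=> n0; have g2 : 0 < sgap ^+ 2 by rewrite exprn_gt0// sgap_gt0.
pose c := ovl s x y - label_sum x * label_sum y / n%:R.
have ls i : `|label_sign i| = 1 by rewrite /label_sign; case: ifP; rewrite ?normrN normr1.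
rewrite /overlap -/c mulrA mulrC; congr (_ / _); apply/eqP; rewrite eq_le; apply/andP; split.
  have ub (g : {perm 'I_2}) : overlap_sum x y g <= 2 / sgap ^+ 2 * `|c|.
    rewrite overlap_sumE// -/c; apply: (le_trans (ler_norm _)); rewrite normrM.
    apply: ler_wpM2r => //; rewrite normrM [X in _ * X]ger0_norm ?invr_ge0 ?(ltW g2)//.
    apply: ler_wpM2r; first by rewrite invr_ge0 ltW.
    apply: (le_trans (ler_norm_sum _ _ _)); rewrite sum_I2 !normrM !ls; lra.
  by apply: bigmax_le => // g _.
have le1 g : overlap_sum x y g <= (\big[Num.max/overlap_sum x y 1%g]_(g : 'S_2) overlap_sum x y g : R).
  exact: le_bigmax.
have [c0|c0] := leP 0 c.
  apply: (le_trans _ (le1 1%g)); rewrite overlap_sumE// -/c ger0_norm//.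
  by rewrite sum_I2 !perm1 /label_sign/= mulr1 mulrNN mulr1.
apply: (le_trans _ (le1 (tperm ord0 ord_max))); rewrite overlap_sumE// -/c ltr0_norm//.
rewrite sum_I2 tpermL tpermR /label_sign/= mul1r mulr1; lra.
Qed.

Lemma label_sum_le n (X : labeling n) : `|label_sum X| <= n%:R * K.
Proof.
apply: (le_trans (ler_norm_sum _ _ _)).
rewrite -[n in n%:R]card_ord -sum1_card natr_sum mulr_suml; apply: ler_sum => i _.
by rewrite mul1r sval_le.
Qed.

(** The standardized labels are independent and centred, so only the diagonal terms survive. Hence
    the centring term in [overlapE] is of order n^(-1/2). *)
Lemma label_sum_sqr n : \sum_(X : labeling n) labeling_mass p X * label_sum X ^+ 2 <= n%:R * K ^+ 2.
Proof.
have e (k l : 'I_n) : \sum_(X : labeling n) labeling_mass p X * (s (X k) * s (X l)) <= (k == l)%:R * K ^+ 2.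
  have -> : \sum_(X : labeling n) labeling_mass p X * (s (X k) * s (X l)) =
      \prod_(i < n) \sum_j (swt p j * ((if i == k then s j else 1) * (if i == l then s j else 1))).
    rewrite (bigA_distr_bigA (fun i j => swt p j * ((if i == k then s j else 1) * (if i == l then s j else 1)))).
    apply: eq_bigr => X _; rewrite !big_split/=; congr (_ * _); rewrite -!big_mkcond.
    by rewrite !big_pred1_eq.
  rewrite (bigD1 k)//= eqxx; have [<-|kl] := eqVneq k l.
    rewrite mul1r [X in _ * X]big1 ?mulr1 => [|i ik]; last first.
      rewrite (negbTE ik) -[RHS](sum_swt p); apply: eq_bigr => j _; by rewrite !mulr1.
    rewrite -[leRHS]mul1r -(sum_swt p) mulr_suml; apply: ler_sum => j _.
    apply: ler_wpM2l; first exact/ltW/swt_pos.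
    by rewrite -expr2 -real_normK ?num_real// lerXn2r ?nnegrE ?sval_le//; apply: le_trans (sbound_ge1 p).
  have -> : \sum_j (swt p j * (s j * 1)) = 0.
    by rewrite -[RHS]sum_swt_sval; apply: eq_bigr => j _; rewrite mulr1.
  by rewrite !mul0r.
have -> : \sum_(X : labeling n) labeling_mass p X * label_sum X ^+ 2 =
    \sum_k \sum_l \sum_(X : labeling n) labeling_mass p X * (s (X k) * s (X l)).
  under [RHS]eq_bigr do rewrite exchange_big/=.
  rewrite [RHS]exchange_big/=; apply: eq_bigr => X _.
  rewrite expr2 /label_sum mulr_suml mulr_sumr; apply: eq_bigr => k _.
  by rewrite !mulr_sumr.
rewrite -[n in n%:R]card_ord -sum1_card natr_sum mulr_suml; apply: ler_sum => k _.
rewrite mul1r; apply: (le_trans (ler_sum _ (fun l _ => e k l))).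
rewrite (bigD1 k)//= eqxx mul1r big1 ?addr0// => l lk.
by rewrite eq_sym (negbTE lk) mul0r.
Qed.

End OverlapFormula.

Section LimfEinf.
Context {T : choiceType} {X : filteredType T} {R : realType}.
Implicit Types (f : X -> \bar R) (F : set_system X).
Local Open Scope ereal_scope.

Lemma limf_einf_ge f F (V : set X) c : F V -> (forall x, V x -> c <= f x) -> c <= limf_einf f F.
Proof.
move=> FV h; rewrite limf_einfE; apply: le_ereal_sup_tmp.
exists (ereal_inf (f @` V)); first by exists V.
by apply: le_ereal_inf_tmp => _ [x Vx <-]; exact: h.
Qed.

Lemma limf_einf_le f F (V : set X) c : ProperFilter F -> F V -> (forall x, V x -> f x <= c) ->
  limf_einf f F <= c.
Proof.
move=> FF FV h; rewrite limf_einfE; apply: ge_ereal_sup => _ [W FW <-].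
have [x [Wx Vx]] := filter_ex (filterI FW FV).
by apply: le_trans (h x Vx); apply: ereal_inf_lbound; exists x.
Qed.

End LimfEinf.

Section IteratedEinf.
Context {R : realType}.
Implicit Types (f : R -> nat -> \bar R) (c : \bar R).

Lemma pinfty_nbhs_ge (d0 : R) : pinfty_nbhs R [set d | d0 <= d].
Proof. by exists d0; split; [exact: num_real|move=> x /ltW]. Qed.

Lemma einf_einf_ge f c : eventually_dn (fun d n => (c <= f d n)%E) ->
  (c <= limf_einf (fun d : R => limn_einf (fun n : nat => f d n)) (pinfty_nbhs R))%E.
Proof.
move=> [d0 h]; apply: limf_einf_ge (pinfty_nbhs_ge d0) _ => d /h[n0 hn].
exact: (limf_einf_ge (nbhs_infty_ger n0)).
Qed.

Lemma einf_einf_le f c : eventually_dn (fun d n => (f d n <= c)%E) ->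
  (limf_einf (fun d : R => limn_einf (fun n : nat => f d n)) (pinfty_nbhs R) <= c)%E.
Proof.
move=> [d0 h]; apply: limf_einf_le (pinfty_nbhs_ge d0) _ => d /h[n0 hn].
exact: (limf_einf_le _ (nbhs_infty_ger n0)).
Qed.

Lemma eventually_dn_and (P Q : R -> nat -> Prop) : eventually_dn P -> eventually_dn Q ->
  eventually_dn (fun d n => P d n /\ Q d n).
Proof.
move=> [d0 h] [d1 h']; exists (Num.max d0 d1) => d; rewrite ge_max => /andP[/h[n0 hn] /h'[n1 hn']].
by exists (Num.max n0 n1) => n; rewrite ge_max => /andP[/hn ? /hn' ?].
Qed.

Lemma eventually_dn_imp (P Q : R -> nat -> Prop) : (forall d n, P d n -> Q d n) ->
  eventually_dn P -> eventually_dn Q.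
Proof. by move=> PQ [d0 h]; exists d0 => d /h[n0 hn]; exists n0 => n /hn /PQ. Qed.

Lemma eventually_dn_ge (x : R) : eventually_dn (fun (_ : R) n => x <= n%:R).
Proof. by exists 0 => d _; exists x. Qed.

End IteratedEinf.

Section SeedExpectation.
Context {R : realType} (n : nat) (est : estimator R n) (G : graph n).

Definition est_prob (x : labeling n) : R := fine (seed_law est [set u | @estimate R n est G u = x]).

Lemma est_prob_ge0 x : 0 <= est_prob x.
Proof. exact: fine_ge0. Qed.

Lemma expectation_est (f : labeling n -> R) : (forall x, 0 <= f x) ->
  ('E_(seed_law est)[fun u => f (@estimate R n est G u)] = (\sum_x est_prob x * f x)%:E)%E.
Proof.
move=> f0; rewrite unlock.
pose A x := [set u | @estimate R n est G u = x].
have mA x : measurable (A x) by exact: measurable_estimate.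
have fE u : (f (@estimate R n est G u))%:E = (\sum_x (f x)%:E * (\1_(A x) u)%:E)%E.
  rewrite (bigD1 (@estimate R n est G u))//= big1 => [|x xu].
    by rewrite indicE mem_set// mule1 adde0.
  by rewrite indicE memNset ?mule0// => /esym/eqP; apply/negP.
under eq_integral do rewrite fE.
rewrite ge0_integral_sum//.
- rewrite -sumEFin; apply: eq_bigr => x _.
  rewrite ge0_integralZl_EFin//; last first.
    by apply/measurable_EFinP; exact: measurable_indic.
  rewrite integral_indic// setIT EFinM muleC /est_prob fineK//.
  by apply: fin_num_measure; exact: mA.
- move=> x; apply: measurable_funeM; apply/measurable_EFinP; exact: measurable_indic.
- by move=> x u _; rewrite -EFinM lee_fin mulr_ge0.
Qed.

Lemma sum_est_prob : \sum_x est_prob x = 1.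
Proof.
have [-> //] : (\sum_x est_prob x)%:E = 1%:E :> \bar R.
rewrite -(expectation_cst (seed_law est) 1) (expectation_est (f := fun=> 1))//.
by congr (_%:E); apply: eq_bigr => x _; rewrite mulr1.
Qed.

End SeedExpectation.

(** * Overlap of an estimator in terms of posterior samples *)

Section Estimation.
Context {R : realType} (p lambda : R).
Hypotheses (hp : 0 < p < 1) (l0 : 0 < lambda).
Local Notation s := (sval p).
Local Notation K := (sbound p).
Local Notation g := (sgap p).
Local Notation rep := (rep p lambda).
Local Notation post := (post p lambda).
Local Notation M := (label_sum p).
Local Notation F q := (free_energy p lambda q).
Local Notation absovl n := (fun X x : labeling n => `|ovl s X x| / n%:R).
Implicit Types (d eta theta : R) (n : nat).

Let K1 : 1 <= K. Proof. exact: sbound_ge1. Qed.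
Let K0 : 0 < K. Proof. by apply: lt_le_trans K1. Qed.

(** The arithmetic-geometric inequality with free parameter [t] stands in for Cauchy-Schwarz and
    keeps every bound linear in the averages. *)
Lemma norm_le_sqr (t a : R) : 0 < t -> `|a| <= t / 2 + a ^+ 2 / (2 * t).
Proof.
move=> t0; rewrite -[a ^+ 2]real_normK ?num_real//; set b := `|a|.
have : 0 <= (b - t) ^+ 2 / (2 * t) by rewrite divr_ge0 ?sqr_ge0// mulr_ge0// ltW.
have -> : (b - t) ^+ 2 / (2 * t) = b ^+ 2 / (2 * t) + t / 2 - b by field; rewrite gt_eqF.
lra.
Qed.

Lemma ovlC n (X x : labeling n) : ovl s X x = ovl s x X.
Proof. by apply: eq_bigr => i _; rewrite mulrC. Qed.

Section Moments.
Context {n : nat}.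
Implicit Types (v : labeling n -> R) (x X : labeling n).

Lemma sum_ovl_sqr v : \sum_X \sum_x v X * v x * ovl s X x ^+ 2 =
  \sum_k \sum_l (\sum_X v X * (s (X k) * s (X l))) ^+ 2.
Proof.
under [RHS]eq_bigr do under eq_bigr do rewrite expr2 mulr_suml.
under [RHS]eq_bigr do rewrite exchange_big/=.
rewrite [RHS]exchange_big/=; apply: eq_bigr => X _.
under [RHS]eq_bigr do under eq_bigr do rewrite mulr_sumr.
under [RHS]eq_bigr do rewrite exchange_big/=.
rewrite [RHS]exchange_big/=; apply: eq_bigr => x _.
rewrite expr2 /ovl mulr_suml mulr_sumr; apply: eq_bigr => k _.
by rewrite mulr_sumr mulr_sumr; apply: eq_bigr => l _; ring.
Qed.

(** The left side is linear in the pair correlations [m k l], with coefficients bounded by [K ^+ 2]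
    whatever [x] is, and by [sum_ovl_sqr] the sum of their squares is the two-replica second moment.
    Hence a bound valid for every estimate [x]. *)
Lemma second_moment_le v x theta : 0 < theta -> 0 < \sum_X v X ->
  \sum_X v X * ovl s x X ^+ 2 <=
  K ^+ 2 * (n%:R ^+ 2 * (theta * (\sum_X v X) / 2) +
     (\sum_X \sum_x v X * v x * ovl s X x ^+ 2) / (2 * (theta * \sum_X v X))).
Proof.
move=> t0 Z0; set Z := \sum_X v X in Z0 *; have tZ : 0 < theta * Z by rewrite mulr_gt0.
pose m k l := \sum_X v X * (s (X k) * s (X l)).
have -> : \sum_X v X * ovl s x X ^+ 2 = \sum_k \sum_l s (x k) * s (x l) * m k l.
  under [RHS]eq_bigr do under eq_bigr do rewrite mulr_sumr.
  under [RHS]eq_bigr do rewrite exchange_big/=.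
  rewrite [RHS]exchange_big/=; apply: eq_bigr => X _.
  rewrite expr2 /ovl mulr_suml mulr_sumr; apply: eq_bigr => k _.
  by rewrite mulr_sumr mulr_sumr; apply: eq_bigr => l _; ring.
have h k l : s (x k) * s (x l) * m k l <= K ^+ 2 * (theta * Z / 2 + m k l ^+ 2 / (2 * (theta * Z))).
  apply: (le_trans (ler_norm _)); rewrite !normrM; apply: ler_pM => //; last exact: norm_le_sqr.
  by rewrite expr2 ler_pM ?sval_le.
apply: (le_trans (ler_sum _ (fun k _ => ler_sum _ (fun l _ => h k l)))).
under eq_bigr do rewrite -mulr_sumr.
rewrite -mulr_sumr ler_wpM2l ?sqr_ge0//.
under eq_bigr do rewrite big_split/=.
rewrite big_split/= sum_ovl_sqr; apply: lerD; last first.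
  by rewrite mulr_suml; apply: ler_sum => k _; rewrite mulr_suml.
under eq_bigr do rewrite sumr_const card_ord.
rewrite sumr_const card_ord -mulrnA -[leLHS]mulr_natl natrM expr2; lra.
Qed.

Lemma overlap_upper x X : (0 < n)%N ->
  overlap x X <= 2 / g ^+ 2 * (`|ovl s x X| / n%:R + K * (`|M X| / n%:R)).
Proof.
move=> n0; have N0 : 0 < n%:R :> R by rewrite ltr0n.
have g2 : 0 < g ^+ 2 by rewrite exprn_gt0// sgap_gt0.
rewrite (overlapE hp)// ler_wpM2l//; first by rewrite divr_ge0// ltW.
rewrite mulrA -mulrDl ler_wpM2r ?invr_ge0 ?(ltW N0)//.
apply: (le_trans (ler_normB _ _)); rewrite lerD2l !normrM [X in _ * X]ger0_norm ?invr_ge0 ?(ltW N0)//.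
rewrite ler_pdivrMr// mulrAC ler_wpM2r// mulrC; exact: label_sum_le.
Qed.

Lemma overlap_lower x X : (0 < n)%N ->
  2 / g ^+ 2 * (`|ovl s X x| / n%:R - K * (`|M X| / n%:R)) <= overlap x X.
Proof.
move=> n0; have N0 : 0 < n%:R :> R by rewrite ltr0n.
have g2 : 0 < g ^+ 2 by rewrite exprn_gt0// sgap_gt0.
rewrite (overlapE hp)// ovlC ler_wpM2l//; first by rewrite divr_ge0// ltW.
rewrite mulrA -mulrBl ler_wpM2r ?invr_ge0 ?(ltW N0)//.
apply: le_trans (lerB_dist _ _); rewrite lerB// !normrM [X in _ * X]ger0_norm ?invr_ge0 ?(ltW N0)//.
rewrite ler_pdivrMr// mulrAC ler_wpM2r// mulrC; exact: label_sum_le.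
Qed.

Lemma overlap_ge0 x X : (0 < n)%N -> 0 <= overlap x X :> R.
Proof.
move=> n0; rewrite (overlapE hp)//.
by rewrite mulr_ge0 ?divr_ge0// sqr_ge0.
Qed.

End Moments.

Section Fixed.
Variables (eta d : R) (n : nat).
Hypothesis reg : regime p lambda eta d n.

Lemma regime_n_gt0 : (0 < n)%N.
Proof. by have [] := reg. Qed.

Lemma regime_massE (X : labeling n) (G : graph n) :
  sbm_mass p lambda d X G = base_mass d G * post d G X.
Proof.
have [d0 n0 mu2 _ _] := reg; apply: (sbm_massE lambda hp); exact: mu_neq1.
Qed.

Lemma rep_fst (f : labeling n -> R) : rep d (fun X x : labeling n => f X) = \sum_X labeling_mass p X * f X.
Proof.
rewrite /rep; under [RHS]eq_bigr do rewrite -(sum_base_post l0 reg) mulr_suml.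
rewrite [RHS]exchange_big/=; apply: eq_bigr => G _.
have z0 := lt0r_neq0 (Zpost_gt0 hp l0 reg G).
under [RHS]eq_bigr do rewrite -mulrA; rewrite -[RHS]mulr_sumr; congr (_ * _).
apply: (canLR (mulfK z0)); rewrite mulr_suml; apply: eq_bigr => X _.
rewrite part_setT mulr_sumr; apply: eq_bigr => x _; ring.
Qed.

Lemma rep_label_sum theta : 0 < theta ->
  rep d (fun X x : labeling n => `|M X| / n%:R) <= theta / 2 + K ^+ 2 / (2 * theta * n%:R).
Proof.
move=> t0; have N0 : 0 < n%:R :> R by rewrite ltr0n regime_n_gt0.
apply: (@le_trans _ _ (rep d (fun X x : labeling n => theta / 2 + (2 * theta * n%:R ^+ 2)^-1 * M X ^+ 2))).
  apply: (rep_le hp l0 reg) => X x.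
  have := norm_le_sqr (M X / n%:R) t0; rewrite normrM [X in _ * X <= _]ger0_norm ?invr_ge0 ?(ltW N0)//.
  move/le_trans; apply; rewrite lerD2l le_eqVlt; apply/orP; left; apply/eqP.
  by field; rewrite !gt_eqF.
rewrite repD (rep_cst hp l0 reg) repZ (rep_fst (fun X : labeling n => M X ^+ 2)) lerD2l.
have c0 : 0 <= (2 * theta * n%:R ^+ 2)^-1 by rewrite invr_ge0 !mulr_ge0 ?exprn_ge0 ?(ltW N0)// ltW.
apply: (le_trans (ler_wpM2l c0 (label_sum_sqr hp n))).
by rewrite le_eqVlt; apply/orP; left; apply/eqP; field; rewrite !gt_eqF.
Qed.

Lemma rep_overlap_lower theta : 0 < theta ->
  2 / g ^+ 2 * (rep d (absovl n) - K * (theta / 2 + K ^+ 2 / (2 * theta * n%:R))) <=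
  rep d (fun X x : labeling n => overlap x X).
Proof.
move=> t0; have k0 := K0; have n0 := regime_n_gt0.
have g2 : 0 < 2 / g ^+ 2 by rewrite divr_gt0// exprn_gt0// sgap_gt0.
apply: (@le_trans _ _ (rep d (fun X x : labeling n => 2 / g ^+ 2 * (`|ovl s X x| / n%:R + (- K) * (`|M X| / n%:R))))).
  rewrite repZ repD repZ; apply: ler_wpM2l; first exact: ltW.
  have := ler_wpM2l (ltW k0) (rep_label_sum t0); lra.
by apply: (rep_le hp l0 reg) => X x; rewrite mulNr; exact: overlap_lower.
Qed.

(** [theta] passes from the absolute overlap to its square, and [theta'] from pair correlations to
    their squares. The bound does not involve [x]. *)
Lemma posterior_overlap_upper (G : graph n) (x : labeling n) theta theta' : 0 < theta -> 0 < theta' ->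
  \sum_X post d G X * overlap x X <=
  2 / g ^+ 2 * (theta / 2 * part [set: labeling n] (post d G) +
    K ^+ 2 / (2 * theta) * (theta' / 2 * part [set: labeling n] (post d G) +
      (2 * theta')^-1 * ((\sum_X \sum_x post d G X * post d G x * (ovl s X x / n%:R) ^+ 2) /
         part [set: labeling n] (post d G))) +
    K * \sum_X post d G X * (`|M X| / n%:R)).
Proof.
move=> t0 t'0; have n0 := regime_n_gt0; have N0 : 0 < n%:R :> R by rewrite ltr0n.
have Z0 := Zpost_gt0 hp l0 reg G; rewrite part_setT in Z0 *.
have v0 X : 0 <= post d G X by apply: ltW; exact: (post_pos hp l0 reg).
set v := post d G in v0 Z0 *; set Z := \sum_i v i in Z0 *.
have g2 : 0 < 2 / g ^+ 2 by rewrite divr_gt0// exprn_gt0// sgap_gt0.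
apply: (le_trans (ler_sum _ (fun X _ => ler_wpM2l (v0 X) (overlap_upper x X n0)))).
under eq_bigr do rewrite mulrCA mulrDr.
rewrite -mulr_sumr big_split/=; apply: ler_wpM2l; first exact: ltW.
apply: lerD; last first.
  by rewrite mulr_sumr; apply: ler_sum => X _; rewrite mulrCA.
apply: (@le_trans _ _ (\sum_X (theta / 2 * v X + (2 * theta * n%:R ^+ 2)^-1 * (v X * ovl s x X ^+ 2)))).
  apply: ler_sum => X _.
  have := ler_wpM2l (v0 X) (norm_le_sqr (ovl s x X / n%:R) t0).
  rewrite normrM [X in _ * (_ * X) <= _]ger0_norm ?invr_ge0 ?(ltW N0)//.
  move/le_trans; apply; rewrite le_eqVlt; apply/orP; left; apply/eqP.
  by field; rewrite !gt_eqF.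
rewrite big_split/= -!mulr_sumr -/Z lerD2l.
have c0 : 0 <= (2 * theta * n%:R ^+ 2)^-1 by rewrite invr_ge0 !mulr_ge0 ?exprn_ge0 ?(ltW N0)// ltW.
apply: (le_trans (ler_wpM2l c0 (second_moment_le x t'0 Z0))); rewrite -/Z.
have -> : \sum_X \sum_x v X * v x * (ovl s X x / n%:R) ^+ 2 =
    n%:R ^- 2 * \sum_X \sum_x v X * v x * ovl s X x ^+ 2.
  rewrite mulr_sumr; apply: eq_bigr => X _; rewrite mulr_sumr; apply: eq_bigr => y _.
  by rewrite expr_div_n; ring.
rewrite le_eqVlt; apply/orP; left; apply/eqP.
by field; rewrite !gt_eqF.
Qed.

(** The pointwise bound is averaged over the estimate and the graph, using that Z has null mean 1;
    the square of the overlap per vertex is at most [K ^+ 2] times its absolute value. *)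
Lemma expected_overlap_upper (est : estimator R n) theta theta' : 0 < theta -> 0 < theta' ->
  (expected_overlap p lambda d est <=
  (2 / g ^+ 2 * (theta / 2 +
    K ^+ 2 / (2 * theta) * (theta' / 2 + (2 * theta')^-1 * (K ^+ 2 * rep d (absovl n))) +
    K * (theta / 2 + K ^+ 2 / (2 * theta * n%:R))))%:E)%E.
Proof.
move=> t0 t'0; have n0 := regime_n_gt0; have N0 : 0 < n%:R :> R by rewrite ltr0n.
have g2 : 0 < 2 / g ^+ 2 by rewrite divr_gt0// exprn_gt0// sgap_gt0.
have k0 := K0.
have -> : expected_overlap p lambda d est =
  (\sum_(G : graph n) base_mass d G * \sum_x est_prob est G x * \sum_X post d G X * overlap x X)%:E.
  rewrite /expected_overlap exchange_big/= -sumEFin; apply: eq_bigr => G _.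
  have hX (X : labeling n) : ((sbm_mass p lambda d X G)%:E *
      'E_(seed_law est)[fun u => overlap (@estimate R n est G u) X] =
      (base_mass d G * post d G X * \sum_x est_prob est G x * overlap x X)%:E)%E.
    rewrite (expectation_est est G (f := fun x => overlap x X)) ?regime_massE//.
    by move=> x; exact: overlap_ge0.
  rewrite (eq_bigr _ (fun X _ => hX X)) sumEFin; congr (_%:E).
  under [LHS]eq_bigr do rewrite -mulrA; rewrite -mulr_sumr; congr (_ * _).
  under [LHS]eq_bigr do rewrite mulr_sumr; rewrite exchange_big/=; apply: eq_bigr => x _.
  by rewrite mulr_sumr; apply: eq_bigr => X _; rewrite mulrCA.
rewrite lee_fin.
pose b (G : graph n) := 2 / g ^+ 2 * (theta / 2 * part [set: labeling n] (post d G) +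
    K ^+ 2 / (2 * theta) * (theta' / 2 * part [set: labeling n] (post d G) +
      (2 * theta')^-1 * ((\sum_X \sum_x post d G X * post d G x * (ovl s X x / n%:R) ^+ 2) /
         part [set: labeling n] (post d G))) +
    K * \sum_X post d G X * (`|M X| / n%:R)).
apply: (@le_trans _ _ (\sum_(G : graph n) base_mass d G * b G)).
  apply: ler_sum => G _; rewrite ler_wpM2l ?(base_mass_ge0 reg)//.
  rewrite -[leRHS]mul1r -(sum_est_prob est G) mulr_suml; apply: ler_sum => x _.
  by rewrite ler_wpM2l ?est_prob_ge0//; exact: posterior_overlap_upper.
have -> : \sum_(G : graph n) base_mass d G * b G = 2 / g ^+ 2 * (theta / 2 +
    K ^+ 2 / (2 * theta) * (theta' / 2 + (2 * theta')^-1 * rep d (fun X x : labeling n => (ovl s X x / n%:R) ^+ 2)) +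
    K * rep d (fun X x : labeling n => `|M X| / n%:R)).
  rewrite (rep_fst (fun X : labeling n => `|M X| / n%:R)).
  have -> : \sum_(X : labeling n) labeling_mass p X * (`|M X| / n%:R) =
     \sum_(G : graph n) base_mass d G * \sum_X post d G X * (`|M X| / n%:R).
    under [LHS]eq_bigr do rewrite -(sum_base_post l0 reg) mulr_suml.
    rewrite exchange_big/=; apply: eq_bigr => G _; rewrite mulr_sumr.
    by apply: eq_bigr => X _; rewrite mulrA.
  transitivity (2 / g ^+ 2 * (theta / 2 * (\sum_(G : graph n) base_mass d G * part [set: labeling n] (post d G)) +
    K ^+ 2 / (2 * theta) * (theta' / 2 * (\sum_(G : graph n) base_mass d G * part [set: labeling n] (post d G)) +
      (2 * theta')^-1 * rep d (fun X x : labeling n => (ovl s X x / n%:R) ^+ 2)) +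
    K * \sum_(G : graph n) base_mass d G * \sum_X post d G X * (`|M X| / n%:R))).
    rewrite /rep !mulr_sumr -!big_split/= !mulr_sumr -!big_split/= mulr_sumr.
    by apply: eq_bigr => G _; rewrite /b; ring.
  by rewrite (sum_base_Z l0 reg) !mulr1.
apply: ler_wpM2l; first exact: ltW.
apply: lerD; last by apply: ler_wpM2l; [exact: ltW|exact: rep_label_sum].
rewrite lerD2l; apply: ler_wpM2l; first by rewrite divr_ge0 ?sqr_ge0// mulr_ge0// ltW.
rewrite lerD2l; apply: ler_wpM2l; first by rewrite invr_ge0 mulr_ge0// ltW.
rewrite -repZ; apply: (rep_le hp l0 reg) => X x.
have e : `|ovl s X x| / n%:R = `|ovl s X x / n%:R|.
  by rewrite normrM [X in _ = _ * X]ger0_norm ?invr_ge0 ?(ltW N0).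
have h : `|ovl s X x / n%:R| <= K ^+ 2.
  by rewrite -e ler_pdivrMr// mulrC; exact: ovl_le.
by rewrite e -[_ ^+ 2 in leLHS]real_normK ?num_real// expr2 ler_wpM2r.
Qed.

End Fixed.

End Estimation.

Section Solvability.
Context {R : realType} (p lambda : R).
Hypotheses (hp : 0 < p < 1) (l0 : 0 < lambda).
Local Notation K := (sbound p).
Local Notation g := (sgap p).
Local Notation F q := (free_energy p lambda q).
Implicit Types (d c theta : R) (n : nat).

Definition bayes_labeling d n (G : graph n) : labeling n :=
  [arg max_(x > [ffun=> ord0] : labeling n)
     (\sum_(X : labeling n) sbm_mass p lambda d X G * overlap x X)]%O.

Lemma measurable_cst_estimate n (h : graph n -> labeling n) (G : graph n) (x : labeling n) :
  measurable [set u : unit | h G = x].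
Proof. by []. Qed.

Definition bayes_estimator d n : estimator R n :=
  Estimator (dirac tt) (measurable_cst_estimate (bayes_labeling d (n := n))).

(** For each graph the maximum over labelings is at least the average over a posterior sample
    [x]. *)
Lemma bayes_overlap eta d n : regime p lambda eta d n ->
  ((rep p lambda d (fun X x : labeling n => overlap x X))%:E <=
   expected_overlap p lambda d (bayes_estimator d n))%E.
Proof.
move=> reg; rewrite /expected_overlap.
have hX (X : labeling n) (G : graph n) : ((sbm_mass p lambda d X G)%:E *
     'E_(dirac tt)[fun u : unit => overlap (@estimate R n (bayes_estimator d n) G u) X] =
     (sbm_mass p lambda d X G * overlap (bayes_labeling d G) X)%:E)%E.
  by rewrite (expectation_cst _ (overlap (bayes_labeling d G) X)) EFinM.
rewrite (eq_bigr _ (fun X _ => eq_bigr _ (fun G _ => hX X G))).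
under eq_bigr do rewrite sumEFin.
rewrite sumEFin lee_fin exchange_big/=; apply: ler_sum => G _.
have vp := post_pos hp l0 reg G; have Z0 := Zpost_gt0 hp l0 reg G.
rewrite mulrA ler_pdivrMr// part_setT.
have -> : base_mass d G * (\sum_X \sum_x post p lambda d G X * post p lambda d G x * overlap x X) =
   \sum_x post p lambda d G x * \sum_(X : labeling n) sbm_mass p lambda d X G * overlap x X.
  rewrite exchange_big mulr_sumr/=; apply: eq_bigr => x _; rewrite !mulr_sumr.
  by apply: eq_bigr => X _; rewrite (regime_massE hp reg); ring.
rewrite mulr_sumr; apply: ler_sum => x _; rewrite mulrC ler_wpM2r//; first exact: ltW.
by rewrite /bayes_labeling; case: arg_maxP => //= y _; exact.
Qed.

Lemma solvable_of_pos q : 0 <= q -> 0 < F q -> solvable_sbm p lambda.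
Proof.
move=> q0 F0; have [c c0 hc] := overlap_detected hp l0 q0 F0.
have K1 := sbound_ge1 p; have k0 : 0 < K by lra.
have g2 : 0 < 2 / g ^+ 2 by rewrite divr_gt0// exprn_gt0// sgap_gt0.
(* The centring term then costs c / 4 from [theta], and another c / 4 once [n] is large. *)
pose theta := c / (2 * K); have t0 : 0 < theta by rewrite divr_gt0// mulr_gt0.
have e1 : K * (theta / 2) = c / 4 by rewrite /theta; field; rewrite gt_eqF.
clearbody theta.
exists (fun d n => bayes_estimator d n).
apply: (@lt_le_trans _ _ (2 / g ^+ 2 * (c / 2))%:E); first by rewrite lte_fin mulr_gt0// divr_gt0.
apply: einf_einf_ge.
have := eventually_dn_and hc (eventually_dn_ge (2 * K ^+ 3 / (theta * c))).
apply: eventually_dn_imp => d n [[[eta reg] hr] hn].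
apply: le_trans (bayes_overlap reg); rewrite lee_fin.
apply: le_trans (rep_overlap_lower hp l0 reg t0).
rewrite ler_wpM2l//; first exact: ltW.
have N0 : 0 < n%:R :> R by rewrite ltr0n; exact: regime_n_gt0 reg.
have e2 : K * (K ^+ 2 / (2 * theta * n%:R)) <= c / 4.
  rewrite mulrA; have -> : K * K ^+ 2 = K ^+ 3 by ring.
  rewrite ler_pdivrMr; last by rewrite !mulr_gt0.
  move: hn; rewrite ler_pdivrMr ?mulr_gt0//; lra.
move: hr; rewrite mulrDr e1; lra.
Qed.

Lemma not_solvable c : 0 < c -> (forall q, 0 <= q -> F q <= - (c * q ^+ 2)) ->
  ~ solvable_sbm p lambda.
Proof.
move=> c0 hF [est]; apply/negP; rewrite -leNgt; apply/lee_addgt0Pr => e e0; rewrite add0e.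
have K1 := sbound_ge1 p; have k0 : 0 < K by lra.
have g2 : 0 < 2 / g ^+ 2 by rewrite divr_gt0// exprn_gt0// sgap_gt0.
(* The parameters [theta], [theta'], [rho] are chosen in this order, each against the coefficients
   fixed by the previous ones, so that all contributions add up to at most [a]. *)
pose a := e / (2 / g ^+ 2); have a0 : 0 < a by rewrite divr_gt0.
have ae : 2 / g ^+ 2 * a = e by rewrite /a mulrCA mulfV ?mulr1// gt_eqF.
pose theta := a / (4 * K); have t0 : 0 < theta by rewrite divr_gt0// mulr_gt0.
have e1 : K * theta = a / 4 by rewrite /theta; field; rewrite gt_eqF.
clearbody a theta.
pose b := K ^+ 2 / (2 * theta); have b0 : 0 < b by rewrite divr_gt0 ?exprn_gt0// mulr_gt0.
pose theta' := a / (4 * b); have t'0 : 0 < theta' by rewrite divr_gt0// mulr_gt0.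
pose h := b * ((2 * theta')^-1 * K ^+ 2).
have h0 : 0 < h.
  apply: mulr_gt0 => //; apply: mulr_gt0; last exact: exprn_gt0.
  by rewrite invr_gt0; exact: mulr_gt0.
pose rho := a / (4 * h); have r0 : 0 < rho by rewrite divr_gt0// mulr_gt0.
apply: einf_einf_le.
have := eventually_dn_and (overlap_vanishes hp l0 c0 hF r0) (eventually_dn_ge (4 * K ^+ 3 / (theta * a))).
apply: eventually_dn_imp => d n [[[eta reg] hr] hn].
apply: (le_trans (expected_overlap_upper hp l0 reg (est d n) t0 t'0)); rewrite lee_fin.
rewrite -[leRHS]ae ler_wpM2l//; first exact: ltW.
have N0 : 0 < n%:R :> R by rewrite ltr0n; exact: regime_n_gt0 reg.
rewrite -/b; set y := rep _ _ _ _ in hr *.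
have e1' : theta <= a / 4 by rewrite -e1 ler_peMl// ltW.
have e2 : K * (K ^+ 2 / (2 * theta * n%:R)) <= a / 8.
  rewrite mulrA; have -> : K * K ^+ 2 = K ^+ 3 by ring.
  rewrite ler_pdivrMr; last by rewrite !mulr_gt0.
  move: hn; rewrite ler_pdivrMr ?mulr_gt0//; lra.
have e3 : b * theta' = a / 4 by rewrite /theta'; field; rewrite gt_eqF.
have e4 : b * ((2 * theta')^-1 * (K ^+ 2 * y)) <= a / 4.
  have -> : b * ((2 * theta')^-1 * (K ^+ 2 * y)) = h * y by rewrite /h; ring.
  have <- : h * rho = a / 4 by rewrite /rho; field; rewrite gt_eqF.
  by rewrite ler_wpM2l// ltW.
rewrite !mulrDr; lra.
Qed.

End Solvability.

(** * The threshold *)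

Section Threshold.
Context {R : realType} (p : R).
Hypothesis hp : 0 < p < 1.
Implicit Types (lambda q : R).

Lemma eq_psi lambda lambda' q q' : 0 <= lambda * q -> lambda * q = lambda' * q' ->
  psi p lambda q = psi p lambda' q'.
Proof.
move=> lq e; have [m hm ->] := psi_mean hp lq; rewrite e in lq hm.
rewrite /psi (free_energyE hp lq hm); ring.
Qed.

Lemma free_energy0 lambda : free_energy p lambda 0 = 0.
Proof. by have := psi0 hp lambda; rewrite /psi expr0n/= mulr0 addr0. Qed.

(* [free_energy p lambda q + (lambda q) ^ 2 / (4 lambda)] depends on [lambda * q] only. *)
Lemma free_energy_le lambda lambda' : 0 < lambda < lambda' ->
  (forall q, 0 <= q -> free_energy p lambda' q <= 0) ->
  forall q, 0 <= q ->
    free_energy p lambda q <= - (lambda ^+ 2 / 4 * (lambda^-1 - lambda'^-1) * q ^+ 2).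
Proof.
move=> /andP[l0 ll] h q q0; have l'0 : 0 < lambda' by apply: lt_trans ll.
have lq : 0 <= lambda * q by rewrite mulr_ge0// ltW.
have q'0 : 0 <= lambda * q / lambda' by rewrite divr_ge0// ltW.
have e : lambda * q = lambda' * (lambda * q / lambda') by rewrite mulrCA mulfV ?mulr1// gt_eqF.
have := eq_psi lq e; rewrite /psi => ep; have hq := h _ q'0.
have e1 : lambda' / 4 * (lambda * q / lambda') ^+ 2 - lambda / 4 * q ^+ 2 =
    - (lambda ^+ 2 / 4 * (lambda^-1 - lambda'^-1) * q ^+ 2) by field; rewrite !gt_eqF.
rewrite -e1; move: ep hq.
by move: (free_energy p lambda q) (free_energy p lambda' _) => A A'; lra.
Qed.

Lemma curvature_gt0 lambda lambda' : 0 < lambda < lambda' ->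
  0 < lambda ^+ 2 / 4 * (lambda^-1 - lambda'^-1).
Proof.
move=> /andP[l0 ll]; have l'0 : 0 < lambda' by apply: lt_trans ll.
by rewrite mulr_gt0 ?divr_gt0 ?exprn_gt0// subr_gt0 ltf_pV2.
Qed.

(** The supremum is identically 0 on the interval (0, lambda'), hence differentiable at [lambda],
    and the quadratic gap makes 0 the only maximizer there. The strict inequality provides the
    neighbourhood and the gap. *)
Lemma le_lambda_c lambda lambda' : 0 < lambda < lambda' ->
  (forall q, 0 <= q -> free_energy p lambda' q <= 0) -> (lambda%:E <= lambda_c p)%E.
Proof.
move=> ll h; have [l0 l1] := andP ll.
have neg x q : 0 < x < lambda' -> 0 <= q -> free_energy p x q <= 0.
  move=> xl q0; apply: (le_trans (free_energy_le xl h q0)).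
  by rewrite oppr_le0 mulr_ge0 ?sqr_ge0// ltW// curvature_gt0.
have sup0 x : 0 < x < lambda' -> sup_free_energy p x = 0.
  move=> xl; apply/eqP; rewrite eq_le; apply/andP; split.
    by apply: ge_sup; [exists 0; exists 0; rewrite ?free_energy0/=|move=> _ [q q0 <-]; exact: neg].
  apply: ub_le_sup; last by exists 0; rewrite ?free_energy0/=.
  by exists 0 => _ [q q0 <-]; exact: neg.
apply: ereal_sup_ubound; exists lambda => //; split; first split=> //.
  apply: (@near_eq_derivable _ R R (cst 0)); last exact: derivable_cst.
  near=> x; rewrite sup0//; apply/andP; split.
    by near: x; exact: lt_nbhsr.
  by near: x; exact: lt_nbhsl.
rewrite /is_q_star; apply/seteqP; split=> q /=.
  move=> [q0 /(_ 0 (lexx _))]; rewrite free_energy0 => Fq.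
  apply/eqP; rewrite eq_le q0 andbT leNgt; apply/negP => qp.
  have := free_energy_le ll h q0; have : 0 < lambda ^+ 2 / 4 * (lambda^-1 - lambda'^-1) * q ^+ 2.
    by rewrite mulr_gt0 ?exprn_gt0// curvature_gt0.
  lra.
move=> ->; split; first exact: lexx.
by move=> q' q'0; rewrite [leRHS]free_energy0; exact: neg.
Unshelve. all: by end_near.
Qed.

(** If the free energy were nonpositive at [lambda], every smaller positive parameter would be at
    most [lambda_c p], leaving no room between the two. *)
Lemma above_threshold lambda : 0 < lambda -> (lambda_c p < lambda%:E)%E ->
  exists2 q, 0 <= q & 0 < free_energy p lambda q.
Proof.
move=> l0 lc; apply: contrapT => nh.
have h q : 0 <= q -> free_energy p lambda q <= 0.
  by move=> q0; rewrite leNgt; apply/negP => Fq; apply: nh; exists q.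
have le x : 0 < x < lambda -> (x%:E <= lambda_c p)%E by move=> xl; exact: le_lambda_c h.
(* This excludes [lambda_c p = -oo] and makes the midpoint used below positive. *)
have half : 0 < lambda / 2 < lambda by lra.
have lh := le _ half; move: lc lh le.
case: (lambda_c p) => [r| |] //; rewrite lte_fin lee_fin => rl hr le.
have mid : 0 < (r + lambda) / 2 < lambda by lra.
have := le _ mid; rewrite lee_fin; lra.
Qed.

Lemma below_threshold lambda : 0 < lambda -> (lambda%:E < lambda_c p)%E ->
  exists2 c, 0 < c & forall q, 0 <= q -> free_energy p lambda q <= - (c * q ^+ 2).
Proof.
move=> l0 /ereal_sup_gt[_ [lambda' [_ hm] <-]]; rewrite lte_fin => ll.
have l01 : 0 < lambda < lambda' by rewrite l0.
exists (lambda ^+ 2 / 4 * (lambda^-1 - lambda'^-1)); first exact: curvature_gt0.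
apply: free_energy_le => // q q0.
have [_ /(_ q q0)] : maximizers p lambda' 0 by rewrite hm.
by rewrite [leRHS]free_energy0.
Qed.

End Threshold.

Theorem theorem9 (R : realType) (p lambda : R)
    (hp : 0 < p < 1) (hlambda : 0 < lambda) :
  ((lambda_c p < lambda%:E)%E -> solvable_sbm p lambda) /\
  ((lambda%:E < lambda_c p)%E -> ~ solvable_sbm p lambda).
Proof.
split=> [/(above_threshold hp hlambda)[q q0 F0]|/(below_threshold hp hlambda)[c c0 hF]].
  exact: solvable_of_pos F0.
exact: not_solvable hF.
Qed.
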